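(* Let $(\mathbb{C},\boxtimes,I)$ be a symmetric normal oplax monoidal closed double category such that: (I) $\mathbb{C}$ is fibrant; (II) each category $\mathrm{Mnd}_A(\mathbb{C})$ has finite coproducts; (III) $\mathbb{C}_0$ has equalisers; (IV) $\mathbb{C}$ has 1-tabulators; (V) each forgetful functor $\mathrm{Mnd}_A(\mathbb{C})\to\mathrm{End}_A(\mathbb{C})$ has a left adjoint; (VI) each $\mathrm{Mnd}_A(\mathbb{C})$ has coequalisers; (VII) $\mathbb{C}$ has local equalisers. Then the symmetric multicategory $\mathsf{CMultMnd}(\mathbb{C})$ of monads and commuting monad multimorphisms is closed. That is, for all monads $(B,b),(C,c)$ there exist a monad $[(B,b),(C,c)]$ and a commuting binary monad multimorphism $$(e^c,\varepsilon^c_1,\varepsilon^c_2)\colon[(B,b),(C,c)],(B,b)\to(C,c)$$ composition with which establishes a bijection between commuting monad multimorphisms $(f,\phi_1,\dots,\phi_n,\psi)\colon(A_1,a_1),\dots,(A_n,a_n),(B,b)\to(C,c)$ and commuting monad multimorphisms $(\bar f,\bar\phi_1,\dots,\bar\phi_n)\colon(A_1,a_1),\dots,(A_n,a_n)\to[(B,b),(C,c)]$, for all monads $(A_1,a_1),\dots,(A_n,a_n)$.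
   Context: Double categories. A (pseudo) double category $\mathbb{C}$ has a category $\mathbb{C}_0$ (objects and vertical maps), a category $\mathbb{C}_1$ (horizontal maps and 2-morphisms), source and target functors $\mathfrak{s},\mathfrak{t}\colon\mathbb{C}_1\to\mathbb{C}_0$, and functors $\circ\colon\mathbb{C}_1\times_{\mathbb{C}_0}\mathbb{C}_1\to\mathbb{C}_1$ and $\mathrm{id}\colon\mathbb{C}_0\to\mathbb{C}_1$, associative and unital up to coherent natural globular isomorphism (coherence cells are suppressed). Write $x\colon A\nrightarrow B$ for a horizontal map with $\mathfrak{s}(x)=A$, $\mathfrak{t}(x)=B$, and $y\circ x\colon A\nrightarrow C$ for its composite with $y\colon B\nrightarrow C$. A 2-morphism $\alpha\colon x\to y$ lies over the pair of vertical maps $(\mathfrak{s}(\alpha),\mathfrak{t}(\alpha))$, and over $f$ if both equal $f$; it is globular if both are identities. $\mathbb{C}[A,B]$ is the category of horizontal maps $A\nrightarrow B$ and globular 2-morphisms. $\mathbb{C}$ is fibrant if $(\mathfrak{s},\mathfrak{t})\colon\mathbb{C}_1\to\mathbb{C}_0\times\mathbb{C}_0$ is a Grothendieck fibration. $\mathbb{C}$ has 1-tabulators if $\mathrm{id}\colon\mathbb{C}_0\to\mathbb{C}_1$ has a right adjoint. $\mathbb{C}$ has local equalisers if each $\mathbb{C}[A,B]$ has equalisers. Monads. $\mathrm{End}(\mathbb{C})$ has objects pairs $(A,x\colon A\nrightarrow A)$ and maps $(f,\phi)\colon(A,x)\to(B,y)$ with $f\colon A\to B$ vertical and $\phi\colon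 x\to y$ a 2-morphism over $f$. A monad $(A,a)$ is an object of $\mathrm{End}(\mathbb{C})$ with globular $\mu\colon a\circ a\to a$, $\eta\colon\mathrm{id}_A\to a$ satisfying associativity and unit laws; a monad map is a map $(f,\phi)$ of $\mathrm{End}(\mathbb{C})$ with $\phi\mu=\mu(\phi\circ\phi)$ and $\phi\eta=\eta\,\mathrm{id}_f$. These form $\mathrm{Mnd}(\mathbb{C})$. $\mathrm{End}_A(\mathbb{C})=\mathbb{C}[A,A]$ and $\mathrm{Mnd}_A(\mathbb{C})$ are the fibres over $A$ of the forgetful functors to $\mathbb{C}_0$. The discrete monad on $A$ is $\Delta_A=(A,\mathrm{id}_A)$. Oplax monoidal structure. An oplax monoidal structure $(\boxtimes,I)$ on $\mathbb{C}$ consists of oplax double functors $\boxtimes\colon\mathbb{C}\times\mathbb{C}\to\mathbb{C}$ and $I\colon\mathbf{1}\to\mathbb{C}$ with invertible vertical transformations for associativity and units satisfying the usual coherence axioms. Explicitly: monoidal structures $(\boxtimes,I_0)$ on $\mathbb{C}_0$ and $(\boxtimes,I_1)$ on $\mathbb{C}_1$ with $\mathfrak{s},\mathfrak{t}$ strict monoidal, and globular 2-morphisms $\xi\colon(y_1\circ x_1)\boxtimes(y_2\circ x_2)\to(y_1\boxtimes y_2)\circ(x_1\boxtimes x_2)$, $\upsilon\colon\mathrm{id}_{A_1}\boxtimes\mathrm{id}_{A_2}\to\mathrm{id}_{A_1\boxtimes A_2}$, $\delta\colon I_1\to I_1\circ I_1$, $\iota\colon I_1\to\mathrm{id}_{I_0}$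 making $\boxtimes$ and $I$ oplax double functors and the associativity and unit constraints vertical transformations. It is normal if $\upsilon,\delta,\iota$ are invertible and $\xi$ is invertible whenever $x_1=y_1=\mathrm{id}_{A_1}$ or $x_2=y_2=\mathrm{id}_{A_2}$. It is symmetric if $\mathbb{C}_0$ and $\mathbb{C}_1$ are symmetric monoidal, $\mathfrak{s},\mathfrak{t}$ preserve the symmetries strictly, and the symmetries are compatible with $\xi$ and $\upsilon$ (i.e. form a vertical transformation). It is closed if there are right adjoints $(-)\boxtimes B\dashv\langle B,-\rangle_0$ on $\mathbb{C}_0$ and $(-)\boxtimes y\dashv\langle y,-\rangle_1$ on $\mathbb{C}_1$ such that $\mathfrak{s},\mathfrak{t}$ strictly preserve the internal homs and the evaluation maps. Commuting monad multimorphisms. By normality, tensoring a monad on either side with discrete monads gives a monad (structure built using $\xi^{-1},\upsilon^{-1}$). A monad multimorphism $(f,\phi_1,\dots,\phi_n)\colon(A_1,a_1),\dots,(A_n,a_n)\to(B,b)$ is a vertical map $f\colon A_1\boxtimes\cdots\boxtimes A_n\to B$ with 2-morphisms $\phi_i\colon\mathrm{id}_{A_1}\boxtimes\cdots\boxtimes a_i\boxtimes\cdots\boxtimes\mathrm{id}_{A_n}\to b$ over $f$ such that each $(f,\phi_i)\colon\Delta_{A_1}\boxtimes\cdots\boxtimes(A_i,a_i)\boxtimes\cdots\boxtimes\Delta_{A_n}\to(B,b)$ is a monad map (for $n=0$: a vertical map $I\to B$). For $n=2$, let $\sigma\colon a_1\boxtimes a_2\cong(a_1\circ\mathrm{id})\boxtimes(\mathrm{id}\circ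 a_2)\xrightarrow{\xi}(a_1\boxtimes\mathrm{id}_{A_2})\circ(\mathrm{id}_{A_1}\boxtimes a_2)$ and $\tau\colon a_1\boxtimes a_2\cong(\mathrm{id}\circ a_1)\boxtimes(a_2\circ\mathrm{id})\xrightarrow{\xi}(\mathrm{id}_{A_1}\boxtimes a_2)\circ(a_1\boxtimes\mathrm{id}_{A_2})$; $(f,\phi_1,\phi_2)$ is commuting if $\mu(\phi_1\circ\phi_2)\sigma=\mu(\phi_2\circ\phi_1)\tau$. In general $(f,\vec\phi)$ is commuting if for all $i<j$ the binary multimorphism $(f,\phi_i,\phi_j)$ with inputs $\Delta_{A_1}\boxtimes\cdots\boxtimes(A_i,a_i)\boxtimes\Delta_{A_{i+1}}\boxtimes\cdots\boxtimes\Delta_{A_{j-1}}$ and $(A_j,a_j)\boxtimes\Delta_{A_{j+1}}\boxtimes\cdots\boxtimes\Delta_{A_n}$ is commuting. Composition: for $(g,\vec\theta)\colon(B_1,b_1),\dots,(B_m,b_m)\to(C,c)$ and $(f,\vec\phi)\colon(A_1,a_1),\dots,(A_n,a_n)\to(B_i,b_i)$, the composite $(g,\vec\theta)\circ_i(f,\vec\phi)$ has vertical map $g(1\boxtimes f\boxtimes1)$ and 2-morphisms $\theta_k(1\boxtimes\mathrm{id}_f\boxtimes1)$ (with the evident placement and normality isomorphisms) for inputs $b_k$, $k\neq i$, and $\theta_i(1\boxtimes\phi_j\boxtimes1)$ for inputs $a_j$; permutations act via the symmetry of $\boxtimes$. Monads and commuting monad multimorphisms form a symmetric multicategory $\mathsf{CMultMnd}(\mathbb{C})$.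 *)

(* Defs.v *)
From mathcomp Require Import ssreflect ssrfun ssrbool eqtype ssrnat fintype.
From Stdlib Require Import ProofIrrelevance.

Set Implicit Arguments.
Unset Strict Implicit.
Unset Printing Implicit Defensive.

Declare Scope dbl_scope.
Delimit Scope dbl_scope with dbl.
Local Open Scope dbl_scope.

Reserved Notation "g ∘ f" (at level 40, left associativity).
Reserved Notation "β • α" (at level 45, left associativity).
Reserved Notation "y ⊙ x" (at level 37, left associativity).
Reserved Notation "β ⊚ α" (at level 37, left associativity).
Reserved Notation "A ⊠ B" (at level 34, left associativity).
Reserved Notation "f ⊠v g" (at level 34, left associativity).
Reserved Notation "x ⊠h y" (at level 34, left associativity).
Reserved Notation "α ⊠c β" (at level 34, left associativity).
Reserved Notation "α ≡ β" (at level 70, no associativity).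

Record Category := {
  ob :> Type;
  Hom : ob -> ob -> Type;
  idm : forall A, Hom A A;
  mcomp : forall A B C, Hom B C -> Hom A B -> Hom A C;
  mcompA : forall A B C D (h : Hom C D) (g : Hom B C) (f : Hom A B),
    mcomp h (mcomp g f) = mcomp (mcomp h g) f;
  mcomp1l : forall A B (f : Hom A B), mcomp (idm B) f = f;
  mcomp1r : forall A B (f : Hom A B), mcomp f (idm A) = f }.
Arguments Hom {_}.
Arguments idm {_}.
Notation "g ∘ f" := (mcomp g f) : dbl_scope.

Record Functor (C D : Category) := {
  fob :> C -> D;
  fmap : forall A B : C, Hom A B -> Hom (fob A) (fob B);
  fmap1 : forall A : C, fmap (idm A) = idm (fob A);
  fmapM : forall (A B E : C) (g : Hom B E) (f : Hom A B),
    fmap (g ∘ f) = fmap g ∘ fmap f }.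
Arguments fmap {C D} _ {A B}.

Record Adjunction (C D : Category) (F : Functor C D) (G : Functor D C) := {
  transpose : forall c d, Hom (F c) d -> Hom c (G d);
  untranspose : forall c d, Hom c (G d) -> Hom (F c) d;
  transposeK : forall c d (h : Hom (F c) d), untranspose (transpose h) = h;
  untransposeK : forall c d (k : Hom c (G d)), transpose (untranspose k) = k;
  transpose_natl : forall c c' d (u : Hom c' c) (h : Hom (F c) d),
    transpose (h ∘ fmap F u) = transpose h ∘ u;
  transpose_natr : forall c d d' (v : Hom d d') (h : Hom (F c) d),
    transpose (v ∘ h) = fmap G v ∘ transpose h }.
Arguments untranspose {C D F G} _ {c d}.
Arguments transpose {C D F G} _ {c d}.

Definition counit (C D : Category) (F : Functor C D) (G : Functor D C)
  (adj : Adjunction F G) (d : D) : Hom (F (G d)) d := untranspose adj (idm (G d)).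

Definition has_right_adjoint (C D : Category) (F : Functor C D) : Prop :=
  exists G : Functor D C, inhabited (Adjunction F G).

Definition has_left_adjoint (C D : Category) (G : Functor D C) : Prop :=
  exists F : Functor C D, inhabited (Adjunction F G).

Definition has_equalisers (C : Category) : Prop :=
  forall (A B : C) (f g : Hom A B), exists (E : C) (e : Hom E A),
    f ∘ e = g ∘ e /\
    forall (X : C) (h : Hom X A), f ∘ h = g ∘ h -> exists! k : Hom X E, e ∘ k = h.

Definition has_coequalisers (C : Category) : Prop :=
  forall (A B : C) (f g : Hom A B), exists (Q : C) (q : Hom B Q),
    q ∘ f = q ∘ g /\
    forall (X : C) (h : Hom B X), h ∘ f = h ∘ g -> exists! k : Hom Q X, k ∘ q = h.

Definition has_finite_coproducts (C : Category) : Prop :=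
  forall (n : nat) (X : 'I_n -> C), exists (S : C) (inj : forall i, Hom (X i) S),
    forall (Y : C) (h : forall i, Hom (X i) Y),
      exists! k : Hom S Y, forall i, k ∘ inj i = h i.

Record iso (C : Category) (A B : C) := {
  fwd : Hom A B;
  bwd : Hom B A;
  fwdK : bwd ∘ fwd = idm A;
  bwdK : fwd ∘ bwd = idm B }.

Definition iso_id (C : Category) (A : C) : iso A A :=
  {| fwd := idm A; bwd := idm A; fwdK := mcomp1l _; bwdK := mcomp1l _ |}.

(** C_0 is [vcat]; the objects of C_1 are presented as a family [hor A B] indexed
    by source and target.  [Cell x y] is the set of all maps x -> y in C_1; s and t
    act on them as [lft] and [rgt]. *)
Record VertData := {
  vcat :> Category;
  hor : vcat -> vcat -> Type;
  Cell : forall A B A' B', hor A B -> hor A' B' -> Type;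
  lft : forall A B A' B' (x : hor A B) (y : hor A' B'), Cell x y -> Hom A A';
  rgt : forall A B A' B' (x : hor A B) (y : hor A' B'), Cell x y -> Hom B B';
  Cid : forall A B (x : hor A B), Cell x x;
  Ccomp : forall A B A' B' A'' B'' (x : hor A B) (y : hor A' B') (z : hor A'' B''),
    Cell y z -> Cell x y -> Cell x z;
  lft_id : forall A B (x : hor A B), lft (Cid x) = idm A;
  rgt_id : forall A B (x : hor A B), rgt (Cid x) = idm B;
  lft_comp : forall A B A' B' A'' B'' (x : hor A B) (y : hor A' B') (z : hor A'' B'')
    (β : Cell y z) (α : Cell x y), lft (Ccomp β α) = lft β ∘ lft α;
  rgt_comp : forall A B A' B' A'' B'' (x : hor A B) (y : hor A' B') (z : hor A'' B'')
    (β : Cell y z) (α : Cell x y), rgt (Ccomp β α) = rgt β ∘ rgt α;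
  CcompA : forall A B A' B' A'' B'' A3 B3
    (x : hor A B) (y : hor A' B') (z : hor A'' B'') (w : hor A3 B3)
    (γ : Cell z w) (β : Cell y z) (α : Cell x y),
    Ccomp γ (Ccomp β α) = Ccomp (Ccomp γ β) α;
  Ccomp1l : forall A B A' B' (x : hor A B) (y : hor A' B') (α : Cell x y),
    Ccomp (Cid y) α = α;
  Ccomp1r : forall A B A' B' (x : hor A B) (y : hor A' B') (α : Cell x y),
    Ccomp α (Cid x) = α }.
Arguments hor {_}.
Arguments Cid {_ A B}.

Record HorOb (C : VertData) := mkHor {
  hsrc : C; htgt : C; hmap : hor hsrc htgt }.
Arguments mkHor {C hsrc htgt}.

Definition C1 (C : VertData) : Category := {|
  ob := HorOb C;
  Hom := fun X Y => Cell (hmap X) (hmap Y);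
  idm := fun X => Cid (hmap X);
  mcomp := fun X Y Z β α => Ccomp β α;
  mcompA := fun X Y Z W γ β α => CcompA γ β α;
  mcomp1l := fun X Y α => Ccomp1l α;
  mcomp1r := fun X Y α => Ccomp1r α |}.

(** 2-morphisms over a prescribed pair of vertical maps (f, g).  Two such are
    compared by [≡], i.e. as maps of C_1, so that an equation may relate
    expressions whose boundaries are only provably equal. *)
Record cell (C : VertData) (A B A' B' : C) (f : Hom A A') (g : Hom B B')
    (x : hor A B) (y : hor A' B') := mkcell {
  ucell :> Cell x y;
  lftE : lft ucell = f;
  rgtE : rgt ucell = g }.
Notation "α ≡ β" := (ucell α = ucell β) : dbl_scope.
Notation gcell := (cell (idm _) (idm _)).

Definition cell_of (C : VertData) (A B A' B' : C) (x : hor A B) (y : hor A' B')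
  (α : Cell x y) : cell (lft α) (rgt α) x y := mkcell erefl erefl.

Definition cid (C : VertData) (A B : C) (x : hor A B) : gcell x x :=
  mkcell (lft_id x) (rgt_id x).

Section VertComp.
Variable C : VertData.
Context (A B A' B' A'' B'' : C) (f' : Hom A' A'') (g' : Hom B' B'')
  (f : Hom A A') (g : Hom B B') (x : hor A B) (y : hor A' B') (z : hor A'' B'').

Lemma vc_lft (β : cell f' g' y z) (α : cell f g x y) : lft (Ccomp β α) = f' ∘ f.
Proof. by rewrite lft_comp !lftE. Qed.
Lemma vc_rgt (β : cell f' g' y z) (α : cell f g x y) : rgt (Ccomp β α) = g' ∘ g.
Proof. by rewrite rgt_comp !rgtE. Qed.

Definition vc (β : cell f' g' y z) (α : cell f g x y) : cell (f' ∘ f) (g' ∘ g) x z :=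
  mkcell (vc_lft β α) (vc_rgt β α).
End VertComp.
Notation "β • α" := (vc β α) : dbl_scope.

Definition recell (C : VertData) (A B A' B' : C) (f f' : Hom A A') (g g' : Hom B B')
  (x : hor A B) (y : hor A' B') (ef : f = f') (eg : g = g') (α : cell f g x y) :
  cell f' g' x y := mkcell (etrans (lftE α) ef) (etrans (rgtE α) eg).

(** An isomorphism of C_1 lying over the pair of isomorphisms (i, j). *)
Record ciso (C : VertData) (A B A' B' : C) (i : iso A A') (j : iso B B')
    (x : hor A B) (y : hor A' B') := {
  cfwd :> cell (fwd i) (fwd j) x y;
  cbwd : cell (bwd i) (bwd j) y x;
  cfwdK : cbwd • cfwd ≡ cid x;
  cbwdK : cfwd • cbwd ≡ cid y }.
Notation giso := (ciso (iso_id _) (iso_id _)).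

(** Horizontal composition is a functor on the pullback of t and s: its arguments
    are a pair of 2-morphisms with a common boundary g. *)
Record HorData := {
  vdata :> VertData;
  hid : forall A : vdata, hor A A;
  hidm : forall (A B : vdata) (f : Hom A B), cell f f (hid A) (hid B);
  hcomp : forall A B E : vdata, hor B E -> hor A B -> hor A E;
  hc : forall (A B E A' B' E' : vdata) (f : Hom A A') (g : Hom B B') (h : Hom E E')
    (y : hor B E) (y' : hor B' E') (x : hor A B) (x' : hor A' B'),
    cell g h y y' -> cell f g x x' -> cell f h (hcomp y x) (hcomp y' x');
  hassoc : forall (A B E F : vdata) (z : hor E F) (y : hor B E) (x : hor A B),
    giso (hcomp (hcomp z y) x) (hcomp z (hcomp y x));
  hlun : forall (A B : vdata) (x : hor A B), giso (hcomp (hid B) x) x;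
  hrun : forall (A B : vdata) (x : hor A B), giso (hcomp x (hid A)) x }.
Arguments hid {_}.
Arguments hidm {_ A B}.
Arguments hassoc {_ A B E F}.
Arguments hlun {_ A B}.
Arguments hrun {_ A B}.
Notation "y ⊙ x" := (hcomp y x) : dbl_scope.
Notation "β ⊚ α" := (hc β α) : dbl_scope.

Record DoubleCategory := {
  hdata :> HorData;
  hidm1 : forall A : hdata, hidm (idm A) ≡ cid (hid A);
  hidmM : forall (A B E : hdata) (g : Hom B E) (f : Hom A B),
    hidm (g ∘ f) ≡ hidm g • hidm f;
  hc1 : forall (A B E : hdata) (y : hor B E) (x : hor A B),
    cid y ⊚ cid x ≡ cid (y ⊙ x);
  hcM : forall (A B E A' B' E' A'' B'' E'' : hdata)
    (f : Hom A A') (g : Hom B B') (h : Hom E E')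
    (f' : Hom A' A'') (g' : Hom B' B'') (h' : Hom E' E'')
    (y : hor B E) (y' : hor B' E') (y'' : hor B'' E'')
    (x : hor A B) (x' : hor A' B') (x'' : hor A'' B'')
    (β' : cell g' h' y' y'') (β : cell g h y y')
    (α' : cell f' g' x' x'') (α : cell f g x x'),
    (β' • β) ⊚ (α' • α) ≡ (β' ⊚ α') • (β ⊚ α);
  hassoc_nat : forall (A B E F A' B' E' F' : hdata)
    (f : Hom A A') (g : Hom B B') (h : Hom E E') (k : Hom F F')
    (z : hor E F) (y : hor B E) (x : hor A B)
    (z' : hor E' F') (y' : hor B' E') (x' : hor A' B')
    (γ : cell h k z z') (β : cell g h y y') (α : cell f g x x'),
    hassoc z' y' x' • ((γ ⊚ β) ⊚ α) ≡ (γ ⊚ (β ⊚ α)) • hassoc z y x;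
  hlun_nat : forall (A B A' B' : hdata) (f : Hom A A') (g : Hom B B')
    (x : hor A B) (x' : hor A' B') (α : cell f g x x'),
    hlun x' • (hidm g ⊚ α) ≡ α • hlun x;
  hrun_nat : forall (A B A' B' : hdata) (f : Hom A A') (g : Hom B B')
    (x : hor A B) (x' : hor A' B') (α : cell f g x x'),
    hrun x' • (α ⊚ hidm f) ≡ α • hrun x;
  hpentagon : forall (A B E F G : hdata)
    (w : hor F G) (z : hor E F) (y : hor B E) (x : hor A B),
    hassoc w z (y ⊙ x) • hassoc (w ⊙ z) y x
      ≡ (cid w ⊚ hassoc z y x) • hassoc w (z ⊙ y) x • (hassoc w z y ⊚ cid x);
  htriangle : forall (A B E : hdata) (y : hor B E) (x : hor A B),
    (cid y ⊚ hlun x) • hassoc y (hid B) x ≡ hrun y ⊚ cid x }.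

(** Cartesian arrows and lifts for (s, t) : C_1 -> C_0 x C_0. *)
Definition cartesian (C : VertData) (A B A' B' : C) (x : hor A B) (y : hor A' B')
    (φ : Cell x y) : Prop :=
  forall (X Y : C) (z : hor X Y) (ψ : Cell z y) (u : Hom X A) (v : Hom Y B),
    lft ψ = lft φ ∘ u -> rgt ψ = rgt φ ∘ v ->
    exists! χ : Cell z x, [/\ lft χ = u, rgt χ = v & Ccomp φ χ = ψ].

Definition fibrant (C : VertData) : Prop :=
  forall (A B A' B' : C) (f : Hom A A') (g : Hom B B') (y : hor A' B'),
  exists (x : hor A B) (φ : Cell x y), [/\ lft φ = f, rgt φ = g & cartesian φ].

Lemma ucell_inj (C : VertData) (A B A' B' : C) (f : Hom A A') (g : Hom B B')
  (x : hor A B) (y : hor A' B') (α β : cell f g x y) : α ≡ β -> α = β.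
Proof.
case: α β => [a la ra] [b lb rb] /= e; case: b / e lb rb => lb rb.
by rewrite (proof_irrelevance _ la lb) (proof_irrelevance _ ra rb).
Qed.

Definition gid (C : VertData) (A B : C) (x : hor A B) : gcell x x := cid x.
Definition gcomp (C : VertData) (A B : C) (x y z : hor A B)
  (β : gcell y z) (α : gcell x y) : gcell x z :=
  recell (mcomp1l _) (mcomp1l _) (β • α).

(** The category C[A, B] of horizontal maps and globular 2-morphisms. *)
Definition Local (C : VertData) (A B : C) : Category.
Proof.
refine {| ob := hor A B; Hom := fun x y => gcell x y; idm := @gid C A B;
          mcomp := @gcomp C A B |}.
- by move=> *; apply: ucell_inj; apply: CcompA.
- by move=> *; apply: ucell_inj; apply: Ccomp1l.
- by move=> *; apply: ucell_inj; apply: Ccomp1r.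
Defined.

Definition has_local_equalisers (C : VertData) : Prop :=
  forall A B : C, has_equalisers (Local A B).

Definition hid_functor (C : DoubleCategory) : Functor C (C1 C) := {|
  fob := fun A : C => (mkHor (hid A) : C1 C);
  fmap := fun A B f => ucell (hidm f);
  fmap1 := @hidm1 C;
  fmapM := @hidmM C |}.

Definition has_1_tabulators (C : DoubleCategory) : Prop :=
  has_right_adjoint (hid_functor C).

Record MonadOn (C : DoubleCategory) (A : C) := {
  mcar : hor A A;
  mmu : gcell (mcar ⊙ mcar) mcar;
  meta : gcell (hid A) mcar;
  mmuA : mmu • (mmu ⊚ cid mcar) ≡ mmu • (cid mcar ⊚ mmu) • hassoc mcar mcar mcar;
  mmu1l : mmu • (meta ⊚ cid mcar) ≡ hlun mcar;
  mmu1r : mmu • (cid mcar ⊚ meta) ≡ hrun mcar }.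

Record Monad (C : DoubleCategory) := mkMonad {
  mob : C;
  mon :> MonadOn mob }.
Arguments mkMonad {C mob}.

Definition is_monad_map (C : DoubleCategory) (A B : C) (M : MonadOn A) (N : MonadOn B)
    (f : Hom A B) (φ : cell f f (mcar M) (mcar N)) : Prop :=
  φ • mmu M ≡ mmu N • (φ ⊚ φ) /\ φ • meta M ≡ meta N • hidm f.

Lemma hc_eqv (C : HorData) (A B E A' B' E' : C)
  (f f2 : Hom A A') (g g2 : Hom B B') (h h2 : Hom E E')
  (y : hor B E) (y' : hor B' E') (x : hor A B) (x' : hor A' B')
  (β : cell g h y y') (β2 : cell g2 h2 y y') (α : cell f g x x') (α2 : cell f2 g2 x x') :
  β ≡ β2 -> α ≡ α2 -> β ⊚ α ≡ β2 ⊚ α2.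
Proof.
move=> eb ea.
have ef : f = f2 by rewrite -(lftE α) -(lftE α2) ea.
have eg : g = g2 by rewrite -(rgtE α) -(rgtE α2) ea.
have eh : h = h2 by rewrite -(rgtE β) -(rgtE β2) eb.
by subst f2 g2 h2; rewrite (ucell_inj eb) (ucell_inj ea).
Qed.

Lemma hidm_eqv (C : HorData) (A B : C) (f g : Hom A B) : f = g -> hidm f ≡ hidm g.
Proof. by move->. Qed.

Lemma monad_map_eqv (C : DoubleCategory) (A B : C) (M : MonadOn A) (N : MonadOn B)
  (f g : Hom A B) (φ : cell f f (mcar M) (mcar N)) (ψ : cell g g (mcar M) (mcar N)) :
  φ ≡ ψ -> is_monad_map φ -> is_monad_map ψ.
Proof.
move=> e; have ef : f = g by rewrite -(lftE φ) -(lftE ψ) e.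
by subst g; rewrite (ucell_inj e).
Qed.

Lemma monad_map_id (C : DoubleCategory) (A : C) (M : MonadOn A) :
  is_monad_map (cid (mcar M)).
Proof.
split; rewrite /= Ccomp1l.
- by rewrite (hc1 (mcar M)) /= Ccomp1r.
- by rewrite hidm1 /= Ccomp1r.
Qed.

Lemma monad_map_comp (C : DoubleCategory) (A B E : C)
  (M : MonadOn A) (N : MonadOn B) (P : MonadOn E) (f : Hom A B) (g : Hom B E)
  (φ : cell f f (mcar M) (mcar N)) (ψ : cell g g (mcar N) (mcar P)) :
  is_monad_map φ -> is_monad_map ψ -> is_monad_map (ψ • φ).
Proof.
move=> [/= m1 e1] [/= m2 e2]; split; rewrite /= -CcompA.
- by rewrite m1 CcompA m2 -CcompA hcM.
- by rewrite e1 CcompA e2 -CcompA hidmM.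
Qed.

(** Maps in the fibre over A: monad maps (id_A, φ). *)
Record MndHom (C : DoubleCategory) (A : C) (M N : MonadOn A) := mkMndHom {
  mhom :> gcell (mcar M) (mcar N);
  mhomP : is_monad_map mhom }.

Lemma mndhom_inj (C : DoubleCategory) (A : C) (M N : MonadOn A) (φ ψ : MndHom M N) :
  φ ≡ ψ -> φ = ψ.
Proof.
case: φ ψ => [a pa] [b pb] /= e; move: pb; rewrite -(ucell_inj e) => pb.
by rewrite (proof_irrelevance _ pa pb).
Qed.

Definition mnd_id (C : DoubleCategory) (A : C) (M : MonadOn A) : MndHom M M :=
  mkMndHom (monad_map_id M).
Definition mnd_comp (C : DoubleCategory) (A : C) (M N P : MonadOn A)
  (ψ : MndHom N P) (φ : MndHom M N) : MndHom M P :=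
  @mkMndHom C A M P (gcomp ψ φ)
    (monad_map_eqv (φ := ψ • φ) (ψ := gcomp ψ φ) erefl (monad_map_comp (mhomP φ) (mhomP ψ))).

Definition Mnd (C : DoubleCategory) (A : C) : Category.
Proof.
refine {| ob := MonadOn A; Hom := @MndHom C A; idm := @mnd_id C A;
          mcomp := @mnd_comp C A |}.
- by move=> *; apply: mndhom_inj; apply: CcompA.
- by move=> *; apply: mndhom_inj; apply: Ccomp1l.
- by move=> *; apply: mndhom_inj; apply: Ccomp1r.
Defined.

Definition forget_monad (C : DoubleCategory) (A : C) : Functor (Mnd A) (Local A A).
Proof.
refine {| fob := (fun M => mcar M) : Mnd A -> Local A A;
          fmap := fun M N (φ : @Hom (Mnd A) M N) => mhom φ |}.
- by [].
- by [].
Defined.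

Record Monoidal (V : Category) := {
  tob : V -> V -> V;
  tmap : forall A A' B B' : V, Hom A A' -> Hom B B' -> Hom (tob A B) (tob A' B');
  tmap1 : forall A B : V, tmap (idm A) (idm B) = idm (tob A B);
  tmapM : forall (A A' A'' B B' B'' : V)
    (f' : Hom A' A'') (f : Hom A A') (g' : Hom B' B'') (g : Hom B B'),
    tmap (f' ∘ f) (g' ∘ g) = tmap f' g' ∘ tmap f g;
  tI : V;
  tassoc : forall A B E : V, iso (tob (tob A B) E) (tob A (tob B E));
  tlun : forall A : V, iso (tob tI A) A;
  trun : forall A : V, iso (tob A tI) A;
  tassoc_nat : forall (A A' B B' E E' : V) (f : Hom A A') (g : Hom B B') (h : Hom E E'),
    fwd (tassoc A' B' E') ∘ tmap (tmap f g) h = tmap f (tmap g h) ∘ fwd (tassoc A B E);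
  tlun_nat : forall (A A' : V) (f : Hom A A'),
    fwd (tlun A') ∘ tmap (idm tI) f = f ∘ fwd (tlun A);
  trun_nat : forall (A A' : V) (f : Hom A A'),
    fwd (trun A') ∘ tmap f (idm tI) = f ∘ fwd (trun A);
  tpentagon : forall A B E F : V,
    fwd (tassoc A B (tob E F)) ∘ fwd (tassoc (tob A B) E F)
    = tmap (idm A) (fwd (tassoc B E F)) ∘ fwd (tassoc A (tob B E) F)
      ∘ tmap (fwd (tassoc A B E)) (idm F);
  ttriangle : forall A B : V,
    tmap (idm A) (fwd (tlun B)) ∘ fwd (tassoc A tI B) = tmap (fwd (trun A)) (idm B) }.
Arguments tob {V} _ _ _.
Arguments tmap {V} _ {A A' B B'}.
Arguments tI {V}.
Arguments tassoc {V} _ _ _ _.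
Arguments tlun {V} _ _.
Arguments trun {V} _ _.

Record Symmetry (V : Category) (O : Monoidal V) := {
  tsym : forall A B : V, Hom (tob O A B) (tob O B A);
  tsym_nat : forall (A A' B B' : V) (f : Hom A A') (g : Hom B B'),
    tsym A' B' ∘ tmap O f g = tmap O g f ∘ tsym A B;
  tsymK : forall A B : V, tsym B A ∘ tsym A B = idm (tob O A B);
  thexagon : forall A B E : V,
    fwd (tassoc O B E A) ∘ tsym A (tob O B E) ∘ fwd (tassoc O A B E)
    = tmap O (idm B) (tsym A E) ∘ fwd (tassoc O B A E) ∘ tmap O (tsym A B) (idm E) }.
Arguments tsym {V O}.

(** Underlying data: the monoidal structure (⊠, I_0) of C_0, the operations and
    constraints of the structure (⊠, I_1) of C_1 lying strictly over it, and the
    comparison 2-morphisms ξ, υ, δ, ι. *)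
Record OplaxData (C : DoubleCategory) := {
  omon :> Monoidal C;
  thor : forall A A' B B' : C, hor A A' -> hor B B' -> hor (tob omon A B) (tob omon A' B');
  tcell : forall (A B A' B' D E D' E' : C)
    (f : Hom A A') (g : Hom B B') (h : Hom D D') (k : Hom E E')
    (x : hor A B) (x' : hor A' B') (y : hor D E) (y' : hor D' E'),
    cell f g x x' -> cell h k y y' ->
    cell (tmap omon f h) (tmap omon g k) (thor x y) (thor x' y');
  thI : hor (tI omon) (tI omon);
  thassoc : forall (A A' B B' E E' : C) (x : hor A A') (y : hor B B') (z : hor E E'),
    ciso (tassoc omon A B E) (tassoc omon A' B' E')
      (thor (thor x y) z) (thor x (thor y z));
  thlun : forall (A A' : C) (x : hor A A'), ciso (tlun omon A) (tlun omon A') (thor thI x) x;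
  thrun : forall (A A' : C) (x : hor A A'), ciso (trun omon A) (trun omon A') (thor x thI) x;
  xi : forall (A1 B1 E1 A2 B2 E2 : C)
    (y1 : hor B1 E1) (x1 : hor A1 B1) (y2 : hor B2 E2) (x2 : hor A2 B2),
    gcell (thor (y1 ⊙ x1) (y2 ⊙ x2)) (thor y1 y2 ⊙ thor x1 x2);
  upsilon : forall A1 A2 : C, gcell (thor (hid A1) (hid A2)) (hid (tob omon A1 A2));
  delta : gcell thI (thI ⊙ thI);
  iota : gcell thI (hid (tI omon)) }.
Arguments thor {C} _ {A A' B B'}.
Arguments tcell {C} _ {A B A' B' D E D' E' f g h k x x' y y'}.
Arguments thI {C}.
Arguments thassoc {C} _ {A A' B B' E E'}.
Arguments thlun {C} _ {A A'}.
Arguments thrun {C} _ {A A'}.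
Arguments xi {C} _ {A1 B1 E1 A2 B2 E2}.
Arguments upsilon {C}.
Arguments delta {C}.
Arguments iota {C}.

Section OplaxLaws.
Variables (C : DoubleCategory) (O : OplaxData C).
Local Notation "A ⊠ B" := (tob O A B) : dbl_scope.
Local Notation "f ⊠v g" := (tmap O f g) : dbl_scope.
Local Notation "x ⊠h y" := (thor O x y) : dbl_scope.
Local Notation "α ⊠c β" := (tcell O α β) : dbl_scope.

Record monoidal1_laws : Prop := {
  tcell1 : forall (A B D E : C) (x : hor A B) (y : hor D E),
    cid x ⊠c cid y ≡ cid (x ⊠h y);
  tcellM : forall (A B A' B' A'' B'' D E D' E' D'' E'' : C)
    (f' : Hom A' A'') (g' : Hom B' B'') (f : Hom A A') (g : Hom B B')
    (h' : Hom D' D'') (k' : Hom E' E'') (h : Hom D D') (k : Hom E E')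
    (x : hor A B) (x' : hor A' B') (x'' : hor A'' B'')
    (y : hor D E) (y' : hor D' E') (y'' : hor D'' E'')
    (α' : cell f' g' x' x'') (α : cell f g x x')
    (β' : cell h' k' y' y'') (β : cell h k y y'),
    (α' • α) ⊠c (β' • β) ≡ (α' ⊠c β') • (α ⊠c β);
  thassoc_nat : forall (A1 B1 A1' B1' A2 B2 A2' B2' A3 B3 A3' B3' : C)
    (f1 : Hom A1 A1') (g1 : Hom B1 B1') (f2 : Hom A2 A2') (g2 : Hom B2 B2')
    (f3 : Hom A3 A3') (g3 : Hom B3 B3')
    (x1 : hor A1 B1) (x1' : hor A1' B1') (x2 : hor A2 B2) (x2' : hor A2' B2')
    (x3 : hor A3 B3) (x3' : hor A3' B3')
    (α1 : cell f1 g1 x1 x1') (α2 : cell f2 g2 x2 x2') (α3 : cell f3 g3 x3 x3'),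
    thassoc O x1' x2' x3' • ((α1 ⊠c α2) ⊠c α3)
      ≡ (α1 ⊠c (α2 ⊠c α3)) • thassoc O x1 x2 x3;
  thlun_nat : forall (A B A' B' : C) (f : Hom A A') (g : Hom B B')
    (x : hor A B) (x' : hor A' B') (α : cell f g x x'),
    thlun O x' • (cid (thI O) ⊠c α) ≡ α • thlun O x;
  thrun_nat : forall (A B A' B' : C) (f : Hom A A') (g : Hom B B')
    (x : hor A B) (x' : hor A' B') (α : cell f g x x'),
    thrun O x' • (α ⊠c cid (thI O)) ≡ α • thrun O x;
  thpentagon : forall (A A' B B' E E' F F' : C)
    (x : hor A A') (y : hor B B') (z : hor E E') (w : hor F F'),
    thassoc O x y (z ⊠h w) • thassoc O (x ⊠h y) z w
      ≡ (cid x ⊠c thassoc O y z w) • thassoc O x (y ⊠h z) w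
        • (thassoc O x y z ⊠c cid w);
  thtriangle : forall (A A' B B' : C) (x : hor A A') (y : hor B B'),
    (cid x ⊠c thlun O y) • thassoc O x (thI O) y ≡ thrun O x ⊠c cid y }.

(** (⊠, ξ, υ) is an oplax double functor C x C -> C. *)
Record oplax_tensor_laws : Prop := {
  xi_nat : forall (A1 B1 E1 A1' B1' E1' A2 B2 E2 A2' B2' E2' : C)
    (f1 : Hom A1 A1') (g1 : Hom B1 B1') (h1 : Hom E1 E1')
    (f2 : Hom A2 A2') (g2 : Hom B2 B2') (h2 : Hom E2 E2')
    (y1 : hor B1 E1) (y1' : hor B1' E1') (x1 : hor A1 B1) (x1' : hor A1' B1')
    (y2 : hor B2 E2) (y2' : hor B2' E2') (x2 : hor A2 B2) (x2' : hor A2' B2')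
    (β1 : cell g1 h1 y1 y1') (α1 : cell f1 g1 x1 x1')
    (β2 : cell g2 h2 y2 y2') (α2 : cell f2 g2 x2 x2'),
    xi O y1' x1' y2' x2' • ((β1 ⊚ α1) ⊠c (β2 ⊚ α2))
      ≡ ((β1 ⊠c β2) ⊚ (α1 ⊠c α2)) • xi O y1 x1 y2 x2;
  upsilon_nat : forall (A1 A2 B1 B2 : C) (f1 : Hom A1 B1) (f2 : Hom A2 B2),
    upsilon O B1 B2 • (hidm f1 ⊠c hidm f2) ≡ hidm (f1 ⊠v f2) • upsilon O A1 A2;
  xi_assoc : forall (A1 B1 E1 F1 A2 B2 E2 F2 : C)
    (z1 : hor E1 F1) (y1 : hor B1 E1) (x1 : hor A1 B1)
    (z2 : hor E2 F2) (y2 : hor B2 E2) (x2 : hor A2 B2),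
    (cid (z1 ⊠h z2) ⊚ xi O y1 x1 y2 x2) • xi O z1 (y1 ⊙ x1) z2 (y2 ⊙ x2)
      • (hassoc z1 y1 x1 ⊠c hassoc z2 y2 x2)
    ≡ hassoc (z1 ⊠h z2) (y1 ⊠h y2) (x1 ⊠h x2)
      • (xi O z1 y1 z2 y2 ⊚ cid (x1 ⊠h x2)) • xi O (z1 ⊙ y1) x1 (z2 ⊙ y2) x2;
  xi_lun : forall (A1 B1 A2 B2 : C) (x1 : hor A1 B1) (x2 : hor A2 B2),
    hlun (x1 ⊠h x2) • (upsilon O B1 B2 ⊚ cid (x1 ⊠h x2)) • xi O (hid B1) x1 (hid B2) x2
      ≡ hlun x1 ⊠c hlun x2;
  xi_run : forall (A1 B1 A2 B2 : C) (x1 : hor A1 B1) (x2 : hor A2 B2),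
    hrun (x1 ⊠h x2) • (cid (x1 ⊠h x2) ⊚ upsilon O A1 A2) • xi O x1 (hid A1) x2 (hid A2)
      ≡ hrun x1 ⊠c hrun x2 }.

(** (I_0, I_1, δ, ι) is an oplax double functor 1 -> C. *)
Record oplax_unit_laws : Prop := {
  delta_assoc : hassoc (thI O) (thI O) (thI O) • (delta O ⊚ cid (thI O)) • delta O
    ≡ (cid (thI O) ⊚ delta O) • delta O;
  delta_lun : hlun (thI O) • (iota O ⊚ cid (thI O)) • delta O ≡ cid (thI O);
  delta_run : hrun (thI O) • (cid (thI O) ⊚ iota O) • delta O ≡ cid (thI O) }.

(** The associativity and unit constraints are vertical transformations. *)
Record oplax_constraint_laws : Prop := {
  xi_thassoc : forall (A1 B1 E1 A2 B2 E2 A3 B3 E3 : C)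
    (y1 : hor B1 E1) (x1 : hor A1 B1) (y2 : hor B2 E2) (x2 : hor A2 B2)
    (y3 : hor B3 E3) (x3 : hor A3 B3),
    (thassoc O y1 y2 y3 ⊚ thassoc O x1 x2 x3)
      • xi O (y1 ⊠h y2) (x1 ⊠h x2) y3 x3 • (xi O y1 x1 y2 x2 ⊠c cid (y3 ⊙ x3))
    ≡ xi O y1 x1 (y2 ⊠h y3) (x2 ⊠h x3) • (cid (y1 ⊙ x1) ⊠c xi O y2 x2 y3 x3)
      • thassoc O (y1 ⊙ x1) (y2 ⊙ x2) (y3 ⊙ x3);
  upsilon_thassoc : forall A1 A2 A3 : C,
    hidm (fwd (tassoc O A1 A2 A3)) • upsilon O (A1 ⊠ A2) A3
      • (upsilon O A1 A2 ⊠c cid (hid A3))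
    ≡ upsilon O A1 (A2 ⊠ A3) • (cid (hid A1) ⊠c upsilon O A2 A3)
      • thassoc O (hid A1) (hid A2) (hid A3);
  xi_thlun : forall (A B E : C) (y : hor B E) (x : hor A B),
    (thlun O y ⊚ thlun O x) • xi O (thI O) (thI O) y x • (delta O ⊠c cid (y ⊙ x))
    ≡ thlun O (y ⊙ x);
  upsilon_thlun : forall A : C,
    hidm (fwd (tlun O A)) • upsilon O (tI O) A • (iota O ⊠c cid (hid A)) ≡ thlun O (hid A);
  xi_thrun : forall (A B E : C) (y : hor B E) (x : hor A B),
    (thrun O y ⊚ thrun O x) • xi O y x (thI O) (thI O) • (cid (y ⊙ x) ⊠c delta O)
    ≡ thrun O (y ⊙ x);
  upsilon_thrun : forall A : C,
    hidm (fwd (trun O A)) • upsilon O A (tI O) • (cid (hid A) ⊠c iota O) ≡ thrun O (hid A) }.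

End OplaxLaws.

Record OplaxMonoidal (C : DoubleCategory) := {
  odata :> OplaxData C;
  omon1P : monoidal1_laws odata;
  otensorP : oplax_tensor_laws odata;
  ounitP : oplax_unit_laws odata;
  oconstrP : oplax_constraint_laws odata }.

Record Symmetric (C : DoubleCategory) (O : OplaxMonoidal C) := {
  sym0 : Symmetry O;
  thsym : forall (A A' B B' : C) (x : hor A A') (y : hor B B'),
    cell (tsym sym0 A B) (tsym sym0 A' B') (thor O x y) (thor O y x);
  thsym_nat : forall (A B A' B' D E D' E' : C)
    (f : Hom A A') (g : Hom B B') (h : Hom D D') (k : Hom E E')
    (x : hor A B) (x' : hor A' B') (y : hor D E) (y' : hor D' E')
    (α : cell f g x x') (β : cell h k y y'),
    thsym x' y' • tcell O α β ≡ tcell O β α • thsym x y;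
  thsymK : forall (A A' B B' : C) (x : hor A A') (y : hor B B'),
    thsym y x • thsym x y ≡ cid (thor O x y);
  thhexagon : forall (A A' B B' E E' : C) (x : hor A A') (y : hor B B') (z : hor E E'),
    thassoc O y z x • thsym x (thor O y z) • thassoc O x y z
    ≡ tcell O (cid y) (thsym x z) • thassoc O y x z • tcell O (thsym x y) (cid z);
  xi_thsym : forall (A1 B1 E1 A2 B2 E2 : C)
    (y1 : hor B1 E1) (x1 : hor A1 B1) (y2 : hor B2 E2) (x2 : hor A2 B2),
    (thsym y1 y2 ⊚ thsym x1 x2) • xi O y1 x1 y2 x2
    ≡ xi O y2 x2 y1 x1 • thsym (y1 ⊙ x1) (y2 ⊙ x2);
  upsilon_thsym : forall A1 A2 : C,
    hidm (tsym sym0 A1 A2) • upsilon O A1 A2 ≡ upsilon O A2 A1 • thsym (hid A1) (hid A2) }.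

Record invertible (C : VertData) (A B : C) (x y : hor A B) (α : gcell x y) := {
  cinv : gcell y x;
  cinvK : cinv • α ≡ cid x;
  cinvKV : α • cinv ≡ cid y }.

Record Normal (C : DoubleCategory) (O : OplaxMonoidal C) := {
  upsilon_inv : forall A1 A2 : C, invertible (upsilon O A1 A2);
  delta_inv : invertible (delta O);
  iota_inv : invertible (iota O);
  xi_invl : forall (A1 A2 B2 E2 : C) (y2 : hor B2 E2) (x2 : hor A2 B2),
    invertible (xi O (hid A1) (hid A1) y2 x2);
  xi_invr : forall (A1 B1 E1 A2 : C) (y1 : hor B1 E1) (x1 : hor A1 B1),
    invertible (xi O y1 x1 (hid A2) (hid A2)) }.

(** A functor C_1 -> C_1 lying over F on sources and over G on targets. *)
Record HFunctor (C : VertData) (F G : Functor C C) := {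
  hfob :> forall A B : C, hor A B -> hor (F A) (G B);
  hfmap : forall (A B A' B' : C) (f : Hom A A') (g : Hom B B')
    (x : hor A B) (x' : hor A' B'),
    cell f g x x' -> cell (fmap F f) (fmap G g) (hfob x) (hfob x');
  hfmap1 : forall (A B : C) (x : hor A B), hfmap (cid x) ≡ cid (hfob x);
  hfmapM : forall (A B A' B' A'' B'' : C) (f' : Hom A' A'') (g' : Hom B' B'')
    (f : Hom A A') (g : Hom B B') (x : hor A B) (x' : hor A' B') (x'' : hor A'' B'')
    (β : cell f' g' x' x'') (α : cell f g x x'),
    hfmap (β • α) ≡ hfmap β • hfmap α }.

Lemma hfmap_eqv (C : VertData) (F G : Functor C C) (K : HFunctor F G) (A B A' B' : C)
  (f f2 : Hom A A') (g g2 : Hom B B') (x : hor A B) (x' : hor A' B')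
  (α : cell f g x x') (α2 : cell f2 g2 x x') : α ≡ α2 -> hfmap K α ≡ hfmap K α2.
Proof.
move=> e; have ef : f = f2 by rewrite -(lftE α) -(lftE α2) e.
have eg : g = g2 by rewrite -(rgtE α) -(rgtE α2) e.
by subst f2 g2; rewrite (ucell_inj e).
Qed.

Definition total (C : VertData) (F G : Functor C C) (K : HFunctor F G) :
  Functor (C1 C) (C1 C).
Proof.
refine {| fob := fun X : C1 C => mkHor (K _ _ (hmap X)) : C1 C;
          fmap := fun X Y (α : Cell (hmap X) (hmap Y)) => ucell (hfmap K (cell_of α)) |}.
- by move=> X; apply: etrans (hfmap1 K (hmap X)); apply: hfmap_eqv.
- move=> X Y Z β α; apply: etrans (hfmapM K (cell_of β) (cell_of α)).
  by apply: hfmap_eqv.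
Defined.

Lemma tcell_eqv (C : DoubleCategory) (O : OplaxData C) (A B A' B' D E D' E' : C)
  (f f2 : Hom A A') (g g2 : Hom B B') (h h2 : Hom D D') (k k2 : Hom E E')
  (x : hor A B) (x' : hor A' B') (y : hor D E) (y' : hor D' E')
  (α : cell f g x x') (α2 : cell f2 g2 x x') (β : cell h k y y') (β2 : cell h2 k2 y y') :
  α ≡ α2 -> β ≡ β2 -> tcell O α β ≡ tcell O α2 β2.
Proof.
move=> ea eb.
have ef : f = f2 by rewrite -(lftE α) -(lftE α2) ea.
have eg : g = g2 by rewrite -(rgtE α) -(rgtE α2) ea.
have eh : h = h2 by rewrite -(lftE β) -(lftE β2) eb.
have ek : k = k2 by rewrite -(rgtE β) -(rgtE β2) eb.
by subst f2 g2 h2 k2; rewrite (ucell_inj eb) (ucell_inj ea).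
Qed.

Definition tens0 (V : Category) (O : Monoidal V) (B : V) : Functor V V.
Proof.
refine {| fob := fun A => tob O A B; fmap := fun A A' f => tmap O f (idm B) |}.
- by move=> A; apply: tmap1.
- by move=> A A' A'' g f; rewrite -tmapM mcomp1l.
Defined.

Definition tens1 (C : DoubleCategory) (O : OplaxMonoidal C) (B B' : C) (y : hor B B') :
  HFunctor (tens0 O B) (tens0 O B').
Proof.
refine {| hfob := (fun A A' x => thor O x y) :
            forall A A' : C, hor A A' -> hor (tens0 O B A) (tens0 O B' A');
          hfmap := fun A A' D D' f g x x' α => tcell O α (cid y) |}.
- by move=> A A' x; apply: tcell1; apply: omon1P.
- move=> *; rewrite -(tcellM (omon1P O)).
  by apply: tcell_eqv; rewrite //= Ccomp1l.
Defined.

Record Closed (C : DoubleCategory) (O : OplaxMonoidal C) := {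
  ihom0 : forall B : C, Functor C C;
  iadj0 : forall B : C, Adjunction (tens0 O B) (ihom0 B);
  ihom1 : forall (B B' : C) (y : hor B B'), HFunctor (ihom0 B) (ihom0 B');
  iadj1 : forall (B B' : C) (y : hor B B'),
    Adjunction (total (tens1 O y)) (total (ihom1 y));
  ev_lft : forall (B B' D D' : C) (y : hor B B') (z : hor D D'),
    @lft C _ _ _ _ (thor O (ihom1 y _ _ z) y) z (counit (iadj1 y) (mkHor z))
      = counit (iadj0 B) D;
  ev_rgt : forall (B B' D D' : C) (y : hor B B') (z : hor D D'),
    @rgt C _ _ _ _ (thor O (ihom1 y _ _ z) y) z (counit (iadj1 y) (mkHor z))
      = counit (iadj0 B') D' }.

Definition gtens (C : DoubleCategory) (O : OplaxData C) (A A' B B' : C)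
  (x x' : hor A A') (y y' : hor B B') (α : gcell x x') (β : gcell y y') :
  gcell (thor O x y) (thor O x' y') := recell (tmap1 O A B) (tmap1 O A' B') (tcell O α β).

Definition epi (C : VertData) (A B A' B' : C) (x : hor A B) (y : hor A' B')
  (α : Cell x y) : Prop :=
  forall (D E : C) (z : hor D E) (β γ : Cell y z), Ccomp β α = Ccomp γ α -> β = γ.

Section CellLemmas.
Variable C : DoubleCategory.

Lemma epi_comp (A B A' B' A'' B'' : C) (x : hor A B) (y : hor A' B') (z : hor A'' B'')
  (β : Cell y z) (α : Cell x y) : epi β -> epi α -> epi (Ccomp β α).
Proof. by move=> eb ea D E w γ δ; rewrite !CcompA => /ea /eb. Qed.

Lemma epi_compr (A B A' B' A'' B'' : C) (x : hor A B) (y : hor A' B') (z : hor A'' B'')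
  (β : Cell y z) (α : Cell x y) : epi (Ccomp β α) -> epi β.
Proof. by move=> e D E w γ δ h; apply: e; rewrite !CcompA h. Qed.

Lemma epi_section (A B A' B' : C) (x : hor A B) (y : hor A' B')
  (α : Cell x y) (β : Cell y x) : Ccomp α β = Cid y -> epi α.
Proof.
by move=> e D E w γ δ h; rewrite -[γ]Ccomp1r -[δ]Ccomp1r -e !CcompA h.
Qed.

Lemma epi_giso (A B : C) (x y : hor A B) (α : gcell x y) : invertible α -> epi α.
Proof. by case=> β _ e; apply: epi_section e. Qed.

Lemma epi_ciso (A B A' B' : C) (i : iso A A') (j : iso B B') (x : hor A B)
  (y : hor A' B') (α : ciso i j x y) : epi α.
Proof. by apply: epi_section (cbwdK α). Qed.

Lemma hcMC (A B E A' B' E' A'' B'' E'' : C)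
    (f : Hom A A') (g : Hom B B') (h : Hom E E')
    (f' : Hom A' A'') (g' : Hom B' B'') (h' : Hom E' E'')
    (y : hor B E) (y' : hor B' E') (y'' : hor B'' E'')
    (x : hor A B) (x' : hor A' B') (x'' : hor A'' B'')
    (β' : cell g' h' y' y'') (β : cell g h y y')
    (α' : cell f' g' x' x'') (α : cell f g x x') :
    Ccomp (β' ⊚ α') (β ⊚ α) = (β' • β) ⊚ (α' • α).
Proof. by rewrite hcM. Qed.

Lemma epi_hc (A B E : C) (y y' : hor B E) (x x' : hor A B)
  (β : gcell y y') (β' : gcell y' y) (α : gcell x x') (α' : gcell x' x) :
  β • β' ≡ cid _ -> α • α' ≡ cid _ -> epi (β ⊚ α).
Proof.
move=> eb ea; apply: (epi_section (β := β' ⊚ α')).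
by rewrite hcMC -[RHS]/(ucell (cid _)) -hc1; apply: hc_eqv.
Qed.

Lemma hassoc_natC (A B E F A' B' E' F' : C)
    (f : Hom A A') (g : Hom B B') (h : Hom E E') (k : Hom F F')
    (z : hor E F) (y : hor B E) (x : hor A B)
    (z' : hor E' F') (y' : hor B' E') (x' : hor A' B')
    (γ : cell h k z z') (β : cell g h y y') (α : cell f g x x') :
    Ccomp (hassoc z' y' x') ((γ ⊚ β) ⊚ α) = Ccomp (γ ⊚ (β ⊚ α)) (hassoc z y x).
Proof. exact: hassoc_nat. Qed.

Lemma htriangleC (A B E : C) (y : hor B E) (x : hor A B) :
    Ccomp (cid y ⊚ hlun x) (hassoc y (hid B) x) = hrun y ⊚ cid x.
Proof. exact: htriangle. Qed.

Lemma hlun_faithful (A B : C) (x y : hor A B) (α β : gcell x y) :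
  cid (hid B) ⊚ α ≡ cid (hid B) ⊚ β -> α ≡ β.
Proof.
move=> e; apply: (epi_ciso (α := hlun x)).
have h (γ : gcell x y) : Ccomp γ (hlun x) = Ccomp (hlun y) (cid (hid B) ⊚ γ).
  have -> : ucell (cid (hid B) ⊚ γ) = hidm (idm B) ⊚ γ by apply: hc_eqv; rewrite ?hidm1.
  exact/esym/hlun_nat.
by rewrite !h e.
Qed.

Lemma hrun_faithful (A B : C) (x y : hor A B) (α β : gcell x y) :
  α ⊚ cid (hid A) ≡ β ⊚ cid (hid A) -> α ≡ β.
Proof.
move=> e; apply: (epi_ciso (α := hrun x)).
have h (γ : gcell x y) : Ccomp γ (hrun x) = Ccomp (hrun y) (γ ⊚ cid (hid A)).
  have -> : ucell (γ ⊚ cid (hid A)) = γ ⊚ hidm (idm A) by apply: hc_eqv; rewrite ?hidm1.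
  exact/esym/hrun_nat.
by rewrite !h e.
Qed.

Lemma mono_hlun (A B D E : C) (x : hor A B) (z : hor D E)
  (β γ : Cell z (hid B ⊙ x)) : Ccomp (hlun x) β = Ccomp (hlun x) γ -> β = γ.
Proof.
move=> h; rewrite -[β]Ccomp1l -[γ]Ccomp1l -[Cid _]/(ucell (cid _)) -(cfwdK (hlun x)) /=.
by rewrite -!CcompA h.
Qed.

Lemma hlun_hid (A B : C) (x : hor A B) : cid (hid B) ⊚ hlun x ≡ hlun (hid B ⊙ x).
Proof.
apply: mono_hlun.
have := hlun_nat (hlun x); rewrite /= => <-; congr Ccomp.
by apply: hc_eqv; rewrite ?hidm1.
Qed.

Lemma hlun_comp (A B E : C) (y : hor B E) (x : hor A B) :
  Ccomp (hlun (y ⊙ x)) (hassoc (hid E) y x) = hlun y ⊚ cid x.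
Proof.
pose l := gcomp (hlun (y ⊙ x)) (hassoc (hid E) y x).
suff : cid (hid E) ⊚ l ≡ cid (hid E) ⊚ (hlun y ⊚ cid x) by move/hlun_faithful.
pose X := Ccomp (hassoc (hid E) (hid E ⊙ y) x) (hassoc (hid E) (hid E) y ⊚ cid x).
have eX : epi X.
  apply: epi_comp; first exact: epi_ciso.
  apply: (epi_hc (β' := cbwd (hassoc (hid E) (hid E) y)) (α' := cid x)).
    exact: cbwdK.
  exact: Ccomp1l.
apply: eX.
have -> : ucell (cid (hid E) ⊚ l)
    = Ccomp (cid (hid E) ⊚ hlun (y ⊙ x)) (cid (hid E) ⊚ hassoc (hid E) y x).
  by rewrite hcMC; apply: hc_eqv; rewrite /= ?Ccomp1l.
rewrite /X -CcompA [X in Ccomp _ X]CcompA.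
have := hpentagon (hid E) (hid E) y x; rewrite /= => <-.
rewrite CcompA htriangleC [RHS]CcompA -hassoc_natC -CcompA hcMC.
rewrite (_ : ucell (_ ⊚ _) = (hrun (hid E) ⊚ cid y) ⊚ cid x); last first.
  by apply: hc_eqv; [exact: htriangleC | exact: Ccomp1l].
rewrite hassoc_natC; congr Ccomp; apply: hc_eqv => //.
by rewrite hc1.
Qed.

Lemma hlun_hrun (A : C) : hlun (hid A) ≡ hrun (hid A).
Proof.
apply: hrun_faithful; rewrite -hlun_comp -hlun_hid.
exact: htriangleC.
Qed.

End CellLemmas.

Section TensorMonad.
Variables (C : DoubleCategory) (O : OplaxMonoidal C).
Local Notation "x ⊠h y" := (thor O x y) : dbl_scope.

Lemma tcMC (A B A' B' A'' B'' D E D' E' D'' E'' : C)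
    (f' : Hom A' A'') (g' : Hom B' B'') (f : Hom A A') (g : Hom B B')
    (h' : Hom D' D'') (k' : Hom E' E'') (h : Hom D D') (k : Hom E E')
    (x : hor A B) (x' : hor A' B') (x'' : hor A'' B'')
    (y : hor D E) (y' : hor D' E') (y'' : hor D'' E'')
    (α' : cell f' g' x' x'') (α : cell f g x x')
    (β' : cell h' k' y' y'') (β : cell h k y y') :
  Ccomp (tcell O α' β') (tcell O α β) = tcell O (α' • α) (β' • β).
Proof. by rewrite (tcellM (omon1P O)). Qed.

Lemma xi_natC (A B E A' B' E' : C)
  (y1 y1' : hor B E) (x1 x1' : hor A B) (y2 y2' : hor B' E') (x2 x2' : hor A' B')
  (β1 : gcell y1 y1') (α1 : gcell x1 x1') (β2 : gcell y2 y2') (α2 : gcell x2 x2') :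
  Ccomp (gtens O β1 β2 ⊚ gtens O α1 α2) (xi O y1 x1 y2 x2)
  = Ccomp (xi O y1' x1' y2' x2') (tcell O (β1 ⊚ α1) (β2 ⊚ α2)).
Proof.
apply: etrans (esym (xi_nat (otensorP O) β1 α1 β2 α2)) => /=.
by congr Ccomp; apply: hc_eqv.
Qed.

Variables (A B : C) (P : MonadOn A) (Q : MonadOn B).
Let p := mcar P.
Let q := mcar Q.
Let pq := p ⊠h q.
Variables (i : invertible (xi O p p q q)) (v : invertible (upsilon O A B)).
Hypotheses (epiA : epi (xi O (p ⊙ p) p (q ⊙ q) q))
  (epil : epi (xi O (hid A) p (hid B) q)) (epir : epi (xi O p (hid A) q (hid B))).

Definition tens_mu : gcell (pq ⊙ pq) pq := gcomp (gtens O (mmu P) (mmu Q)) (cinv i).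
Definition tens_eta : gcell (hid (tob O A B)) pq :=
  gcomp (gtens O (meta P) (meta Q)) (cinv v).

Lemma tens_mu_xi : Ccomp tens_mu (xi O p p q q) = gtens O (mmu P) (mmu Q).
Proof.
rewrite /tens_mu /= -CcompA; apply: etrans (Ccomp1r _); congr Ccomp.
exact: cinvK.
Qed.

Lemma tens_eta_ups : Ccomp tens_eta (upsilon O A B) = gtens O (meta P) (meta Q).
Proof.
rewrite /tens_eta /= -CcompA; apply: etrans (Ccomp1r _); congr Ccomp.
exact: cinvK.
Qed.

Lemma cid_gtens : cid pq ≡ gtens O (cid p) (cid q).
Proof. exact/esym/(tcell1 (omon1P O)). Qed.

Lemma tens_mu1l : tens_mu • (tens_eta ⊚ cid pq) ≡ hlun pq.
Proof.
have e1 : epi (upsilon O A B ⊚ cid pq).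
  apply: (epi_hc (β' := cinv v) (α' := cid pq)); first exact: cinvKV.
  exact: Ccomp1l.
apply: (epi_comp e1 epil); rewrite CcompA [RHS]CcompA.
apply: etrans (esym (xi_lun (otensorP O) p q)).
rewrite /= -[in LHS](CcompA _ _ (upsilon O A B ⊚ cid pq)) hcMC.
rewrite (_ : ucell (_ ⊚ _) = gtens O (meta P) (meta Q) ⊚ gtens O (cid p) (cid q)); last first.
  by apply: hc_eqv; [exact: tens_eta_ups | rewrite /= Ccomp1l; exact: cid_gtens].
rewrite -CcompA xi_natC CcompA tens_mu_xi /= tcMC.
by apply: tcell_eqv; apply: mmu1l.
Qed.

Lemma tens_mu1r : tens_mu • (cid pq ⊚ tens_eta) ≡ hrun pq.
Proof.
have e1 : epi (cid pq ⊚ upsilon O A B).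
  apply: (epi_hc (α' := cinv v) (β' := cid pq)); last exact: cinvKV.
  exact: Ccomp1l.
apply: (epi_comp e1 epir); rewrite CcompA [RHS]CcompA.
apply: etrans (esym (xi_run (otensorP O) p q)).
rewrite /= -[in LHS](CcompA _ _ (cid pq ⊚ upsilon O A B)) hcMC.
rewrite (_ : ucell (_ ⊚ _) = gtens O (cid p) (cid q) ⊚ gtens O (meta P) (meta Q)); last first.
  by apply: hc_eqv; [rewrite /= Ccomp1l; exact: cid_gtens | exact: tens_eta_ups].
rewrite -CcompA xi_natC CcompA tens_mu_xi /= tcMC.
by apply: tcell_eqv; apply: mmu1r.
Qed.

Lemma tens_muA : tens_mu • (tens_mu ⊚ cid pq) ≡ tens_mu • (cid pq ⊚ tens_mu) • hassoc pq pq pq.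
Proof.
have e1 : epi (xi O p p q q ⊚ cid pq).
  apply: (epi_hc (β' := cinv i) (α' := cid pq)); first exact: cinvKV.
  exact: Ccomp1l.
apply: (epi_comp e1 epiA).
have mE := tens_mu_xi; move: tens_mu mE => m mE.
have := xi_assoc (otensorP O) p p p q q q; rewrite /= -!CcompA => h.
rewrite -h {h}.
rewrite [X in Ccomp _ X = _]CcompA hcMC.
rewrite (_ : ucell (_ ⊚ _) = gtens O (mmu P) (mmu Q) ⊚ gtens O (cid p) (cid q)); last first.
  by apply: hc_eqv; [exact: mE | rewrite /= Ccomp1l; exact: cid_gtens].
rewrite xi_natC [LHS]CcompA mE tcMC.
rewrite [X in _ = Ccomp _ X]CcompA hcMC.
rewrite (_ : ucell (_ ⊚ _) = gtens O (cid p) (cid q) ⊚ gtens O (mmu P) (mmu Q)); last first.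
  by apply: hc_eqv; [rewrite /= Ccomp1l; exact: cid_gtens | exact: mE].
rewrite [X in _ = Ccomp _ X]CcompA xi_natC -[X in _ = Ccomp _ X]CcompA [RHS]CcompA.
rewrite mE !tcMC.
by apply: tcell_eqv; rewrite ?mmuA /= CcompA.
Qed.

Definition tens_monad : MonadOn (tob O A B) := {|
  mcar := pq; mmu := tens_mu; meta := tens_eta;
  mmuA := tens_muA; mmu1l := tens_mu1l; mmu1r := tens_mu1r |}.

End TensorMonad.

Definition discrete (C : DoubleCategory) (A : C) : MonadOn A.
Proof.
refine {| mcar := hid A; mmu := cfwd (hlun (hid A)) : gcell _ _; meta := gid (hid A) |}.
- apply: etrans (CcompA _ _ _); congr Ccomp.
  by rewrite -hlun_comp -hlun_hid.
- by apply: etrans (Ccomp1r _); congr Ccomp; apply: hc1.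
- by rewrite -hlun_hrun; apply: etrans (Ccomp1r _); congr Ccomp; apply: hc1.
Defined.

Section Invertible.
Variable C : DoubleCategory.

Definition inv_id (A B : C) (x : hor A B) : invertible (cid x) :=
  {| cinv := cid x; cinvK := Ccomp1l _; cinvKV := Ccomp1l _ |}.

Definition inv_giso (A B : C) (x y : hor A B) (α : giso x y) :
  invertible (α : gcell x y) :=
  {| cinv := cbwd α : gcell y x; cinvK := cfwdK α; cinvKV := cbwdK α |}.

Definition inv_comp (A B : C) (x y z : hor A B) (β : gcell y z) (α : gcell x y)
  (ib : invertible β) (ia : invertible α) : invertible (gcomp β α).
Proof.
exists (gcomp (cinv ia) (cinv ib)) => /=.
- rewrite -CcompA [X in Ccomp _ X = _]CcompA; apply: etrans (cinvK ia); congr Ccomp.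
  by apply: etrans (Ccomp1l _); congr Ccomp; apply: cinvK.
- rewrite -CcompA [X in Ccomp _ X = _]CcompA; apply: etrans (cinvKV ib); congr Ccomp.
  by apply: etrans (Ccomp1l _); congr Ccomp; apply: cinvKV.
Defined.

Definition inv_hc (A B E : C) (y y' : hor B E) (x x' : hor A B)
  (β : gcell y y') (α : gcell x x') (ib : invertible β) (ia : invertible α) :
  invertible (β ⊚ α).
Proof.
exists (cinv ib ⊚ cinv ia); rewrite /= hcMC -[RHS]/(ucell (cid _)) -hc1;
  by apply: hc_eqv; [apply: cinvK | apply: cinvK] || (apply: hc_eqv; apply: cinvKV).
Defined.

Definition inv_gtens (O : OplaxMonoidal C) (A A' B B' : C) (x x' : hor A A')
  (y y' : hor B B') (α : gcell x x') (β : gcell y y')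
  (ia : invertible α) (ib : invertible β) : invertible (gtens O α β).
Proof.
exists (gtens O (cinv ia) (cinv ib));
  rewrite /= tcMC -[RHS]/(ucell (cid _)) -(tcell1 (omon1P O));
  by apply: tcell_eqv; [apply: cinvK | apply: cinvK] || (apply: tcell_eqv; apply: cinvKV).
Defined.

Definition inv_inv (A B : C) (x y : hor A B) (α : gcell x y) (ia : invertible α) :
  invertible (cinv ia) := {| cinv := α; cinvK := cinvKV ia; cinvKV := cinvK ia |}.

Definition inv_conj (A B : C) (x x' y y' : hor A B) (α : gcell x y) (α' : gcell x' y')
  (l : gcell y' y) (r : gcell x' x) (il : invertible l) (ir : invertible r)
  (ia : invertible α) (e : Ccomp l α' = Ccomp α r) : invertible α'.
Proof.
exists (gcomp (cinv ir) (gcomp (cinv ia) l)) => /=.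
- rewrite -!CcompA e [X in Ccomp _ X = _]CcompA; apply: etrans (cinvK ir); congr Ccomp.
  by apply: etrans (Ccomp1l _); congr Ccomp; apply: cinvK.
- have eα : ucell α' = Ccomp (cinv il) (Ccomp α r).
    rewrite -e CcompA -[LHS]Ccomp1l; congr Ccomp; exact/esym/cinvK.
  rewrite eα -!CcompA [X in Ccomp _ (Ccomp _ X) = _]CcompA.
  rewrite (_ : Ccomp r (cinv ir) = Cid _); last exact: cinvKV.
  rewrite Ccomp1l [X in Ccomp _ X = _]CcompA (_ : Ccomp α (cinv ia) = Cid _); last exact: cinvKV.
  by rewrite Ccomp1l; apply: cinvK.
Defined.

End Invertible.

Section NormalTensor.
Variables (C : DoubleCategory) (O : OplaxMonoidal C) (N : Normal O).

(** ξ is invertible as soon as one tensor factor consists of maps isomorphic to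
    identities. *)
Definition xi_idlike_l (A : C) (y1 x1 : hor A A)
  (β : gcell y1 (hid A)) (α : gcell x1 (hid A)) (ib : invertible β) (ia : invertible α)
  (A2 B2 E2 : C) (y2 : hor B2 E2) (x2 : hor A2 B2) : invertible (xi O y1 x1 y2 x2) :=
  inv_conj (inv_hc (inv_gtens O ib (inv_id y2)) (inv_gtens O ia (inv_id x2)))
    (inv_gtens O (inv_hc ib ia) (inv_hc (inv_id y2) (inv_id x2)))
    (xi_invl N A y2 x2) (xi_natC O β α (cid y2) (cid x2)).

Definition xi_idlike_r (A : C) (y2 x2 : hor A A)
  (β : gcell y2 (hid A)) (α : gcell x2 (hid A)) (ib : invertible β) (ia : invertible α)
  (A1 B1 E1 : C) (y1 : hor B1 E1) (x1 : hor A1 B1) : invertible (xi O y1 x1 y2 x2) :=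
  inv_conj (inv_hc (inv_gtens O (inv_id y1) ib) (inv_gtens O (inv_id x1) ia))
    (inv_gtens O (inv_hc (inv_id y1) (inv_id x1)) (inv_hc ib ia))
    (xi_invr N A y1 x1) (xi_natC O (cid y1) (cid x1) β α).

Definition inv_hid_hid (A : C) (x : hor A A) (α : gcell x (hid A)) (ia : invertible α) :
  invertible (gcomp (hlun (hid A) : gcell _ _) (α ⊚ α)) :=
  inv_comp (inv_giso (hlun (hid A))) (inv_hc ia ia).

(** The tensor product of a monad with a discrete monad on the right. *)
Definition tens_discrete (A : C) (M : MonadOn A) (B : C) : MonadOn (tob O A B) :=
  @tens_monad C O A B M (discrete B)
    (xi_invr N B (mcar M) (mcar M)) (upsilon_inv N A B)
    (epi_giso (xi_idlike_r (inv_hid_hid (inv_id (hid B))) (inv_id (hid B)) _ _))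
    (epi_giso (xi_invr N B _ _)) (epi_giso (xi_invr N B _ _)).

(** The tensor product, on the left, with a monad D whose horizontal map is
    isomorphic to an identity, such as Δ_{A_1} ⊠ ... ⊠ Δ_{A_n}. *)
Definition idlike_tens (A : C) (D : MonadOn A) (u : gcell (mcar D) (hid A))
  (iu : invertible u) (B : C) (M : MonadOn B) : MonadOn (tob O A B) :=
  @tens_monad C O A B D M (xi_idlike_l iu iu _ _) (upsilon_inv N A B)
    (epi_giso (xi_idlike_l (inv_hid_hid iu) iu _ _))
    (epi_giso (xi_idlike_l (inv_id (hid A)) iu _ _))
    (epi_giso (xi_idlike_l iu (inv_id (hid A)) _ _)).

End NormalTensor.

(** Non-empty lists of monads A_1, ..., A_n, built from the left: the tensor
    product A_1 ⊠ ... ⊠ A_n is bracketed as ((A_1 ⊠ A_2) ⊠ ...) ⊠ A_n. *)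
Inductive inputs (C : DoubleCategory) :=
| one of Monad C
| snoc of inputs C & Monad C.
Arguments one {C}.
Arguments snoc {C}.

(** Indices i with 1 <= i <= n in [pos], and j with 1 < j <= n in [later]; in both,
    [None] is the last index n. *)
Fixpoint pos (C : DoubleCategory) (Γ : inputs C) : Type :=
  match Γ with one _ => unit | snoc Γ _ => option (pos Γ) end.

Fixpoint later (C : DoubleCategory) (Γ : inputs C) : Type :=
  match Γ with one _ => void | snoc Γ _ => option (later Γ) end.

Fixpoint pos_later (C : DoubleCategory) (Γ : inputs C) : later Γ -> pos Γ :=
  match Γ return later Γ -> pos Γ with
  | one _ => fun j : void => match j with end
  | snoc Γ _ => fun j => if j is Some j then Some (@pos_later C Γ j) else None
  end.

Fixpoint first (C : DoubleCategory) (Γ : inputs C) : pos Γ :=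
  match Γ with one _ => tt | snoc Γ _ => Some (first Γ) end.

(** A_1, ..., A_{j-1} and A_j, ..., A_n. *)
Fixpoint before (C : DoubleCategory) (Γ : inputs C) : later Γ -> inputs C :=
  match Γ return later Γ -> inputs C with
  | one _ => fun j : void => match j with end
  | snoc Γ _ => fun j => if j is Some j then @before C Γ j else Γ
  end.

Fixpoint from (C : DoubleCategory) (Γ : inputs C) : later Γ -> inputs C :=
  match Γ return later Γ -> inputs C with
  | one _ => fun j : void => match j with end
  | snoc Γ A => fun j => if j is Some j then snoc (@from C Γ j) A else one A
  end.

Fixpoint pos_before (C : DoubleCategory) (Γ : inputs C) :
    forall j : later Γ, pos (before j) -> pos Γ :=
  match Γ return forall j : later Γ, pos (before j) -> pos Γ with
  | one _ => fun j : void => match j with end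
  | snoc Γ A => fun j =>
      match j return pos (@before C (snoc Γ A) j) -> option (pos Γ) with
      | Some j => fun i => Some (@pos_before C Γ j i)
      | None => fun i => Some i
      end
  end.

Section Multimorphisms.
Variables (C : DoubleCategory) (O : OplaxMonoidal C) (N : Normal O).
Local Notation "A ⊠ B" := (tob O A B) : dbl_scope.
Local Notation "f ⊠v g" := (tmap O f g) : dbl_scope.
Local Notation "x ⊠h y" := (thor O x y) : dbl_scope.
Local Notation "α ⊠c β" := (tcell O α β) : dbl_scope.

Fixpoint tens_ob (Γ : inputs C) : C :=
  match Γ with one A => mob A | snoc Γ A => tens_ob Γ ⊠ mob A end.

(** The monad Δ_{A_1} ⊠ ... ⊠ Δ_{A_n}, and the comparison of its horizontal map
    with the identity of A_1 ⊠ ... ⊠ A_n. *)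
Fixpoint discretes (Γ : inputs C) : MonadOn (tens_ob Γ) :=
  match Γ with
  | one A => discrete (mob A)
  | snoc Γ A => tens_discrete N (discretes Γ) (mob A)
  end.

Fixpoint upsilons (Γ : inputs C) : gcell (mcar (discretes Γ)) (hid (tens_ob Γ)) :=
  match Γ with
  | one A => cid (hid (mob A))
  | snoc Γ A =>
      gcomp (upsilon O (tens_ob Γ) (mob A)) (gtens O (upsilons Γ) (cid (hid (mob A))))
  end.

Fixpoint upsilons_inv (Γ : inputs C) : invertible (upsilons Γ) :=
  match Γ with
  | one A => inv_id (hid (mob A))
  | snoc Γ A =>
      inv_comp (upsilon_inv N (tens_ob Γ) (mob A))
        (inv_gtens O (upsilons_inv Γ) (inv_id (hid (mob A))))
  end.

(** The monad Δ_{A_1} ⊠ ... ⊠ (A_i, a_i) ⊠ ... ⊠ Δ_{A_n}. *)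
Fixpoint placed (Γ : inputs C) : pos Γ -> MonadOn (tens_ob Γ) :=
  match Γ with
  | one A => fun _ => mon A
  | snoc Γ A => fun i =>
      if i is Some i then tens_discrete N (placed i) (mob A)
      else idlike_tens N (upsilons_inv Γ) (mon A)
  end.

(** A vertical map f out of A_1 ⊠ ... ⊠ A_n and 2-morphisms φ_i over f. *)
Record PreMulti (Γ : inputs C) (B : Monad C) := mkPreMulti {
  mmap : Hom (tens_ob Γ) (mob B);
  mcell : forall i : pos Γ, cell mmap mmap (mcar (placed i)) (mcar B) }.

Definition is_multimorphism (Γ : inputs C) (B : Monad C) (m : PreMulti Γ B) : Prop :=
  forall i : pos Γ, is_monad_map (M := placed i) (N := B) (mcell m i).

Definition sigma (A1 A2 : C) (a1 : hor A1 A1) (a2 : hor A2 A2) :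
  gcell (a1 ⊠h a2) ((a1 ⊠h hid A2) ⊙ (hid A1 ⊠h a2)) :=
  gcomp (xi O a1 (hid A1) (hid A2) a2) (gtens O (cbwd (hrun a1)) (cbwd (hlun a2))).

Definition tau (A1 A2 : C) (a1 : hor A1 A1) (a2 : hor A2 A2) :
  gcell (a1 ⊠h a2) ((hid A1 ⊠h a2) ⊙ (a1 ⊠h hid A2)) :=
  gcomp (xi O (hid A1) a1 a2 (hid A2)) (gtens O (cbwd (hlun a1)) (cbwd (hrun a2))).

Definition commuting2 (A1 A2 : C) (a1 : hor A1 A1) (a2 : hor A2 A2) (B : Monad C)
    (f : Hom (A1 ⊠ A2) (mob B))
    (φ1 : cell f f (a1 ⊠h hid A2) (mcar B)) (φ2 : cell f f (hid A1 ⊠h a2) (mcar B)) : Prop :=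
  mmu B • (φ1 ⊚ φ2) • sigma a1 a2 ≡ mmu B • (φ2 ⊚ φ1) • tau a1 a2.

(** The coherence isomorphism from
    (A_1 ⊠ ... ⊠ A_{j-1}) ⊠ (A_j ⊠ ... ⊠ A_n) to A_1 ⊠ ... ⊠ A_n. *)
Fixpoint regroup (Γ : inputs C) :
    forall j : later Γ, Hom (tens_ob (before j) ⊠ tens_ob (from j)) (tens_ob Γ) :=
  match Γ return
      forall j : later Γ, Hom (tens_ob (before j) ⊠ tens_ob (from j)) (tens_ob Γ)
  with
  | one _ => fun j : void => match j with end
  | snoc Γ A => fun j =>
      match j return
        Hom (tens_ob (@before C (snoc Γ A) j) ⊠ tens_ob (@from C (snoc Γ A) j)) _ with
      | Some j => (@regroup Γ j ⊠v idm (mob A))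
                  ∘ bwd (tassoc O (tens_ob (before j)) (tens_ob (from j)) (mob A))
      | None => idm _
      end
  end.

(** Over it, the coherence 2-morphism which for i < j identifies
    (id ⊠ ... ⊠ a_i ⊠ ... ⊠ id) ⊠ id_{A_j ⊠ ... ⊠ A_n}
    with the horizontal map of [placed] at i. *)
Fixpoint regroup_fst (Γ : inputs C) :
    forall (j : later Γ) (i : pos (before j)),
    cell (regroup j) (regroup j)
      (mcar (placed i) ⊠h hid (tens_ob (from j))) (mcar (placed (pos_before i))) :=
  match Γ return
      forall (j : later Γ) (i : pos (before j)),
      cell (regroup j) (regroup j)
      (mcar (placed i) ⊠h hid (tens_ob (from j))) (mcar (placed (pos_before i)))
  with
  | one _ => fun j : void => match j with end
  | snoc Γ A => fun j =>
      match j return forall i : pos (@before C (snoc Γ A) j),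
        cell (@regroup (snoc Γ A) j) (@regroup (snoc Γ A) j)
          (mcar (placed i) ⊠h hid (tens_ob (@from C (snoc Γ A) j)))
          (mcar (placed (@pos_before C (snoc Γ A) j i))) with
      | Some j => fun i : pos (@before C Γ j) =>
          recell (mcomp1r _) (mcomp1r _)
            ((@regroup_fst Γ j i ⊠c cid (hid (mob A)))
             • cbwd (thassoc O (mcar (placed i)) (hid (tens_ob (from j))) (hid (mob A)))
             • gtens O (cid (mcar (placed i)))
                 (cinv (upsilon_inv N (tens_ob (from j)) (mob A))))
      | None => fun i => cid (mcar (placed i) ⊠h hid (mob A))
      end
  end.

(** Likewise for id_{A_1 ⊠ ... ⊠ A_{j-1}} ⊠ (a_j ⊠ id ⊠ ... ⊠ id). *)
Fixpoint regroup_snd (Γ : inputs C) :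
    forall j : later Γ,
    cell (regroup j) (regroup j)
      (hid (tens_ob (before j)) ⊠h mcar (placed (first (from j))))
      (mcar (placed (pos_later j))) :=
  match Γ return
      forall j : later Γ,
      cell (regroup j) (regroup j)
      (hid (tens_ob (before j)) ⊠h mcar (placed (first (from j))))
      (mcar (placed (pos_later j)))
  with
  | one _ => fun j : void => match j with end
  | snoc Γ A => fun j =>
      match j return
        cell (@regroup (snoc Γ A) j) (@regroup (snoc Γ A) j)
          (hid (tens_ob (@before C (snoc Γ A) j))
           ⊠h mcar (placed (first (@from C (snoc Γ A) j))))
          (mcar (placed (@pos_later C (snoc Γ A) j))) with
      | Some j =>
          (@regroup_snd Γ j ⊠c cid (hid (mob A)))
          • cbwd (thassoc O (hid (tens_ob (before j))) (mcar (placed (first (from j))))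
                    (hid (mob A)))
      | None => gtens O (cinv (upsilons_inv Γ)) (cid (mcar A))
      end
  end.

Definition is_commuting (Γ : inputs C) (B : Monad C) (m : PreMulti Γ B) : Prop :=
  is_multimorphism m /\
  forall (j : later Γ) (i : pos (before j)),
    commuting2 (a1 := mcar (placed i)) (a2 := mcar (placed (first (from j))))
      (mcell m (pos_before i) • regroup_fst i) (mcell m (pos_later j) • regroup_snd j).

(** Possibly empty lists of inputs: multimorphisms () -> B are vertical maps I_0 -> B. *)
Definition snoc_opt (Γ : option (inputs C)) (A : Monad C) : inputs C :=
  if Γ is Some Γ then snoc Γ A else one A.

Definition PreMulti_opt (Γ : option (inputs C)) (B : Monad C) : Type :=
  if Γ is Some Γ then PreMulti Γ B else Hom (tI O) (mob B).

Definition is_commuting_opt (Γ : option (inputs C)) (B : Monad C) : PreMulti_opt Γ B -> Prop :=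
  match Γ with Some Γ => fun m => is_commuting m | None => fun _ => True end.

(** The composite e ∘_1 m, for e : H, B -> D and m : A_1, ..., A_n -> H. *)
Section Compose.
Variables (H B D : Monad C) (e : PreMulti (snoc (one H) B) D).

Definition compose_pos (Γ : inputs C) (m : PreMulti Γ H) : PreMulti (snoc Γ B) D :=
  @mkPreMulti (snoc Γ B) D (mmap e ∘ (mmap m ⊠v idm (mob B)))
    (fun i => match i return cell _ _ (mcar (@placed (snoc Γ B) i)) (mcar D) with
      | Some i => mcell e (Some tt) • (mcell m i ⊠c cid (hid (mob B)))
      | None =>
          recell (mcomp1r _) (mcomp1r _)
            (mcell e None • (hidm (mmap m) ⊠c cid (mcar B))
             • gtens O (upsilons Γ) (cid (mcar B)))
      end).

Definition compose_nil (m : Hom (tI O) (mob H)) : PreMulti (one B) D :=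
  @mkPreMulti (one B) D (mmap e ∘ (m ⊠v idm (mob B)) ∘ bwd (tlun O (mob B)))
    (fun _ =>
       recell (mcomp1r _) (mcomp1r _)
         (mcell e None • (hidm m ⊠c cid (mcar B)) • gtens O (iota O) (cid (mcar B)))
       • cbwd (thlun O (mcar B))).

Definition compose1 (Γ : option (inputs C)) : PreMulti_opt Γ H -> PreMulti (snoc_opt Γ B) D :=
  match Γ with Some Γ => fun m => compose_pos m | None => fun m => compose_nil m end.

End Compose.
End Multimorphisms.

(* Main.v *)
From mathcomp Require Import ssreflect ssrfun ssrbool.
From Stdlib Require Import FunctionalExtensionality ClassicalEpsilon.
Require Import Defs.

(** The 2-morphisms x ⊠ y -> d into a monad d multiply: Ψ * Φ := μ (Ψ ⊚ Φ) ξ is associative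
    and unital, and monad maps, multimorphisms and the commuting condition are equations
    for this product.

    [(B,b),(D,d)] lives over the object H of monad maps from b to d, the joint equaliser in
    C_0 of maps between tabulators of internal homs: vertical maps A -> H are pairs of
    f : A ⊠ B -> D and a multiplicative ε2 : id_A ⊠ b -> d over f.  Its horizontal map h is
    the centraliser of ε2: the local equaliser of the two maps to the reindexed ⟨b, d⟩
    obtained from the reindexed ⟨id_B, d⟩ by multiplying with ε2 on either side.  Local
    equalisers are stable under reindexing, because reindexing has a left adjoint (compose
    with a companion and a conjoint); so h classifies the 2-morphisms x ⊠ id_B -> d that
    commute with ε2.  A centraliser is closed under multiplication, which makes h a monad,
    and everything else follows from its universal property. *)

Set Implicit Arguments.
Unset Strict Implicit.
Unset Printing Implicit Defensive.

Local Open Scope dbl_scope.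

(** * Cancellation, naturality and unit coherence for 2-morphisms *)

Section Cells.
Variable C : DoubleCategory.

(** Lets an equation between composites be rewritten at the head of a longer right-nested
    composite. *)
Lemma CcompK (A0 B0 A1 B1 A2 B2 A3 B3 : C) (x : hor A0 B0) (y : hor A1 B1)
  (z : hor A2 B2) (w : hor A3 B3) (α : Cell z w) (β : Cell y z) (γ : Cell y w) :
  Ccomp α β = γ -> forall δ : Cell x y, Ccomp α (Ccomp β δ) = Ccomp γ δ.
Proof. by move=> <- δ; rewrite CcompA. Qed.

Lemma cfwdC (A B A' B' : C) (i : iso A A') (j : iso B B') (x : hor A B) (y : hor A' B')
  (α : ciso i j x y) : Ccomp (cbwd α) α = Cid x.
Proof. exact: cfwdK. Qed.

Lemma cbwdC (A B A' B' : C) (i : iso A A') (j : iso B B') (x : hor A B) (y : hor A' B')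
  (α : ciso i j x y) : Ccomp α (cbwd α) = Cid y.
Proof. exact: cbwdK. Qed.

Lemma cinvC (A B : C) (x y : hor A B) (α : gcell x y) (i : invertible α) :
  Ccomp (cinv i) α = Cid x.
Proof. exact: cinvK. Qed.

Lemma cinvVC (A B : C) (x y : hor A B) (α : gcell x y) (i : invertible α) :
  Ccomp α (cinv i) = Cid y.
Proof. exact: cinvKV. Qed.

Lemma ciso_moveL (A B A' B' E F : C) (i : iso A A') (j : iso B B') (x : hor A B)
  (y : hor A' B') (z : hor E F) (α : ciso i j x y) (β : Cell z x) (γ : Cell z y) :
  Ccomp α β = γ <-> β = Ccomp (cbwd α) γ.
Proof.
by split=> [<-|->]; rewrite CcompA ?cfwdC ?cbwdC Ccomp1l.
Qed.

Lemma ciso_moveR (A B A' B' E F : C) (i : iso A A') (j : iso B B') (x : hor A B)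
  (y : hor A' B') (z : hor E F) (α : ciso i j x y) (β : Cell y z) (γ : Cell x z) :
  Ccomp β α = γ <-> β = Ccomp γ (cbwd α).
Proof.
by split=> [<-|->]; rewrite -CcompA ?cfwdC ?cbwdC Ccomp1r.
Qed.

Lemma hc1C (A B E : C) (y : hor B E) (x : hor A B) : ucell (cid y ⊚ cid x) = Cid (y ⊙ x).
Proof. exact: hc1. Qed.

Lemma hlun_natC (A B A' B' : C) (f : Hom A A') (g : Hom B B') (x : hor A B)
  (x' : hor A' B') (i : cell g g (hid B) (hid B')) (α : cell f g x x') :
  i ≡ hidm g -> Ccomp (hlun x') (i ⊚ α) = Ccomp α (hlun x).
Proof.
move=> ei; apply: etrans (hlun_nat α); congr Ccomp; exact: hc_eqv.
Qed.

Lemma hrun_natC (A B A' B' : C) (f : Hom A A') (g : Hom B B') (x : hor A B)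
  (x' : hor A' B') (i : cell f f (hid A) (hid A')) (α : cell f g x x') :
  i ≡ hidm f -> Ccomp (hrun x') (α ⊚ i) = Ccomp α (hrun x).
Proof.
move=> ei; apply: etrans (hrun_nat α); congr Ccomp; exact: hc_eqv.
Qed.

Lemma hidm1C (A : C) : ucell (hidm (idm A)) = Cid (hid A).
Proof. exact: hidm1. Qed.

(** The other half of Kelly's argument for [hlun_comp]. *)
Lemma hrun_comp (A B E : C) (y : hor B E) (x : hor A B) :
  ucell (hrun (y ⊙ x)) = Ccomp (cid y ⊚ hrun x) (hassoc y x (hid A)).
Proof.
pose r := gcomp (cid y ⊚ hrun x) (hassoc y x (hid A)).
suff h : hrun (y ⊙ x) ⊚ cid (hid A) ≡ r ⊚ cid (hid A).
  by have := hrun_faithful (α := hrun (y ⊙ x) : gcell _ _) (β := r) h.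
have mA : forall (D F : C) (z : hor D F) (β γ : Cell z _),
    Ccomp (hassoc y x (hid A)) β = Ccomp (hassoc y x (hid A)) γ -> β = γ.
  by move=> D F z β γ /ciso_moveL ->; rewrite CcompA cfwdC Ccomp1l.
apply: mA.
have -> : ucell (r ⊚ cid (hid A))
    = Ccomp ((cid y ⊚ hrun x) ⊚ cid (hid A)) (hassoc y x (hid A) ⊚ cid (hid A)).
  by rewrite hcMC; apply: hc_eqv; rewrite /= ?Ccomp1l.
rewrite -htriangleC CcompA.
have -> : Ccomp (hassoc y x (hid A)) (cid (y ⊙ x) ⊚ hlun (hid A))
   = Ccomp (cid y ⊚ (cid x ⊚ hlun (hid A))) (hassoc y x (hid A ⊙ hid A)).
  rewrite -hassoc_natC; congr Ccomp; apply: hc_eqv => //; exact/esym/hc1.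
rewrite -CcompA.
have := hpentagon y x (hid A) (hid A); rewrite /= => ->.
rewrite 2!CcompA [RHS]CcompA hassoc_natC; congr Ccomp; congr Ccomp.
rewrite hcMC; apply: hc_eqv; first by rewrite /= Ccomp1l.
exact: htriangleC.
Qed.

Lemma hc_cancel_l (A B E : C) (y y' : hor B E) (x : hor A B) (α : giso y y') :
  Ccomp (α ⊚ cid x) (cbwd α ⊚ cid x) = Cid _.
Proof. by rewrite hcMC -hc1C; apply: hc_eqv; rewrite /= ?cbwdC ?Ccomp1l. Qed.

Lemma hc_cancel_r (A B E : C) (y : hor B E) (x x' : hor A B) (α : giso x x') :
  Ccomp (cid y ⊚ cbwd α) (cid y ⊚ α) = Cid _.
Proof. by rewrite hcMC -hc1C; apply: hc_eqv; rewrite /= ?cfwdC ?Ccomp1l. Qed.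

(** The triangle identity and its two companions, solved for inverse unitors. In this form they
    absorb the associators that [star_assoc] produces when products are regrouped. *)
Lemma hassoc_hrunV (A B E : C) (y : hor B E) (x : hor A B) :
  Ccomp (hassoc y (hid B) x) (cbwd (hrun y) ⊚ cid x) = cid y ⊚ cbwd (hlun x).
Proof.
have -> : ucell (hassoc y (hid B) x) = Ccomp (cid y ⊚ cbwd (hlun x)) (hrun y ⊚ cid x).
  by rewrite -htriangleC CcompA hc_cancel_r Ccomp1l.
by rewrite -CcompA hc_cancel_l Ccomp1r.
Qed.

Lemma hassoc_hlunV (A B E : C) (y : hor B E) (x : hor A B) :
  Ccomp (hassoc (hid E) y x) (cbwd (hlun y) ⊚ cid x) = cbwd (hlun (y ⊙ x)).
Proof.
have /ciso_moveL-> := hlun_comp y x.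
by rewrite -CcompA hc_cancel_l Ccomp1r.
Qed.

Lemma hassoc_comp_hrunV (A B E : C) (y : hor B E) (x : hor A B) :
  Ccomp (hassoc y x (hid A)) (cbwd (hrun (y ⊙ x))) = cid y ⊚ cbwd (hrun x).
Proof.
by apply/esym/ciso_moveR; rewrite hrun_comp CcompA hc_cancel_r Ccomp1l.
Qed.

Lemma hlunV_natC (A B A' B' : C) (f : Hom A A') (g : Hom B B') (x : hor A B)
  (x' : hor A' B') (i : cell g g (hid B) (hid B')) (α : cell f g x x') :
  i ≡ hidm g -> Ccomp (cbwd (hlun x')) α = Ccomp (i ⊚ α) (cbwd (hlun x)).
Proof.
by move=> ei; apply/esym/ciso_moveL; rewrite CcompA; apply/esym/ciso_moveR/esym/hlun_natC.
Qed.

Lemma hrunV_natC (A B A' B' : C) (f : Hom A A') (g : Hom B B') (x : hor A B)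
  (x' : hor A' B') (i : cell f f (hid A) (hid A')) (α : cell f g x x') :
  i ≡ hidm f -> Ccomp (cbwd (hrun x')) α = Ccomp (α ⊚ i) (cbwd (hrun x)).
Proof.
by move=> ei; apply/esym/ciso_moveL; rewrite CcompA; apply/esym/ciso_moveR/esym/hrun_natC.
Qed.

Lemma hlunV_hrunV (A : C) : ucell (cbwd (hlun (hid A))) = cbwd (hrun (hid A)).
Proof.
rewrite -[RHS]Ccomp1l -(cfwdC (hlun (hid A))) hlun_hrun -CcompA cbwdC; exact/esym/Ccomp1r.
Qed.

End Cells.

(** * The tensor product on maps of C_1 *)

Section RawTensor.
Variables (C : DoubleCategory) (O : OplaxMonoidal C).

(** The boundaries are read off from the arguments instead of being indices as in [tcell], so
    equations between 2-morphisms can be rewritten inside. *)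
Definition tc (A B A' B' D E D' E' : C) (x : hor A B) (x' : hor A' B') (y : hor D E)
  (y' : hor D' E') (α : Cell x x') (β : Cell y y') : Cell (thor O x y) (thor O x' y') :=
  tcell O (cell_of α) (cell_of β).

Lemma tcE (A B A' B' D E D' E' : C) (f : Hom A A') (g : Hom B B') (h : Hom D D')
  (k : Hom E E') (x : hor A B) (x' : hor A' B') (y : hor D E) (y' : hor D' E')
  (α : cell f g x x') (β : cell h k y y') : ucell (tcell O α β) = tc α β.
Proof. exact: tcell_eqv. Qed.

Lemma tcC (A B A' B' A'' B'' D E D' E' D'' E'' : C)
  (x : hor A B) (x' : hor A' B') (x'' : hor A'' B'')
  (y : hor D E) (y' : hor D' E') (y'' : hor D'' E'')
  (α' : Cell x' x'') (α : Cell x x') (β' : Cell y' y'') (β : Cell y y') :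
  Ccomp (tc α' β') (tc α β) = tc (Ccomp α' α) (Ccomp β' β).
Proof. by rewrite /tc tcMC; apply: tcell_eqv. Qed.

Lemma tc1 (A B D E : C) (x : hor A B) (y : hor D E) : tc (Cid x) (Cid y) = Cid (thor O x y).
Proof. by apply: etrans (tcell1 (omon1P O) x y); apply: tcell_eqv. Qed.

Lemma lft_tc (A B A' B' D E D' E' : C) (x : hor A B) (x' : hor A' B') (y : hor D E)
  (y' : hor D' E') (α : Cell x x') (β : Cell y y') :
  lft (tc α β) = tmap O (lft α) (lft β).
Proof. exact: lftE. Qed.

Lemma rgt_tc (A B A' B' D E D' E' : C) (x : hor A B) (x' : hor A' B') (y : hor D E)
  (y' : hor D' E') (α : Cell x x') (β : Cell y y') :
  rgt (tc α β) = tmap O (rgt α) (rgt β).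
Proof. exact: rgtE. Qed.

Lemma xi_natR (A1 B1 E1 A1' B1' E1' A2 B2 E2 A2' B2' E2' : C)
    (f1 : Hom A1 A1') (g1 : Hom B1 B1') (h1 : Hom E1 E1')
    (f2 : Hom A2 A2') (g2 : Hom B2 B2') (h2 : Hom E2 E2')
    (y1 : hor B1 E1) (y1' : hor B1' E1') (x1 : hor A1 B1) (x1' : hor A1' B1')
    (y2 : hor B2 E2) (y2' : hor B2' E2') (x2 : hor A2 B2) (x2' : hor A2' B2')
    (β1 : cell g1 h1 y1 y1') (α1 : cell f1 g1 x1 x1')
    (β2 : cell g2 h2 y2 y2') (α2 : cell f2 g2 x2 x2') :
  Ccomp (xi O y1' x1' y2' x2') (tc (β1 ⊚ α1) (β2 ⊚ α2))
  = Ccomp (tcell O β1 β2 ⊚ tcell O α1 α2) (xi O y1 x1 y2 x2).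
Proof. by rewrite -tcE; apply: (xi_nat (otensorP O)). Qed.

End RawTensor.

(** * The convolution product of 2-morphisms into a monad *)

Section Star.
Variables (C : DoubleCategory) (O : OplaxMonoidal C).
Local Notation tc := (tc O).

Section Def.
Variables (D : C) (N : MonadOn D) (A A' A'' B B' B'' : C) (x' : hor A' A'') (x : hor A A')
  (y' : hor B' B'') (y : hor B B') (f : Hom (tob O A B) D) (g : Hom (tob O A' B') D)
  (h : Hom (tob O A'' B'') D) (Ψ : cell g h (thor O x' y') (mcar N))
  (Φ : cell f g (thor O x y) (mcar N)).

(** A convolution product, with ξ in the place of a comultiplication. It is defined only when the
    middle boundaries agree, here both [g]. *)
Definition star_cell : Cell (thor O (x' ⊙ x) (y' ⊙ y)) (mcar N) :=
  Ccomp (mmu N) (Ccomp (Ψ ⊚ Φ) (xi O x' x y' y)).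

Lemma lft_star : lft star_cell = f.
Proof. by rewrite !lft_comp !lftE mcomp1l mcomp1r. Qed.

Lemma rgt_star : rgt star_cell = h.
Proof. by rewrite !rgt_comp !rgtE mcomp1l mcomp1r. Qed.

Definition star : cell f h (thor O (x' ⊙ x) (y' ⊙ y)) (mcar N) := mkcell lft_star rgt_star.
End Def.

Variables (D : C) (N : MonadOn D).

Lemma star_eqv (A A' A'' B B' B'' : C) (x' : hor A' A'') (x : hor A A')
    (y' : hor B' B'') (y : hor B B') (f f2 : Hom (tob O A B) D) (g g2 : Hom (tob O A' B') D)
    (h h2 : Hom (tob O A'' B'') D)
    (Ψ : cell g h (thor O x' y') (mcar N)) (Φ : cell f g (thor O x y) (mcar N))
    (Ψ2 : cell g2 h2 (thor O x' y') (mcar N)) (Φ2 : cell f2 g2 (thor O x y) (mcar N)) :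
  Ψ ≡ Ψ2 -> Φ ≡ Φ2 -> star Ψ Φ ≡ star Ψ2 Φ2.
Proof. by move=> e1 e2; congr Ccomp; congr Ccomp; apply: hc_eqv. Qed.

(** Naturality of ξ and interchange. Every restriction of a product along 2-morphisms goes through
    this lemma. *)
Lemma star_nat (A A' A'' B B' B'' E E' E'' F F' F'' : C)
    (x' : hor A' A'') (x : hor A A') (y' : hor B' B'') (y : hor B B')
    (w' : hor E' E'') (w : hor E E') (z' : hor F' F'') (z : hor F F')
    (f : Hom (tob O A B) D) (g : Hom (tob O A' B') D) (h : Hom (tob O A'' B'') D)
    (f2 : Hom (tob O E F) D) (g2 : Hom (tob O E' F') D) (h2 : Hom (tob O E'' F'') D)
    (Ψ : cell g h (thor O x' y') (mcar N)) (Φ : cell f g (thor O x y) (mcar N))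
    (Ψ2 : cell g2 h2 (thor O w' z') (mcar N)) (Φ2 : cell f2 g2 (thor O w z) (mcar N))
    (u : Hom E A) (u' : Hom E' A') (u'' : Hom E'' A'')
    (v : Hom F B) (v' : Hom F' B') (v'' : Hom F'' B'')
    (α' : cell u' u'' w' x') (α : cell u u' w x)
    (β' : cell v' v'' z' y') (β : cell v v' z y) :
  ucell Ψ2 = Ccomp Ψ (tc α' β') -> ucell Φ2 = Ccomp Φ (tc α β) ->
  ucell (star Ψ2 Φ2) = Ccomp (star Ψ Φ) (tc (α' ⊚ α) (β' ⊚ β)).
Proof.
move=> e1 e2; rewrite /= /star_cell -!CcompA; congr Ccomp.
rewrite xi_natR CcompA hcMC; congr Ccomp.
by apply: hc_eqv; rewrite ?e1 ?e2 /= tcE.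
Qed.

(** Associativity of μ, naturality of the associator and the axiom [xi_assoc], applied in this
    order. *)
Lemma star_assoc (A A' A'' A3 B B' B'' B3 : C)
    (x'' : hor A'' A3) (x' : hor A' A'') (x : hor A A')
    (y'' : hor B'' B3) (y' : hor B' B'') (y : hor B B')
    (f : Hom (tob O A B) D) (g : Hom (tob O A' B') D) (h : Hom (tob O A'' B'') D)
    (k : Hom (tob O A3 B3) D)
    (Θ : cell h k (thor O x'' y'') (mcar N)) (Ψ : cell g h (thor O x' y') (mcar N))
    (Φ : cell f g (thor O x y) (mcar N)) :
  ucell (star (star Θ Ψ) Φ)
  = Ccomp (star Θ (star Ψ Φ)) (tc (hassoc x'' x' x) (hassoc y'' y' y)).
Proof.
rewrite /= /star_cell.
have -> : ucell (star Θ Ψ ⊚ Φ)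
    = Ccomp (mmu N ⊚ cid _) (Ccomp ((Θ ⊚ Ψ) ⊚ Φ) (xi O x'' x' y'' y' ⊚ cid _)).
  by rewrite 2!hcMC; apply: hc_eqv; rewrite /= ?Ccomp1l ?Ccomp1r.
have -> : ucell (Θ ⊚ star Ψ Φ)
    = Ccomp (cid _ ⊚ mmu N) (Ccomp (Θ ⊚ (Ψ ⊚ Φ)) (cid _ ⊚ xi O x' x y' y)).
  by rewrite 2!hcMC; apply: hc_eqv; rewrite /= ?Ccomp1l ?Ccomp1r.
have := mmuA N; rewrite /= -!CcompA => m; rewrite (CcompK m) -!CcompA.
congr Ccomp; congr Ccomp; rewrite (CcompK (hassoc_natC _ _ _)) -!CcompA; congr Ccomp.
by have := xi_assoc (otensorP O) x'' x' x y'' y' y; rewrite /= tcE -!CcompA => ->.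
Qed.

(** The convolution unit, one for each vertical map [f]; [star1l] and [star1r] are its unit laws, up
    to unitors. *)
Definition star1 (A B : C) (f : Hom (tob O A B) D) :
  cell f f (thor O (hid A) (hid B)) (mcar N) :=
  recell (etrans (mcomp1l _) (mcomp1r _)) (etrans (mcomp1l _) (mcomp1r _))
    (meta N • (hidm f • upsilon O A B)).

Lemma star1E (A B : C) (f : Hom (tob O A B) D) :
  ucell (star1 f) = Ccomp (meta N) (Ccomp (hidm f) (upsilon O A B)).
Proof. by []. Qed.

Lemma star1_nat (A B A' B' : C) (f : Hom (tob O A B) D) (u : Hom A' A) (v : Hom B' B) :
  ucell (star1 (f ∘ tmap O u v)) = Ccomp (star1 f) (tc (hidm u) (hidm v)).
Proof.
rewrite !star1E hidmM /= -!CcompA -tcE; congr Ccomp; congr Ccomp.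
exact/esym/(upsilon_nat (otensorP O)).
Qed.

Lemma star1l (A A' B B' : C) (x : hor A A') (y : hor B B')
    (f : Hom (tob O A B) D) (g : Hom (tob O A' B') D) (Φ : cell f g (thor O x y) (mcar N)) :
  ucell (star (star1 g) Φ) = Ccomp Φ (tc (hlun x) (hlun y)).
Proof.
rewrite /= /star_cell.
have -> : ucell (star1 g ⊚ Φ)
    = Ccomp (meta N ⊚ cid _) (Ccomp (hidm g ⊚ Φ) (upsilon O A' B' ⊚ cid _)).
  by rewrite 2!hcMC; apply: hc_eqv; rewrite /= ?Ccomp1l ?Ccomp1r.
have := mmu1l N; rewrite /= => m; rewrite CcompA (CcompK m) CcompA.
rewrite (_ : Ccomp (hlun _) (hidm g ⊚ Φ) = Ccomp Φ (hlun _)); last exact: hlun_nat.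
rewrite -!CcompA; congr Ccomp; rewrite -tcE.
by have := xi_lun (otensorP O) x y; rewrite /= -!CcompA => ->.
Qed.

Lemma star1r (A A' B B' : C) (x : hor A A') (y : hor B B')
    (f : Hom (tob O A B) D) (g : Hom (tob O A' B') D) (Φ : cell f g (thor O x y) (mcar N)) :
  ucell (star Φ (star1 f)) = Ccomp Φ (tc (hrun x) (hrun y)).
Proof.
rewrite /= /star_cell.
have -> : ucell (Φ ⊚ star1 f)
    = Ccomp (cid _ ⊚ meta N) (Ccomp (Φ ⊚ hidm f) (cid _ ⊚ upsilon O A B)).
  by rewrite 2!hcMC; apply: hc_eqv; rewrite /= ?Ccomp1l ?Ccomp1r.
have := mmu1r N; rewrite /= => m; rewrite CcompA (CcompK m) CcompA.
rewrite (_ : Ccomp (hrun _) (Φ ⊚ hidm f) = Ccomp Φ (hrun _)); last exact: hrun_nat.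
rewrite -!CcompA; congr Ccomp; rewrite -tcE.
by have := xi_run (otensorP O) x y; rewrite /= -!CcompA => ->.
Qed.

(** [multiplicative P Q φ]: φ is a monad map P ⊠ Q -> N, phrased so that P ⊠ Q
    need not be a monad. *)
Definition multiplicative (A B : C) (P : MonadOn A) (Q : MonadOn B) (f : Hom (tob O A B) D)
    (φ : cell f f (thor O (mcar P) (mcar Q)) (mcar N)) : Prop :=
  Ccomp φ (tc (mmu P) (mmu Q)) = star φ φ /\ Ccomp φ (tc (meta P) (meta Q)) = star1 f.

(** The structure of [tens_monad] contains the inverses of ξ and υ. Precomposing the monad map
    equations with ξ and υ, which are epi, removes these inverses and leaves equations for
    [star]. *)
Lemma tens_monad_mapP (A B : C) (P : MonadOn A) (Q : MonadOn B)
    (i : invertible (xi O (mcar P) (mcar P) (mcar Q) (mcar Q)))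
    (v : invertible (upsilon O A B))
    (epiA : epi (xi O (mcar P ⊙ mcar P) (mcar P) (mcar Q ⊙ mcar Q) (mcar Q)))
    (epil : epi (xi O (hid A) (mcar P) (hid B) (mcar Q)))
    (epir : epi (xi O (mcar P) (hid A) (mcar Q) (hid B)))
    (f : Hom (tob O A B) D) (φ : cell f f (thor O (mcar P) (mcar Q)) (mcar N)) :
  is_monad_map (M := tens_monad i v epiA epil epir) (N := N) φ <-> multiplicative φ.
Proof.
rewrite /is_monad_map /multiplicative star1E /= /star_cell.
have mE : Ccomp (tens_mu i) (xi O (mcar P) (mcar P) (mcar Q) (mcar Q)) = tc (mmu P) (mmu Q).
  by rewrite tens_mu_xi /= tcE.
have uE : Ccomp (tens_eta P Q v) (upsilon O A B) = tc (meta P) (meta Q).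
  by rewrite tens_eta_ups /= tcE.
rewrite -mE -uE; split=> -[m e]; split.
- by rewrite CcompA m -!CcompA.
- by rewrite CcompA e -!CcompA.
- by apply: (epi_giso i); rewrite -CcompA [RHS](esym (CcompA _ _ _)); exact: m.
- by apply: (epi_giso v); rewrite -CcompA [RHS](esym (CcompA _ _ _)); exact: e.
Qed.

(** The monad maps α and β move the structure maps across the tensor; [star_nat] and [star1_nat] do
    the rest. *)
Lemma multiplicative_comp (A B A' B' : C) (P : MonadOn A) (Q : MonadOn B)
    (P' : MonadOn A') (Q' : MonadOn B') (f : Hom (tob O A B) D) (u : Hom A' A) (v : Hom B' B)
    (g : Hom (tob O A' B') D)
    (φ : cell f f (thor O (mcar P) (mcar Q)) (mcar N))
    (ψ : cell g g (thor O (mcar P') (mcar Q')) (mcar N))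
    (α : cell u u (mcar P') (mcar P)) (β : cell v v (mcar Q') (mcar Q)) :
  is_monad_map α -> is_monad_map β -> ucell ψ = Ccomp φ (tc α β) ->
  multiplicative φ -> multiplicative ψ.
Proof.
move=> [/= αm αe] [/= βm βe] e [m1 m2].
have eg : g = f ∘ tmap O u v.
  by rewrite -(lftE ψ) e lft_comp lft_tc !lftE.
split.
- rewrite e -CcompA tcC αm βm -tcC CcompA m1.
  by apply: esym; apply: star_nat.
- rewrite e -CcompA tcC αe βe -tcC CcompA m2 eg.
  by rewrite star1_nat.
Qed.

Section Cross.
Variables (A B : C) (x : hor A A) (y : hor B B) (f : Hom (tob O A B) D)
  (φ : cell f f (thor O x (hid B)) (mcar N)) (ψ : cell f f (thor O (hid A) y) (mcar N)).

(** [crossl] and [crossr] are the products of the two arguments in either order, μ(φ ⊚ ψ)σ and μ(ψ ⊚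
    φ)τ, with σ and τ absorbed into unitors and [star]. *)
Definition crossl : Cell (thor O x y) (mcar N) :=
  Ccomp (star φ ψ) (tc (cbwd (hrun x)) (cbwd (hlun y))).

Definition crossr : Cell (thor O x y) (mcar N) :=
  Ccomp (star ψ φ) (tc (cbwd (hlun x)) (cbwd (hrun y))).

Lemma lft_crossl : lft crossl = f.
Proof. by rewrite lft_comp lft_star lft_tc !lftE tmap1 mcomp1r. Qed.

Lemma rgt_crossl : rgt crossl = f.
Proof. by rewrite rgt_comp rgt_star rgt_tc !rgtE tmap1 mcomp1r. Qed.

Lemma lft_crossr : lft crossr = f.
Proof. by rewrite lft_comp lft_star lft_tc !lftE tmap1 mcomp1r. Qed.

Lemma rgt_crossr : rgt crossr = f.
Proof. by rewrite rgt_comp rgt_star rgt_tc !rgtE tmap1 mcomp1r. Qed.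

Definition commutes : Prop := crossl = crossr.
End Cross.

Section CrossNat.
Variables (A B A' B' : C) (x : hor A A) (y : hor B B) (x' : hor A' A') (y' : hor B' B')
  (f : Hom (tob O A B) D) (f' : Hom (tob O A' B') D) (u : Hom A' A) (v : Hom B' B)
  (φ : cell f f (thor O x (hid B)) (mcar N)) (ψ : cell f f (thor O (hid A) y) (mcar N))
  (φ' : cell f' f' (thor O x' (hid B')) (mcar N))
  (ψ' : cell f' f' (thor O (hid A') y') (mcar N))
  (α : cell u u x' x) (β : cell v v y' y).
Hypotheses (eφ : ucell φ' = Ccomp φ (tc α (hidm v)))
  (eψ : ucell ψ' = Ccomp ψ (tc (hidm u) β)).

Lemma crossl_nat : crossl φ' ψ' = Ccomp (crossl φ ψ) (tc α β).
Proof.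
rewrite /crossl (star_nat eφ eψ) -[LHS]CcompA -[RHS]CcompA !tcC.
congr Ccomp; congr (tc _ _); apply: esym; [exact: hrunV_natC | exact: hlunV_natC].
Qed.

Lemma crossr_nat : crossr φ' ψ' = Ccomp (crossr φ ψ) (tc α β).
Proof.
rewrite /crossr (star_nat eψ eφ) -[LHS]CcompA -[RHS]CcompA !tcC.
congr Ccomp; congr (tc _ _); apply: esym; [exact: hlunV_natC | exact: hrunV_natC].
Qed.

Lemma commutes_nat : commutes φ ψ -> commutes φ' ψ'.
Proof. by rewrite /commutes crossl_nat crossr_nat => ->. Qed.
End CrossNat.

End Star.

Lemma commuting2P (C : DoubleCategory) (O : OplaxMonoidal C) (A1 A2 : C) (a1 : hor A1 A1) (a2 : hor A2 A2) (B : Monad C)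
    (f : Hom (tob O A1 A2) (mob B))
    (φ1 : cell f f (thor O a1 (hid A2)) (mcar B)) (φ2 : cell f f (thor O (hid A1) a2) (mcar B)) :
  commuting2 φ1 φ2 <-> commutes φ1 φ2.
Proof. by rewrite /commuting2 /commutes /crossl /crossr /= /star_cell !tcE -!CcompA. Qed.

(** * Companions, conjoints and opcartesian lifts in a fibrant double category *)

Section OpcartesianLifts.
Variables (C : DoubleCategory) (hfib : fibrant C).

(** [p] is the cartesian lift of the identity of [B] along (f, id), and η factors [hidm f] through
    it. The first companion identity is this factorisation; the second follows from uniqueness of
    factorisations. *)
Lemma companion (A B : C) (f : Hom A B) : exists (p : hor A B)
    (ε : cell f (idm B) p (hid B)) (η : cell (idm A) f (hid A) p),
  ε • η ≡ hidm f /\ Ccomp (hlun p) (ε ⊚ η) = hrun p.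
Proof.
have [p [φ [el er cφ]]] := hfib f (idm B) (hid B).
pose ε : cell f (idm B) p (hid B) := mkcell el er.
have [||η0 [[ηl ηr ηE] _]] := cφ _ _ (hid A) (hidm f) (idm A) f.
- by rewrite el mcomp1r lftE.
- by rewrite er mcomp1l rgtE.
pose η : cell (idm A) f (hid A) p := mkcell ηl ηr.
exists p, ε, η; split=> //.
(* Both sides of the second identity factor [Ccomp ε (hrun p)] through ε. *)
have [||χ [_ χU]] := cφ _ _ _ (Ccomp ε (hrun p)) (idm A) (idm B).
- by rewrite lft_comp !lftE /=.
- by rewrite rgt_comp !rgtE /=.
transitivity χ; [symmetry|]; apply: χU; split=> //.
- by rewrite lft_comp !lftE mcomp1l.
- by rewrite rgt_comp !rgtE mcomp1l.
- rewrite -[φ]/(ucell ε).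
  rewrite CcompA -(hlun_natC (i := hidm (idm B))) // -CcompA hcMC.
  rewrite -(hrun_natC (i := hidm f)) //; rewrite -hlun_hrun; congr Ccomp.
  by apply: hc_eqv; rewrite //= hidm1C Ccomp1l.
- by rewrite lftE.
- by rewrite rgtE.
Qed.

(** Dual to [companion], from the cartesian lift along (id, f). *)
Lemma conjoint (A B : C) (f : Hom A B) : exists (p : hor B A)
    (ε : cell (idm B) f p (hid B)) (η : cell f (idm A) (hid A) p),
  ε • η ≡ hidm f /\ Ccomp (hrun p) (η ⊚ ε) = hlun p.
Proof.
have [p [φ [el er cφ]]] := hfib (idm B) f (hid B).
pose ε : cell (idm B) f p (hid B) := mkcell el er.
have [||η0 [[ηl ηr ηE] _]] := cφ _ _ (hid A) (hidm f) f (idm A).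
- by rewrite el mcomp1l lftE.
- by rewrite er mcomp1r rgtE.
pose η : cell f (idm A) (hid A) p := mkcell ηl ηr.
exists p, ε, η; split=> //.
have [||χ [_ χU]] := cφ _ _ _ (Ccomp ε (hlun p)) (idm B) (idm A).
- by rewrite lft_comp !lftE /=.
- by rewrite rgt_comp !rgtE /=.
transitivity χ; [symmetry|]; apply: χU; split=> //.
- by rewrite lft_comp !lftE mcomp1l.
- by rewrite rgt_comp !rgtE mcomp1l.
- rewrite -[φ]/(ucell ε).
  rewrite CcompA -(hrun_natC (i := hidm (idm B))) // -CcompA hcMC.
  rewrite -(hlun_natC (i := hidm f)) //; rewrite -hlun_hrun; congr Ccomp.
  by apply: hc_eqv; rewrite //= hidm1C Ccomp1l.
- by rewrite lftE.
- by rewrite rgtE.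
Qed.

(** The lift is [x] followed by the companion of [g], and φ factors as ε ⊚ φ up to a unitor. One
    companion identity gives existence, the other uniqueness. The left boundary [f] is arbitrary so
    that a lift on the left can follow. *)
Lemma opcartesian_rgt (A A' H' : C) (g : Hom A' H') (x : hor A A') :
  exists (x' : hor A H') (κ : cell (idm A) g x x'),
  forall (H : C) (f : Hom A H) (z : hor H H') (φ : cell f g x z),
  exists! χ : cell f (idm H') x' z, Ccomp χ κ = φ.
Proof.
have [p [ε [η [εη z1]]]] := companion g.
pose κ0 : cell _ _ x (p ⊙ x) := (η ⊚ cid x) • cbwd (hlun x).
have κE : ucell κ0 = Ccomp (η ⊚ cid x) (cbwd (hlun x)) by [].
pose κ : cell (idm A) g x (p ⊙ x) := recell (mcomp1l _) (mcomp1r _) κ0.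
(* The second companion identity whiskered by [x]; any factorisation through κ is recovered from
   it. *)
have zz : Ccomp (hlun (p ⊙ x)) (ε ⊚ κ) = Cid _.
  have -> : ucell (ε ⊚ κ) = Ccomp (ε ⊚ (η ⊚ cid x)) (cid p ⊚ cbwd (hlun x)).
    by rewrite hcMC; apply: hc_eqv; rewrite //= Ccomp1r.
  have -> : Ccomp (ε ⊚ (η ⊚ cid x)) (cid p ⊚ cbwd (hlun x))
    = Ccomp (hassoc (hid H') p x) (Ccomp ((ε ⊚ η) ⊚ cid x)
        (Ccomp (cbwd (hassoc p (hid A') x)) (cid p ⊚ cbwd (hlun x)))).
    by rewrite CcompA hassoc_natC -CcompA (CcompK (cbwdC _)) Ccomp1l.
  have -> : Ccomp (hlun (p ⊙ x)) (Ccomp (hassoc (hid H') p x) (Ccomp ((ε ⊚ η) ⊚ cid x)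
        (Ccomp (cbwd (hassoc p (hid A') x)) (cid p ⊚ cbwd (hlun x)))))
    = Ccomp (hrun p ⊚ cid x)
        (Ccomp (cbwd (hassoc p (hid A') x)) (cid p ⊚ cbwd (hlun x))).
    rewrite (CcompK (hlun_comp _ _)) CcompA hcMC; congr Ccomp.
    by apply: hc_eqv; rewrite /= ?z1 ?Ccomp1l.
  rewrite -htriangleC -CcompA (CcompK (cbwdC _)) Ccomp1l hcMC -hc1C.
  by apply: hc_eqv; rewrite /= ?Ccomp1l ?cbwdC.
exists (p ⊙ x), κ => H f z φ.
have χP : exists χ : cell f (idm H') (p ⊙ x) z, ucell χ = Ccomp (hlun z) (ε ⊚ φ).
  exists (recell (mcomp1l _) (mcomp1r _) (hlun z • (ε ⊚ φ))) => //.
have [χ χE] := χP; exists χ; split.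
- rewrite χE /= -CcompA.
  have -> : Ccomp (ε ⊚ φ) (Ccomp (η ⊚ cid x) (cbwd (hlun x)))
     = Ccomp (hidm g ⊚ φ) (cbwd (hlun x)).
    rewrite CcompA hcMC; congr Ccomp.
    by apply: hc_eqv; rewrite /= ?Ccomp1r.
  by rewrite CcompA (hlun_natC (i := hidm g)) // -CcompA cbwdC Ccomp1r.
- move=> χ' e; apply: ucell_inj; rewrite χE.
  have -> : ucell (ε ⊚ φ) = Ccomp (hidm (idm H') ⊚ χ') (ε ⊚ κ).
    by rewrite hcMC; apply: hc_eqv; rewrite //= hidm1C Ccomp1l.
  by rewrite CcompA (hlun_natC (i := hidm (idm H'))) // -CcompA zz Ccomp1r.
Qed.

Lemma opcartesian_lft (A A' H : C) (f : Hom A H) (x : hor A A') :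
  exists (x' : hor H A') (κ : cell f (idm A') x x'),
  forall (z : hor H A') (φ : cell f (idm A') x z),
  exists! χ : gcell x' z, Ccomp χ κ = φ.
Proof.
have [p [ε [η [εη z1]]]] := conjoint f.
pose κ0 : cell _ _ x (x ⊙ p) := (cid x ⊚ η) • cbwd (hrun x).
pose κ : cell f (idm A') x (x ⊙ p) := recell (mcomp1r _) (mcomp1l _) κ0.
have zz : Ccomp (hrun (x ⊙ p)) (κ ⊚ ε) = Cid _.
  have -> : ucell (κ ⊚ ε) = Ccomp ((cid x ⊚ η) ⊚ ε) (cbwd (hrun x) ⊚ cid p).
    by rewrite hcMC; apply: hc_eqv; rewrite //= Ccomp1r.
  rewrite hrun_comp -CcompA (CcompK (hassoc_natC _ _ _)) -CcompA CcompA hcMC.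
  have -> : ucell ((cid x • cid x) ⊚ (hrun p • (η ⊚ ε))) = cid x ⊚ hlun p.
    by apply: hc_eqv; rewrite //= Ccomp1l.
  rewrite CcompA htriangleC hcMC -hc1C.
  by apply: hc_eqv; rewrite /= ?Ccomp1l ?cbwdC.
exists (x ⊙ p), κ => z φ.
have χP : exists χ : gcell (x ⊙ p) z, ucell χ = Ccomp (hrun z) (φ ⊚ ε).
  exists (recell (mcomp1l _) (mcomp1r _) (hrun z • (φ ⊚ ε))) => //.
have [χ χE] := χP; exists χ; split.
- rewrite χE /= -CcompA.
  have -> : Ccomp (φ ⊚ ε) (Ccomp (cid x ⊚ η) (cbwd (hrun x)))
     = Ccomp (φ ⊚ hidm f) (cbwd (hrun x)).
    rewrite CcompA hcMC; congr Ccomp.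
    by apply: hc_eqv; rewrite /= ?Ccomp1r.
  by rewrite CcompA (hrun_natC (i := hidm f)) // -CcompA cbwdC Ccomp1r.
- move=> χ' e; apply: ucell_inj; rewrite χE.
  have -> : ucell (φ ⊚ ε) = Ccomp (χ' ⊚ hidm (idm H)) (κ ⊚ ε).
    by rewrite hcMC; apply: hc_eqv; rewrite //= hidm1C Ccomp1l.
  by rewrite CcompA (hrun_natC (i := hidm (idm H))) // -CcompA zz Ccomp1r.
Qed.

(** A lift on the right followed by one on the left. It trades 2-morphisms over (f, g) for globular
    ones, to which local equalisers apply. *)
Lemma opcartesian (A A' H H' : C) (f : Hom A H) (g : Hom A' H') (x : hor A A') :
  exists (x' : hor H H') (κ : cell f g x x'),
  forall (z : hor H H') (φ : cell f g x z), exists! χ : gcell x' z, Ccomp χ κ = φ.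
Proof.
have [x1 [κ1 u1]] := opcartesian_rgt g x.
have [x2 [κ2 u2]] := opcartesian_lft f x1.
exists x2, (recell (mcomp1r _) (mcomp1l _) (κ2 • κ1)) => z φ.
have [χ1 [e1 U1]] := u1 _ _ _ φ.
have [χ2 [e2 U2]] := u2 _ χ1.
exists χ2; split; first by rewrite /= CcompA e2.
move=> χ' e; apply: U2.
have/U1 -> // : Ccomp (recell (mcomp1l _) (mcomp1l _) (χ' • κ2)) κ1 = φ.
by rewrite -e /= CcompA.
Qed.

End OpcartesianLifts.

(** * Transposition and joint equalisers *)

Section Adjunctions.
Variables (V W : Category) (F : Functor V W) (G : Functor W V) (adj : Adjunction F G).

Lemma untransposeE (c : V) (d : W) (k : Hom c (G d)) :
  untranspose adj k = counit adj d ∘ fmap F k.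
Proof.
by rewrite -[RHS](transposeK adj) transpose_natl untransposeK mcomp1l.
Qed.

Lemma transpose_inj (c : V) (d : W) (h h' : Hom (F c) d) :
  transpose adj h = transpose adj h' -> h = h'.
Proof. by move=> e; rewrite -(transposeK adj h) e transposeK. Qed.

End Adjunctions.

(** The second pair is equalised after restriction to the equaliser of the first. *)
Lemma joint_equaliser (V : Category) (heq : has_equalisers V) (A B B' : V)
  (f g : Hom A B) (f' g' : Hom A B') : exists (E : V) (e : Hom E A),
  [/\ f ∘ e = g ∘ e, f' ∘ e = g' ∘ e &
  forall (X : V) (h : Hom X A), f ∘ h = g ∘ h -> f' ∘ h = g' ∘ h ->
    exists! k : Hom X E, e ∘ k = h].
Proof.
have [E1 [e1 [q1 u1]]] := heq _ _ f g.
have [E2 [e2 [q2 u2]]] := heq _ _ (f' ∘ e1) (g' ∘ e1).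
exists E2, (e1 ∘ e2); split.
- by rewrite !mcompA q1.
- by rewrite !mcompA.
move=> X h e e'; have [k1 [k1E k1U]] := u1 _ _ e.
have [|k2 [k2E k2U]] := u2 _ k1; first by rewrite -!mcompA k1E.
exists k2; split; first by rewrite -mcompA k2E.
by move=> k kE; apply: k2U; apply/esym/k1U; rewrite mcompA.
Qed.

(** * Representing 2-morphisms by internal homs and tabulators *)

Section InternalHom.
Variables (C : DoubleCategory) (O : OplaxMonoidal C) (K : Closed O).
Local Notation tc := (tc O).

Lemma untranspose1E (A A' B B' D D' : C) (x : hor A A') (y : hor B B') (z : hor D D')
    (α : Cell x (ihom1 K y _ _ z)) :
  untranspose (iadj1 K y) (c := mkHor x) (d := mkHor z) α
  = Ccomp (counit (iadj1 K y) (mkHor z)) (tc α (Cid y)).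
Proof.
rewrite untransposeE /=; congr Ccomp; exact: tcell_eqv.
Qed.

(** Evaluation in C_1 lies strictly over evaluation in C_0, hence so does transposition. *)
Lemma lft_untranspose1 (A A' B B' D D' : C) (x : hor A A') (y : hor B B') (z : hor D D')
    (α : Cell x (ihom1 K y _ _ z)) :
  @lft C _ _ _ _ (thor O x y) z (untranspose (iadj1 K y) (c := mkHor x) (d := mkHor z) α)
  = untranspose (iadj0 K B) (lft α).
Proof. by rewrite untranspose1E lft_comp ev_lft lft_tc lft_id untransposeE. Qed.

Lemma rgt_untranspose1 (A A' B B' D D' : C) (x : hor A A') (y : hor B B') (z : hor D D')
    (α : Cell x (ihom1 K y _ _ z)) :
  @rgt C _ _ _ _ (thor O x y) z (untranspose (iadj1 K y) (c := mkHor x) (d := mkHor z) α)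
  = untranspose (iadj0 K B') (rgt α).
Proof. by rewrite untranspose1E rgt_comp ev_rgt rgt_tc rgt_id untransposeE. Qed.

(** [p] is the reindexing of the internal hom ⟨y, z⟩ along the transposes of [e], [e']. *)
Lemma represent_hor (hfib : fibrant C) (H H' B B' D D' : C) (y : hor B B') (z : hor D D')
    (e : Hom (tob O H B) D) (e' : Hom (tob O H' B') D') :
  exists (p : hor H H') (π : cell e e' (thor O p y) z),
  forall (A A' : C) (x : hor A A') (f : Hom A H) (g : Hom A' H') (φ : Cell (thor O x y) z),
    lft φ = e ∘ tmap O f (idm B) -> rgt φ = e' ∘ tmap O g (idm B') ->
    exists! χ : cell f g x p, Ccomp π (tc χ (Cid y)) = φ.
Proof.
have [p [κ [κl κr cκ]]] :=
  hfib _ _ _ _ (transpose (iadj0 K B) e) (transpose (iadj0 K B') e') (ihom1 K y _ _ z).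
pose π0 : Cell (thor O p y) z := untranspose (iadj1 K y) (c := mkHor p) (d := mkHor z) κ.
have πl : lft π0 = e by rewrite lft_untranspose1 κl transposeK.
have πr : rgt π0 = e' by rewrite rgt_untranspose1 κr transposeK.
exists p, (mkcell πl πr) => A A' x f g φ φl φr /=.
have πE (χ : Cell x p) : Ccomp π0 (tc χ (Cid y))
    = untranspose (iadj1 K y) (c := mkHor x) (d := mkHor z) (Ccomp κ χ).
  by rewrite /π0 !untranspose1E -CcompA tcC Ccomp1l.
pose φ' : Cell x _ := transpose (iadj1 K y) (c := mkHor x) (d := mkHor z) φ.
have φ'E : untranspose (iadj1 K y) (c := mkHor x) (d := mkHor z) φ' = φ.
  exact: transposeK.
(* The boundary conditions on φ say that its transpose lies over the transposes of [e] and [e']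
   composed with [f] and [g], as cartesianness of κ requires. *)
have [||χ [[χl χr χE] χU]] := cκ _ _ x φ' f g.
- rewrite κl; rewrite -[LHS](untransposeK (iadj0 K B)) -lft_untranspose1 φ'E φl.
  exact: transpose_natl.
- rewrite κr; rewrite -[LHS](untransposeK (iadj0 K B')) -rgt_untranspose1 φ'E φr.
  exact: transpose_natl.
exists (mkcell χl χr); split=> /=; first by rewrite πE χE.
move=> χ' e2; apply: ucell_inj; apply: χU; split; rewrite ?lftE ?rgtE //.
by move: e2; rewrite πE -{1}φ'E => e2; rewrite -[LHS](untransposeK (iadj1 K y) (c := mkHor x) (d := mkHor z)) /= e2 φ'E.
Qed.

Section Tabulators.
Variables (T : Functor (C1 C) C) (adjT : Adjunction (hid_functor C) T).

(** Closedness followed by the tabulator adjunction: maps from [A] into the tabulator of ⟨y, z⟩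
    stand for 2-morphisms id_A ⊠ y -> z whose two boundaries may differ. *)
Definition classify (A B B' D D' : C) (y : hor B B') (z : hor D D')
    (α : Cell (thor O (hid A) y) z) : Hom A (T (mkHor (ihom1 K y _ _ z))) :=
  transpose adjT (d := mkHor (ihom1 K y _ _ z))
    (transpose (iadj1 K y) (c := mkHor (hid A)) (d := mkHor z) α).

Definition unclassify (A B B' D D' : C) (y : hor B B') (z : hor D D')
    (k : Hom A (T (mkHor (ihom1 K y _ _ z)))) : Cell (thor O (hid A) y) z :=
  untranspose (iadj1 K y) (c := mkHor (hid A)) (d := mkHor z)
    (untranspose adjT (d := mkHor (ihom1 K y _ _ z)) k).

Section Laws.
Variables (B B' D D' : C) (y : hor B B') (z : hor D D').

Lemma classifyK (A : C) (α : Cell (thor O (hid A) y) z) : unclassify (classify α) = α.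
Proof.
rewrite /unclassify /classify transposeK.
exact: (transposeK (iadj1 K y) (c := mkHor (hid A)) (d := mkHor z)).
Qed.

Lemma unclassifyK (A : C) (k : Hom A (T (mkHor (ihom1 K y _ _ z)))) :
  classify (unclassify k) = k.
Proof.
rewrite /unclassify /classify.
rewrite (untransposeK (iadj1 K y) (c := mkHor (hid A)) (d := mkHor z)).
exact: untransposeK.
Qed.

Lemma classify_nat (A A' : C) (k : Hom A' A) (α : Cell (thor O (hid A) y) z) :
  classify (Ccomp α (tc (hidm k) (Cid y))) = classify α ∘ k.
Proof.
rewrite /classify -transpose_natl; congr transpose.
apply: etrans (transpose_natl (iadj1 K y) (c := mkHor (hid A)) (c' := mkHor (hid A'))
  (d := mkHor z) (ucell (hidm k)) α).
congr transpose; congr Ccomp; exact: tcell_eqv.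
Qed.

Lemma unclassify_nat (A A' : C) (k : Hom A' A) (l : Hom A (T (mkHor (ihom1 K y _ _ z)))) :
  unclassify (l ∘ k) = Ccomp (unclassify l) (tc (hidm k) (Cid y)).
Proof. by rewrite -[RHS]classifyK classify_nat unclassifyK. Qed.

End Laws.
End Tabulators.
End InternalHom.

(** * The object of monad maps *)

Section VerticalRepresentation.
Variables (C : DoubleCategory) (O : OplaxMonoidal C) (K : Closed O).
Local Notation tc := (tc O).
Variables (D : C) (N : MonadOn D) (B : C) (M : MonadOn B).

Lemma hidm_monad_map (A A' : C) (k : Hom A A') :
  is_monad_map (M := discrete A) (N := discrete A') (hidm k).
Proof.
split; first exact/esym/hlun_natC.
by rewrite /= Ccomp1l Ccomp1r.
Qed.

(** Contracting id_A ⊙ id_A to id_A puts both sides of the multiplication law on id_A ⊠ (b ⊙ b),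
    where [classify] applies. *)
Lemma discrete_multiplicativeP (A : C) (f : Hom (tob O A B) D)
    (ψ : cell f f (thor O (hid A) (mcar M)) (mcar N)) :
  multiplicative (P := discrete A) (Q := M) ψ <->
  Ccomp ψ (tc (Cid (hid A)) (mmu M))
    = Ccomp (star ψ ψ) (tc (cbwd (hlun (hid A))) (Cid (mcar M ⊙ mcar M))) /\
  Ccomp ψ (tc (Cid (hid A)) (meta M)) = star1 N f.
Proof.
split=> -[m e]; split=> //.
- by rewrite -m -CcompA tcC cbwdC Ccomp1r.
- transitivity (Ccomp (Ccomp ψ (tc (Cid (hid A)) (mmu M)))
    (tc (hlun (hid A)) (Cid (mcar M ⊙ mcar M)))).
    by rewrite -CcompA tcC Ccomp1l Ccomp1r.
  by rewrite m -CcompA tcC cfwdC Ccomp1l tc1 Ccomp1r.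
Qed.

Lemma tc_hidm_slide (A A' E E' F F' : C) (k : Hom A A') (x : hor E E') (x' : hor F F')
    (α : Cell x x') :
  Ccomp (tc (hidm k) (Cid x')) (tc (Cid (hid A)) α)
  = Ccomp (tc (Cid (hid A')) α) (tc (hidm k) (Cid x)).
Proof. by rewrite !tcC !Ccomp1l !Ccomp1r. Qed.

Lemma represent_vert (heq : has_equalisers C) (htab : has_1_tabulators C) :
  exists (H : C) (e : Hom (tob O H B) D) (ε : cell e e (thor O (hid H) (mcar M)) (mcar N)),
  multiplicative (P := discrete H) (Q := M) ε /\
  forall (A : C) (f : Hom (tob O A B) D) (ψ : cell f f (thor O (hid A) (mcar M)) (mcar N)),
    multiplicative (P := discrete A) (Q := M) ψ ->
    exists! k : Hom A H, Ccomp ε (tc (hidm k) (Cid (mcar M))) = ψ.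
Proof.
have [T [adjT]] := htab.
(* [X0] classifies all 2-morphisms id_A ⊠ b -> d, and [ψ0] is the universal one. *)
pose X0 := T (mkHor (ihom1 K (mcar M) _ _ (mcar N))).
pose ψ0 : Cell (thor O (hid X0) (mcar M)) (mcar N) := unclassify adjT (idm X0).
have ψ0E (A : C) (k : Hom A X0) :
    Ccomp ψ0 (tc (hidm k) (Cid (mcar M))) = unclassify adjT k.
  by rewrite -unclassify_nat mcomp1l.
(* The first equaliser makes the two boundaries of [ψ0] agree; they are compared through their
   transposes, which are maps out of [X0]. *)
have [X1 [e1 [q1 u1]]] :=
  heq _ _ (transpose (iadj0 K B) (lft ψ0)) (transpose (iadj0 K B) (rgt ψ0)).
pose f1 := lft ψ0 ∘ tmap O e1 (idm B).
pose ψ1' := Ccomp ψ0 (tc (hidm e1) (Cid (mcar M))).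
have l1 : lft ψ1' = f1 by rewrite lft_comp lft_tc lftE lft_id.
have r1 : rgt ψ1' = f1.
  rewrite rgt_comp rgt_tc rgtE rgt_id; apply: (transpose_inj (adj := iadj0 K B)).
  apply: etrans (transpose_natl (iadj0 K B) e1 (rgt ψ0)) _; rewrite -q1.
  exact/esym/(transpose_natl (iadj0 K B) e1 (lft ψ0)).
pose ψ1 : cell f1 f1 (thor O (hid X1) (mcar M)) (mcar N) := mkcell l1 r1.
(* The second imposes the multiplication and unit laws on [ψ1], each as a parallel pair of maps from
   [X1] to a tabulator. *)
have [H [e [qm qu uH]]] := joint_equaliser heq
  (classify K adjT (Ccomp ψ1 (tc (Cid (hid X1)) (mmu M))))
  (classify K adjT (Ccomp (star ψ1 ψ1) (tc (cbwd (hlun (hid X1))) (Cid (mcar M ⊙ mcar M)))))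
  (classify K adjT (Ccomp ψ1 (tc (Cid (hid X1)) (meta M))))
  (classify K adjT (star1 N f1)).
have starE (A : C) (k : Hom A X1) (f : Hom (tob O A B) D)
    (ψ : cell f f (thor O (hid A) (mcar M)) (mcar N)) :
    ucell ψ = Ccomp ψ1 (tc (hidm k) (Cid (mcar M))) ->
    Ccomp (star ψ ψ) (tc (cbwd (hlun (hid A))) (Cid (mcar M ⊙ mcar M)))
    = Ccomp (Ccomp (star ψ1 ψ1) (tc (cbwd (hlun (hid X1))) (Cid (mcar M ⊙ mcar M))))
        (tc (hidm k) (Cid (mcar M ⊙ mcar M))).
  move=> ψE; rewrite (star_nat (α' := hidm k) (α := hidm k) (β' := cid _) (β := cid _) ψE ψE).
  rewrite -[LHS]CcompA -[RHS]CcompA !tcC hc1C; congr Ccomp.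
  congr (tc _ _).
  exact/esym/hlunV_natC.
(* Both sides of each law are natural in [k], so multiplicativity of a restriction of [ψ1] becomes a
   condition on [k] alone. *)
have charP (A : C) (k : Hom A X1) (f : Hom (tob O A B) D)
    (ψ : cell f f (thor O (hid A) (mcar M)) (mcar N)) :
    ucell ψ = Ccomp ψ1 (tc (hidm k) (Cid (mcar M))) ->
    multiplicative (P := discrete A) (Q := M) ψ <->
    classify K adjT (Ccomp ψ1 (tc (Cid (hid X1)) (mmu M))) ∘ k
    = classify K adjT
        (Ccomp (star ψ1 ψ1) (tc (cbwd (hlun (hid X1))) (Cid (mcar M ⊙ mcar M)))) ∘ k /\
    classify K adjT (Ccomp ψ1 (tc (Cid (hid X1)) (meta M))) ∘ k
    = classify K adjT (star1 N f1) ∘ k.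
  move=> ψE.
  have ef : f = f1 ∘ tmap O k (idm B).
    by rewrite -(lftE ψ) ψE lft_comp l1 lft_tc lftE lft_id.
  rewrite discrete_multiplicativeP (starE _ _ _ _ ψE) ψE.
  have -> : ucell (star1 N f) = Ccomp (star1 N f1) (tc (hidm k) (Cid (hid B))).
    by rewrite ef star1_nat hidm1C.
  have slide (E E' : C) (x : hor E E') (α : Cell x (mcar M)) :
      Ccomp (Ccomp ψ1 (tc (hidm k) (Cid (mcar M)))) (tc (Cid (hid A)) α)
      = Ccomp (Ccomp ψ1 (tc (Cid (hid X1)) α)) (tc (hidm k) (Cid x)).
    by rewrite -!CcompA tc_hidm_slide.
  rewrite !slide -!classify_nat.
  split=> -[m u]; first by rewrite m u.
  by split; apply: (can_inj (@classifyK _ _ K _ adjT _ _ _ _ _ _ A)).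
exists H, (f1 ∘ tmap O e (idm B)), (ψ1 • tcell O (hidm e) (cid (mcar M))).
have εE : ucell (ψ1 • tcell O (hidm e) (cid (mcar M)))
  = Ccomp ψ1 (tc (hidm e) (Cid (mcar M))) by rewrite /= tcE.
split; first by apply/(charP _ e _ _ εE).
move=> A f ψ ψm.
have ψ0k := classifyK K adjT ψ; rewrite -ψ0E in ψ0k.
(* The two boundaries of ψ are equal, so its classifying map factors through [e1]. *)
have [|k1 [k1E k1U]] := u1 A (classify K adjT ψ).
  apply: etrans (esym (transpose_natl (iadj0 K B) _ (lft ψ0))) _.
  apply: etrans (transpose_natl (iadj0 K B) _ (rgt ψ0)); congr transpose => /=.
  transitivity (lft (Ccomp ψ0 (tc (hidm (classify K adjT ψ)) (Cid (mcar M))))).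
    by rewrite lft_comp lft_tc lftE lft_id.
  transitivity (rgt (Ccomp ψ0 (tc (hidm (classify K adjT ψ)) (Cid (mcar M))))).
    by rewrite ψ0k lftE rgtE.
  by rewrite rgt_comp rgt_tc rgtE rgt_id.
have ψ1E (k : Hom A X1) : Ccomp ψ1 (tc (hidm k) (Cid (mcar M)))
    = Ccomp ψ0 (tc (hidm (e1 ∘ k)) (Cid (mcar M))).
  by rewrite /= /ψ1' -CcompA tcC Ccomp1l hidmM.
have ψk1 : ucell ψ = Ccomp ψ1 (tc (hidm k1) (Cid (mcar M))).
  by rewrite ψ1E k1E ψ0k.
have [c1 c2] := (charP _ _ _ _ ψk1).1 ψm.
have [k [kE kU]] := uH _ _ c1 c2.
have εkE (l : Hom A H) : Ccomp (ψ1 • tcell O (hidm e) (cid (mcar M))) (tc (hidm l) (Cid (mcar M)))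
    = Ccomp ψ1 (tc (hidm (e ∘ l)) (Cid (mcar M))).
  by rewrite εE -CcompA tcC Ccomp1l hidmM.
exists k; split; first by rewrite εkE kE.
move=> l; rewrite εkE => lE; apply: kU; apply/esym/k1U.
rewrite -[LHS](unclassifyK adjT) -ψ0E -ψ1E lE.
by [].
Qed.

End VerticalRepresentation.

(** * The centraliser as a local equaliser *)

Section HorizontalRepresentation.
Variables (C : DoubleCategory) (O : OplaxMonoidal C) (K : Closed O).
Local Notation tc := (tc O).
Variables (hfib : fibrant C) (hloceq : has_local_equalisers C).
Variables (D : C) (N : MonadOn D) (B : C) (y : hor B B) (H : C) (e : Hom (tob O H B) D)
  (ε2 : cell e e (thor O (hid H) y) (mcar N)).

(** The property is tested over every [k], not only on globular 2-morphisms. ψ is the restriction of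
    [ε2] along [k], given up to equality in C_1 so that [f] need not be syntactically a
    composite. *)
Definition universal (h : hor H H) (ε1 : cell e e (thor O h (hid B)) (mcar N)) : Prop :=
  forall (A : C) (x : hor A A) (k : Hom A H) (f : Hom (tob O A B) D)
    (φ : cell f f (thor O x (hid B)) (mcar N)) (ψ : cell f f (thor O (hid A) y) (mcar N)),
    ucell ψ = Ccomp ε2 (tc (hidm k) (Cid y)) -> commutes φ ψ ->
    exists! χ : cell k k x h, Ccomp ε1 (tc χ (Cid (hid B))) = φ.

Lemma represent_commuting :
  exists (h : hor H H) (ε1 : cell e e (thor O h (hid B)) (mcar N)),
  commutes ε1 ε2 /\ universal ε1.
Proof.
(* π is the universal 2-morphism p ⊠ id_B -> d, not yet required to commute with [ε2]; [q]
   represents the codomain of the two products. *)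
have [p [π pU]] := represent_hor K hfib (hid B) (mcar N) e e.
have [q [ρ qU]] := represent_hor K hfib y (mcar N) e e.
have e1 : e = e ∘ tmap O (idm H) (idm B) by rewrite tmap1 mcomp1r.
have [u [uE _]] := qU _ _ p (idm H) (idm H) (crossl π ε2)
  (etrans (lft_crossl π ε2) e1) (etrans (rgt_crossl π ε2) e1).
have [v [vE _]] := qU _ _ p (idm H) (idm H) (crossr π ε2)
  (etrans (lft_crossr π ε2) e1) (etrans (rgt_crossr π ε2) e1).
have [h [ι [/= ιE ιU]]] := @hloceq H H p q u v.
have {}ιE : Ccomp u ι = Ccomp v ι by have := congr1 (@ucell _ _ _ _ _ _ _ _ _) ιE.
pose ε1 : cell e e (thor O h (hid B)) (mcar N) :=
  recell (esym e1) (esym e1) (π • tcell O ι (cid (hid B))).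
have ε1E : ucell ε1 = Ccomp π (tc ι (Cid (hid B))) by rewrite /= tcE.
(* u and v represent the two sides of [commutes] for the universal π *)
have crossE (A : C) (x : hor A A) (k : Hom A H) (f : Hom (tob O A B) D)
    (φ : cell f f (thor O x (hid B)) (mcar N)) (ψ : cell f f (thor O (hid A) y) (mcar N))
    (χ : cell k k x p) :
    ucell ψ = Ccomp ε2 (tc (hidm k) (Cid y)) -> ucell φ = Ccomp π (tc χ (Cid (hid B))) ->
    commutes φ ψ <-> Ccomp u χ = Ccomp v χ.
  move=> eψ eφ; rewrite -hidm1C in eφ; rewrite -[Cid y]/(ucell (cid y)) in eψ.
  have ef : f = e ∘ tmap O k (idm B) by rewrite -(lftE φ) eφ lft_comp lft_tc !lftE.
  rewrite /commutes (crossl_nat eφ eψ) (crossr_nat eφ eψ) -uE -vE.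
  rewrite -!CcompA !tcC !Ccomp1l; split=> [E|->] //.
  (* Uniqueness of representation by [q] cancels ρ. *)
  have [||χ0 [_ χ0U]] := qU _ _ x k k (Ccomp ρ (tc (Ccomp u χ) (cid y))).
  - by rewrite lft_comp lft_tc lft_comp !lftE mcomp1l.
  - by rewrite rgt_comp rgt_tc rgt_comp !rgtE mcomp1l.
  have := χ0U (recell (mcomp1l _) (mcomp1l _) (u • χ)) erefl.
  have := χ0U (recell (mcomp1l _) (mcomp1l _) (v • χ)) (esym E).
  by move=> -> /(congr1 (@ucell _ _ _ _ _ _ _ _ _)).
exists h, ε1; split.
  apply/(crossE _ _ (idm H) _ _ _ ι) => //.
  by rewrite hidm1C tc1 Ccomp1r.
move=> A x k f φ ψ eψ c.
have ef : f = e ∘ tmap O k (idm B).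
  by rewrite -(lftE ψ) eψ lft_comp lft_tc !lftE lft_id.
have [||χ1 [χ1E χ1U]] := pU _ _ x k k φ; rewrite ?lftE ?rgtE //.
(* ι is an equaliser for globular 2-morphisms only, whereas [χ1] lies over [k]; factoring through κ
   gives a globular [χ2], and uniqueness of such factorisations shows that it equalises [u] and
   [v]. *)
have [x' [κ κU]] := opcartesian hfib k k x.
have [χ2 [χ2E χ2U]] := κU _ χ1.
have uv : gcomp u χ2 = gcomp v χ2.
  have {}c := (crossE _ _ _ _ _ _ _ eψ (esym χ1E)).1 c.
  have [χ3 [_ χ3U]] := κU _ (recell (mcomp1l _) (mcomp1l _) (u • χ1)).
  transitivity χ3; first by apply/esym/χ3U; rewrite /= -CcompA χ2E.
  by apply: χ3U; rewrite /= -CcompA χ2E c.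
have [χ4 [χ4E χ4U]] := ιU _ _ uv.
have {}χ4E : Ccomp ι χ4 = χ2 by rewrite -χ4E.
exists (recell (mcomp1l _) (mcomp1l _) (χ4 • κ)); split.
  by rewrite ε1E -CcompA tcC Ccomp1l /= CcompA χ4E χ2E.
move=> χ χE; apply: ucell_inj => /=.
(* For uniqueness a competitor is factored through κ as well and compared with [χ4] in C[H, H]. *)
have [χ5 [χ5E _]] := κU _ χ.
have ιχ : χ1 = recell (mcomp1l _) (mcomp1l _) (ι • χ).
  by apply: χ1U; rewrite /= -χE ε1E -CcompA tcC Ccomp1l.
have χ25 : χ2 = gcomp ι χ5 by apply: χ2U; rewrite ιχ /= -χ5E CcompA.
by rewrite (χ4U χ5) // χ25.
Qed.

End HorizontalRepresentation.

(** * Closure of the centraliser under unit and multiplication *)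

Section Centraliser.
Variables (C : DoubleCategory) (O : OplaxMonoidal C).
Local Notation tc := (tc O).
Variables (D : C) (N : MonadOn D) (B : C) (y : hor B B) (H : C) (e : Hom (tob O H B) D)
  (ε2 : cell e e (thor O (hid H) y) (mcar N)).

(** Both products with the unit reduce to [ε2], because the two unitors of an identity coincide. *)
Lemma star1_commutes : commutes (star1 N e) ε2.
Proof.
rewrite /commutes /crossl /crossr star1l star1r -!CcompA !tcC hlunV_hrunV.
by rewrite hlun_hrun !cbwdC.
Qed.

Variables (h : hor H H) (ε1 : cell e e (thor O h (hid B)) (mcar N)).

Lemma star_square_proof : lft (Ccomp (star ε1 ε1) (tc (Cid (h ⊙ h)) (cbwd (hlun (hid B))))) = e
  /\ rgt (Ccomp (star ε1 ε1) (tc (Cid (h ⊙ h)) (cbwd (hlun (hid B))))) = e.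
Proof.
split; [rewrite lft_comp lft_tc lft_id | rewrite rgt_comp rgt_tc rgt_id];
  by rewrite (lftE, rgtE) (lftE, rgtE) tmap1 mcomp1r.
Qed.

(** The product of [ε1] with itself, with id_B ⊙ id_B contracted to id_B so that [universal] can
    apply to it. *)
Definition star_square : cell e e (thor O (h ⊙ h) (hid B)) (mcar N) :=
  mkcell star_square_proof.1 star_square_proof.2.

(** Presents an unchanged factor as a restriction along identities, the form that [star_nat]
    expects. *)
Lemma id_tc (A A' E E' F : C) (x : hor A A') (z : hor E E') (f g : Hom (tob O A E) F)
    (f' g' : Hom (tob O A' E') F) (w : hor F F) (φ : cell f f' (thor O x z) w) :
  ucell φ = Ccomp φ (tc (cid x) (cid z)).
Proof. by rewrite tc1 Ccomp1r. Qed.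

(** x·(x'·b) = x·(b·x') = (x·b)·x' = (b·x)·x' for x, x' in the centraliser. *)
Lemma star_square_commutes : commutes ε1 ε2 -> commutes star_square ε2.
Proof.
pose cl : cell e e (thor O h y) (mcar N) := mkcell (lft_crossl ε1 ε2) (rgt_crossl ε1 ε2).
pose cr : cell e e (thor O h y) (mcar N) := mkcell (lft_crossr ε1 ε2) (rgt_crossr ε1 ε2).
rewrite /commutes => c.
have clr : cl ≡ cr by [].
have i1 := id_tc e e ε1; have i2 := id_tc e e ε2.
(* [stepl], [mid] and [stepr] are the three regroupings by [star_assoc]; what remains in each is
   coherence of unitors and associators. *)
have stepl : crossl star_square ε2
    = Ccomp (star ε1 cl) (tc (Cid (h ⊙ h)) (cbwd (hlun y))).
  rewrite /crossl (star_nat (Ψ := star ε1 ε1) (Ψ2 := star_square) (Φ := ε2) (α' := cid (h ⊙ h))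
    (β' := cbwd (hlun (hid B))) (α := cid _) (β := cid _) erefl i2).
  rewrite (star_nat (Ψ := ε1) (Φ := star ε1 ε2) (Φ2 := cl) (α' := cid h)
    (β' := cid _) (α := cbwd (hrun h)) (β := cbwd (hlun y)) i1 erefl).
  rewrite star_assoc; move: (star ε1 (star ε1 ε2)) => s; rewrite -!CcompA !tcC hc1C; congr Ccomp; congr (tc _ _).
  - by rewrite Ccomp1l Ccomp1r hassoc_comp_hrunV.
  - by rewrite CcompA hassoc_hlunV (hlunV_natC (i := cid _)) // hidm1C.
have mid : Ccomp (star ε1 cr) (tc (Cid (h ⊙ h)) (cbwd (hlun y)))
    = Ccomp (star cl ε1) (tc (Cid (h ⊙ h)) (cbwd (hrun y))).
  rewrite (star_nat (Ψ := ε1) (Φ := star ε2 ε1) (Φ2 := cr) (α' := cid h)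
    (β' := cid _) (α := cbwd (hlun h)) (β := cbwd (hrun y)) i1 erefl).
  rewrite (star_nat (Ψ := star ε1 ε2) (Ψ2 := cl) (Φ := ε1) (α' := cbwd (hrun h))
    (β' := cbwd (hlun y)) (α := cid _) (β := cid _) erefl i1).
  rewrite star_assoc; move: (star ε1 (star ε2 ε1)) => s; rewrite -!CcompA !tcC; congr Ccomp; congr (tc _ _).
  - by rewrite !Ccomp1r hassoc_hrunV.
  - by rewrite [RHS]CcompA hassoc_hlunV (hlunV_natC (i := cid _)) // hidm1C.
have stepr : crossr star_square ε2
    = Ccomp (star cr ε1) (tc (Cid (h ⊙ h)) (cbwd (hrun y))).
  rewrite /crossr (star_nat (Ψ := ε2) (Φ := star ε1 ε1) (Φ2 := star_square) (α' := cid _)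
    (β' := cid _) (α := cid (h ⊙ h)) (β := cbwd (hlun (hid B))) i2 erefl).
  rewrite (star_nat (Ψ := star ε2 ε1) (Ψ2 := cr) (Φ := ε1) (α' := cbwd (hlun h))
    (β' := cbwd (hrun y)) (α := cid _) (β := cid _) erefl i1).
  rewrite star_assoc; move: (star ε2 (star ε1 ε1)) => s; rewrite -!CcompA !tcC hc1C; congr Ccomp; congr (tc _ _).
  - by rewrite Ccomp1l Ccomp1r hassoc_hlunV.
  - by rewrite [RHS]CcompA hassoc_hrunV.
(* Commutation enters twice, first to the right of the outer [ε1], then to the left of it. *)
rewrite stepl stepr (star_eqv (Ψ := ε1) (Φ := cl) (Φ2 := cr) erefl clr) mid.
by congr Ccomp; apply: star_eqv.
Qed.

End Centraliser.

(** * The monad structure on the centraliser *)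

Section HomMonad.
Variables (C : DoubleCategory) (O : OplaxMonoidal C).
Local Notation tc := (tc O).
Variables (D : C) (N : MonadOn D) (B H : C) (e : Hom (tob O H B) D).

Section Multiplication.
Variables (h : hor H H) (ε1 : cell e e (thor O h (hid B)) (mcar N)) (μ : gcell (h ⊙ h) h).
Hypothesis μE : Ccomp ε1 (tc μ (Cid (hid B))) = star_square ε1.

(** Since μ represents [star_square], evaluation by [ε1] carries multiplication by μ to convolution.
    This turns laws for μ into laws for [star]. *)
Lemma eval_mul (A A' A'' : C) (w' : hor A' A'') (w : hor A A') (k : Hom A H) (k' : Hom A' H)
    (k'' : Hom A'' H) (f : Hom (tob O A B) D) (f' : Hom (tob O A' B) D)
    (f'' : Hom (tob O A'' B) D) (α : cell k' k'' w' h) (β : cell k k' w h)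
    (φ : cell f' f'' (thor O w' (hid B)) (mcar N)) (ψ : cell f f' (thor O w (hid B)) (mcar N)) :
  ucell φ = Ccomp ε1 (tc α (cid (hid B))) -> ucell ψ = Ccomp ε1 (tc β (cid (hid B))) ->
  Ccomp ε1 (tc (Ccomp μ (α ⊚ β)) (Cid (hid B)))
  = Ccomp (star φ ψ) (tc (Cid (w' ⊙ w)) (cbwd (hlun (hid B)))).
Proof.
move=> eφ eψ; rewrite (star_nat eφ eψ) -[Cid (hid B)]Ccomp1l -tcC CcompA μE /=.
by rewrite -[LHS]CcompA -[RHS]CcompA !tcC hc1C !Ccomp1l !Ccomp1r.
Qed.
End Multiplication.

Variables (y : hor B B) (ε2 : cell e e (thor O (hid H) y) (mcar N)).

(** Restrictions of a commuting pair commute, so the uniqueness clause of [universal] covers both χ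
    and χ'. *)
Lemma universal_faithful (h : hor H H) (ε1 : cell e e (thor O h (hid B)) (mcar N)) :
  commutes ε1 ε2 -> universal ε2 ε1 ->
  forall (A : C) (x : hor A A) (k : Hom A H) (χ χ' : Cell x h),
    lft χ = k -> rgt χ = k -> lft χ' = k -> rgt χ' = k ->
    Ccomp ε1 (tc χ (Cid (hid B))) = Ccomp ε1 (tc χ' (Cid (hid B))) -> χ = χ'.
Proof.
move=> c u A x k χ χ' l r l' r' E.
pose χt : cell k k x h := mkcell l r; pose χt' : cell k k x h := mkcell l' r'.
pose φ := ε1 • tcell O χt (cid (hid B)); pose ψ := ε2 • tcell O (hidm k) (cid y).
have eφ : ucell φ = Ccomp ε1 (tc χt (hidm (idm B))) by rewrite /= tcE hidm1C.
have eψ : ucell ψ = Ccomp ε2 (tc (hidm k) (cid y)) by rewrite /= tcE.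
have [χ0 [_ χ0U]] := u _ x k _ φ ψ eψ (commutes_nat eφ eψ c).
have e1 := χ0U χt; rewrite eφ hidm1C in e1.
have e2 := χ0U χt'; rewrite eφ hidm1C in e2.
by have := etrans (esym (e1 erefl)) (e2 (esym E)); move/(congr1 (@ucell _ _ _ _ _ _ _ _ _)).
Qed.

(** μ and η represent [star_square] and [star1], which commute with [ε2]. The monad laws are checked
    after evaluation, where they are associativity and unitality of [star]. *)
Lemma hom_monad (h : hor H H) (ε1 : cell e e (thor O h (hid B)) (mcar N)) :
  commutes ε1 ε2 -> universal ε2 ε1 ->
  exists (P : MonadOn H) (ε : cell e e (thor O (mcar P) (hid B)) (mcar N)),
  [/\ multiplicative (P := P) (Q := discrete B) ε, commutes ε ε2 & universal ε2 ε].
Proof.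
move=> c u; have faith := universal_faithful c u.
have i2 : ucell ε2 = Ccomp ε2 (tc (hidm (idm H)) (Cid y)) by rewrite hidm1C tc1 Ccomp1r.
have [μ [μE _]] := u _ _ (idm H) _ _ _ i2 (star_square_commutes c).
have [η [ηE _]] := u _ _ (idm H) _ _ _ i2 (star1_commutes ε2).
have i1 : ucell ε1 = Ccomp ε1 (tc (cid h) (cid (hid B))) by rewrite tc1 Ccomp1r.
have μA : μ • (μ ⊚ cid h) ≡ μ • (cid h ⊚ μ) • hassoc h h h.
  apply: (faith _ _ (idm H)); rewrite ?lft_comp ?rgt_comp ?lftE ?rgtE /= ?mcomp1l //.
  rewrite (eval_mul μE (φ := star_square ε1) (ψ := ε1)) //.
  rewrite -[Cid (hid B)]Ccomp1r -tcC CcompA.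
  rewrite (eval_mul μE (ψ := star_square ε1) (φ := ε1)) //.
  rewrite (star_nat (Ψ := star ε1 ε1) (Ψ2 := star_square ε1) (Φ := ε1) (α' := cid (h ⊙ h))
    (β' := cbwd (hlun (hid B))) (α := cid _) (β := cid _) erefl i1).
  rewrite (star_nat (Ψ := ε1) (Φ := star ε1 ε1) (Φ2 := star_square ε1) (α' := cid _)
    (β' := cid _) (α := cid (h ⊙ h)) (β := cbwd (hlun (hid B))) i1 erefl).
  rewrite star_assoc; move: (star ε1 (star ε1 ε1)) => s.
  rewrite -!CcompA !tcC !hc1C; congr Ccomp; congr (tc _ _).
    by rewrite !Ccomp1l !Ccomp1r.
  by rewrite CcompA hassoc_hlunV (hlunV_natC (i := cid _)) ?hidm1C // Ccomp1r.
have μ1l : μ • (η ⊚ cid h) ≡ hlun h.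
  apply: (faith _ _ (idm H)); rewrite ?lft_comp ?rgt_comp ?lftE ?rgtE /= ?mcomp1l //.
  rewrite (eval_mul μE (φ := star1 N e) (ψ := ε1)) // star1l.
  by rewrite -CcompA tcC Ccomp1r cbwdC.
have μ1r : μ • (cid h ⊚ η) ≡ hrun h.
  apply: (faith _ _ (idm H)); rewrite ?lft_comp ?rgt_comp ?lftE ?rgtE /= ?mcomp1l //.
  rewrite (eval_mul μE (ψ := star1 N e) (φ := ε1)) // star1r.
  by rewrite -CcompA tcC Ccomp1r -hlun_hrun cbwdC.
exists {| mcar := h; mmu := μ; meta := η; mmuA := μA; mmu1l := μ1l; mmu1r := μ1r |}, ε1.
split=> //; split=> //=.
rewrite -[ucell μ]Ccomp1r -[ucell (hlun (hid B))]Ccomp1l -tcC CcompA μE.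
rewrite -[LHS]CcompA tcC cfwdC Ccomp1l tc1.
exact: Ccomp1r.
Qed.

(** Forwards this is precomposition. Backwards, the equations for χ are tested after evaluation,
    where [eval_mul] reduces them to those for φ. *)
Lemma universal_monad_map (P : MonadOn H) (ε : cell e e (thor O (mcar P) (hid B)) (mcar N)) :
  commutes ε ε2 -> universal ε2 ε -> multiplicative (P := P) (Q := discrete B) ε ->
  forall (A : C) (R : MonadOn A) (k : Hom A H) (f : Hom (tob O A B) D)
    (χ : cell k k (mcar R) (mcar P))
    (φ : cell f f (thor O (mcar R) (hid B)) (mcar N)),
    ucell φ = Ccomp ε (tc χ (Cid (hid B))) ->
    is_monad_map χ <-> multiplicative (P := R) (Q := discrete B) φ.
Proof.
move=> c u m A R k f χ φ eφ; have faith := universal_faithful c u.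
split=> [χm|[φm φe]].
  apply: (multiplicative_comp (P := P) (Q := discrete B) (Q' := discrete B) (φ := ε)
    (β := cid (mcar (discrete B))) χm _ eφ m).
  exact: monad_map_id.
have ef : f = e ∘ tmap O k (idm B) by rewrite -(lftE φ) eφ lft_comp lft_tc !lftE lft_id.
case: m => mm me.
have μE : Ccomp ε (tc (mmu P) (Cid (hid B))) = star_square ε.
  change (ucell (star_square ε)) with
    (Ccomp (star ε ε) (tc (Cid (mcar P ⊙ mcar P)) (cbwd (hlun (hid B))))).
  rewrite -[ucell (star ε ε)]mm -[RHS]CcompA tcC Ccomp1r.
  by congr Ccomp; congr (tc _ _); apply/esym/(cbwdC (hlun (hid B))).
split.
- apply: (faith _ _ k); rewrite /= ?lft_comp ?rgt_comp ?lftE ?rgtE ?mcomp1l ?mcomp1r //.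
  rewrite (eval_mul μE eφ eφ) -φm eφ -!CcompA !tcC /=.
  by rewrite Ccomp1r Ccomp1l cbwdC.
- apply: (faith _ _ k); rewrite /= ?lft_comp ?rgt_comp ?lftE ?rgtE ?mcomp1l ?mcomp1r //.
  have -> : Ccomp ε (tc (Ccomp χ (meta R)) (Cid (hid B))) = star1 N f.
    by rewrite -φe eφ -CcompA tcC Ccomp1l.
  rewrite ef star1_nat -me -CcompA tcC hidm1C /=.
  by rewrite Ccomp1r.
Qed.

End HomMonad.

(** * Transfer of the commuting condition along evaluation *)

Section CrossTransfer.
Variables (C : DoubleCategory) (O : OplaxMonoidal C).
Local Notation tc := (tc O).
Local Notation "A ⊠ B" := (tob O A B) : dbl_scope.
Local Notation "x ⊠h y" := (thor O x y) : dbl_scope.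

(** The axiom [xi_thassoc] read for products: on a triple tensor they may be formed in either
    bracketing. *)
Lemma star_thassoc (D : C) (N : MonadOn D) (A A' A'' B B' B'' E E' E'' : C)
    (x' : hor A' A'') (x : hor A A') (y' : hor B' B'') (y : hor B B') (z' : hor E' E'')
    (z : hor E E')
    (f : Hom (A ⊠ B ⊠ E) D) (f' : Hom (A' ⊠ B' ⊠ E') D) (f'' : Hom (A'' ⊠ B'' ⊠ E'') D)
    (g : Hom (A ⊠ (B ⊠ E)) D) (g' : Hom (A' ⊠ (B' ⊠ E')) D) (g'' : Hom (A'' ⊠ (B'' ⊠ E'')) D)
    (Θ' : cell f' f'' (x' ⊠h y' ⊠h z') (mcar N)) (Θ : cell f f' (x ⊠h y ⊠h z) (mcar N))
    (Ξ' : cell g' g'' (x' ⊠h (y' ⊠h z')) (mcar N)) (Ξ : cell g g' (x ⊠h (y ⊠h z)) (mcar N)) :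
  ucell Θ' = Ccomp Ξ' (thassoc O x' y' z') -> ucell Θ = Ccomp Ξ (thassoc O x y z) ->
  Ccomp (star Θ' Θ) (tc (xi O x' x y' y) (Cid (z' ⊙ z)))
  = Ccomp (star Ξ' Ξ) (Ccomp (tc (Cid (x' ⊙ x)) (xi O y' y z' z))
      (thassoc O (x' ⊙ x) (y' ⊙ y) (z' ⊙ z))).
Proof.
move=> e' e.
have eh : ucell (Θ' ⊚ Θ) = Ccomp (Ξ' ⊚ Ξ) (thassoc O x' y' z' ⊚ thassoc O x y z).
  by rewrite hcMC; apply: hc_eqv.
rewrite /= /star_cell eh -!CcompA; congr Ccomp; congr Ccomp.
by have := xi_thassoc (oconstrP O) x' x y' y z' z; rewrite /= !tcE -!CcompA => ->.
Qed.

Section Evaluation.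
Variables (H D B : C) (P : MonadOn H) (N : MonadOn D) (e : Hom (H ⊠ B) D)
  (ε : cell e e (mcar P ⊠h hid B) (mcar N)).
Hypothesis εM : multiplicative (P := P) (Q := discrete B) ε.

(** Multiplicativity of ε turns products in [P] into products in [N]. *)
Lemma eval_star (A A' A'' E E' E'' : C) (x' : hor A' A'') (x : hor A A') (y' : hor E' E'')
    (y : hor E E') (g : Hom (A ⊠ E) H) (g' : Hom (A' ⊠ E') H) (g'' : Hom (A'' ⊠ E'') H)
    (f : Hom (A ⊠ E ⊠ B) D) (f' : Hom (A' ⊠ E' ⊠ B) D) (f'' : Hom (A'' ⊠ E'' ⊠ B) D)
    (Φ' : cell g' g'' (x' ⊠h y') (mcar P)) (Φ : cell g g' (x ⊠h y) (mcar P))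
    (Θ' : cell f' f'' (x' ⊠h y' ⊠h hid B) (mcar N))
    (Θ : cell f f' (x ⊠h y ⊠h hid B) (mcar N)) :
  ucell Θ' = Ccomp ε (tc Φ' (cid (hid B))) -> ucell Θ = Ccomp ε (tc Φ (cid (hid B))) ->
  Ccomp ε (tc (star Φ' Φ) (hlun (hid B)))
  = Ccomp (star Θ' Θ) (tc (xi O x' x y' y) (Cid (hid B ⊙ hid B))).
Proof.
move=> e' e0; rewrite (star_nat e' e0) -[RHS]CcompA tcC hc1C.
have -> : ucell (star ε ε) = Ccomp ε (tc (mmu P) (hlun (hid B))) by rewrite -εM.1.
rewrite -[RHS]CcompA tcC /= /star_cell.
by rewrite !Ccomp1r.
Qed.

Section Binary.
Variables (A1 A2 : C) (a1 : hor A1 A1) (a2 : hor A2 A2) (g : Hom (A1 ⊠ A2) H)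
  (Φ1 : cell g g (a1 ⊠h hid A2) (mcar P)) (Φ2 : cell g g (hid A1 ⊠h a2) (mcar P))
  (f : Hom (A1 ⊠ (A2 ⊠ B)) D)
  (Ψ1 : cell f f (a1 ⊠h hid (A2 ⊠ B)) (mcar N))
  (Ψ2 : cell f f (hid A1 ⊠h (a2 ⊠h hid B)) (mcar N)).
Hypotheses
  (E1 : Ccomp (Ccomp Ψ1 (tc (Cid a1) (upsilon O A2 B))) (thassoc O a1 (hid A2) (hid B))
        = Ccomp ε (tc Φ1 (cid (hid B))))
  (E2 : Ccomp Ψ2 (thassoc O (hid A1) a2 (hid B)) = Ccomp ε (tc Φ2 (cid (hid B)))).

(** [Ψ1] with its identity split by υ, so that the associativity constraint can act. *)
Let Ξ1 : cell f f (a1 ⊠h (hid A2 ⊠h hid B)) (mcar N) :=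
  recell (mcomp1r _) (mcomp1r _) (Ψ1 • gtens O (cid a1) (upsilon O A2 B)).
Let Θ1 := ε • tcell O Φ1 (cid (hid B)).
Let Θ2 := ε • tcell O Φ2 (cid (hid B)).

Lemma hlunV_tens : ucell (cbwd (hlun (a2 ⊠h hid B)))
  = Ccomp (upsilon O A2 B ⊚ cid (a2 ⊠h hid B)) (Ccomp (xi O (hid A2) a2 (hid B) (hid B))
      (tc (cbwd (hlun a2)) (cbwd (hlun (hid B))))).
Proof.
apply/esym; rewrite -[LHS]Ccomp1l -(cfwdC (hlun (a2 ⊠h hid B))) -[LHS]CcompA.
have := xi_lun (otensorP O) a2 (hid B); rewrite /= tcE -!CcompA => E.
rewrite -[RHS]Ccomp1r; congr Ccomp.
have {}E := congr1 (fun γ => Ccomp γ (tc (cbwd (hlun a2)) (cbwd (hlun (hid B))))) E.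
by move: E; rewrite -!CcompA tcC !cbwdC tc1.
Qed.

Lemma hrunV_tens : ucell (cbwd (hrun (a2 ⊠h hid B)))
  = Ccomp (cid (a2 ⊠h hid B) ⊚ upsilon O A2 B) (Ccomp (xi O a2 (hid A2) (hid B) (hid B))
      (tc (cbwd (hrun a2)) (cbwd (hlun (hid B))))).
Proof.
apply/esym; rewrite -[LHS]Ccomp1l -(cfwdC (hrun (a2 ⊠h hid B))) -[LHS]CcompA.
have := xi_run (otensorP O) a2 (hid B); rewrite /= tcE -!CcompA => E.
rewrite -[RHS]Ccomp1r; congr Ccomp.
have {}E := congr1 (fun γ => Ccomp γ (tc (cbwd (hrun a2)) (cbwd (hlun (hid B))))) E.
by move: E; rewrite -!CcompA tcC -hlun_hrun !cbwdC tc1.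
Qed.

(** [eval_star] moves the product from [P] to [N], [star_thassoc] rebrackets it, and [hlunV_tens]
    merges the unitors of [a2] and id_B. With [crossr_transfer] it compares commuting in [P] with
    commuting in [N]. *)
Lemma crossl_transfer : Ccomp (crossl Ψ1 Ψ2) (thassoc O a1 a2 (hid B))
  = Ccomp ε (tc (crossl Φ1 Φ2) (Cid (hid B))).
Proof.
have eΞ1 : ucell Ξ1 = Ccomp Ψ1 (tc (cid a1) (upsilon O A2 B)) by rewrite /= tcE.
have e2 : ucell Ψ2 = Ccomp Ψ2 (tc (cid (hid A1)) (cid (a2 ⊠h hid B))).
  by rewrite tc1 Ccomp1r.
have eΘ1 : ucell Θ1 = Ccomp ε (tc Φ1 (cid (hid B))) by rewrite /= tcE.
have eΘ2 : ucell Θ2 = Ccomp ε (tc Φ2 (cid (hid B))) by rewrite /= tcE.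
have t1 : ucell Θ1 = Ccomp Ξ1 (thassoc O a1 (hid A2) (hid B)) by rewrite eΘ1 -E1 /= tcE.
have t2 : ucell Θ2 = Ccomp Ψ2 (thassoc O (hid A1) a2 (hid B)) by rewrite eΘ2 -E2.
have -> : tc (crossl Φ1 Φ2) (Cid (hid B))
   = Ccomp (tc (star Φ1 Φ2) (hlun (hid B)))
       (tc (tc (cbwd (hrun a1)) (cbwd (hlun a2))) (cbwd (hlun (hid B)))).
  by rewrite tcC cbwdC.
rewrite CcompA (eval_star eΘ1 eΘ2) (star_thassoc t1 t2) (star_nat eΞ1 e2) /crossl.
rewrite hlunV_tens hc1C; move: (star Ψ1 Ψ2) => s; rewrite -!CcompA; congr Ccomp.
have := thassoc_nat (omon1P O) (cbwd (hrun a1)) (cbwd (hlun a2)) (cbwd (hlun (hid B))).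
rewrite /= !tcE => ->.
by rewrite !CcompA !tcC !Ccomp1l -!CcompA.
Qed.

Lemma crossr_transfer : Ccomp (crossr Ψ1 Ψ2) (thassoc O a1 a2 (hid B))
  = Ccomp ε (tc (crossr Φ1 Φ2) (Cid (hid B))).
Proof.
have eΞ1 : ucell Ξ1 = Ccomp Ψ1 (tc (cid a1) (upsilon O A2 B)) by rewrite /= tcE.
have e2 : ucell Ψ2 = Ccomp Ψ2 (tc (cid (hid A1)) (cid (a2 ⊠h hid B))).
  by rewrite tc1 Ccomp1r.
have eΘ1 : ucell Θ1 = Ccomp ε (tc Φ1 (cid (hid B))) by rewrite /= tcE.
have eΘ2 : ucell Θ2 = Ccomp ε (tc Φ2 (cid (hid B))) by rewrite /= tcE.
have t1 : ucell Θ1 = Ccomp Ξ1 (thassoc O a1 (hid A2) (hid B)) by rewrite eΘ1 -E1 /= tcE.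
have t2 : ucell Θ2 = Ccomp Ψ2 (thassoc O (hid A1) a2 (hid B)) by rewrite eΘ2 -E2.
have -> : tc (crossr Φ1 Φ2) (Cid (hid B))
   = Ccomp (tc (star Φ2 Φ1) (hlun (hid B)))
       (tc (tc (cbwd (hlun a1)) (cbwd (hrun a2))) (cbwd (hlun (hid B)))).
  by rewrite tcC cbwdC.
rewrite CcompA (eval_star eΘ2 eΘ1) (star_thassoc t2 t1) (star_nat e2 eΞ1) /crossr.
rewrite hrunV_tens hc1C; move: (star Ψ2 Ψ1) => s; rewrite -!CcompA; congr Ccomp.
have := thassoc_nat (omon1P O) (cbwd (hlun a1)) (cbwd (hrun a2)) (cbwd (hlun (hid B))).
rewrite /= !tcE => ->.
by rewrite !CcompA !tcC !Ccomp1l -!CcompA.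
Qed.

End Binary.
End Evaluation.
End CrossTransfer.

(** * Comparison isomorphisms as monad maps *)

Section MonadIsos.
Variables (C : DoubleCategory) (O : OplaxMonoidal C).
Local Notation tc := (tc O).

Lemma monad_map_inverse (A : C) (P Q : MonadOn A) (α : gcell (mcar P) (mcar Q))
    (i : invertible α) : is_monad_map α -> is_monad_map (cinv i).
Proof.
case=> /= m e; split=> /=.
- have -> : ucell (mmu Q) = Ccomp (Ccomp (mmu Q) (α ⊚ α)) (cinv i ⊚ cinv i).
    rewrite -CcompA hcMC -[LHS]Ccomp1r -hc1C; congr Ccomp.
    by apply: hc_eqv; rewrite /= cinvVC.
  by rewrite -m !CcompA cinvC Ccomp1l.
- move: e; rewrite hidm1C !Ccomp1r => e.
  by rewrite -e CcompA cinvC Ccomp1l.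
Qed.

(** Once υ ⊚ υ is split into two whiskerings, the multiplication law is [xi_lun] at identities. *)
Lemma upsilon_multiplicative (A B : C) :
  multiplicative (P := discrete A) (Q := discrete B) (N := discrete (tob O A B)) (f := idm _)
    (upsilon O A B).
Proof.
split; last by rewrite star1E hidm1C /= !Ccomp1l tc1 Ccomp1r.
rewrite /= /star_cell /=.
have -> : ucell (upsilon O A B ⊚ upsilon O A B)
    = Ccomp (cid _ ⊚ upsilon O A B) (upsilon O A B ⊚ cid _).
  by rewrite hcMC; apply: hc_eqv; rewrite /= ?Ccomp1l ?Ccomp1r.
rewrite !CcompA (hlun_natC (i := cid _)) ?hidm1C // -!CcompA.
by have := xi_lun (otensorP O) (hid A) (hid B); rewrite /= tcE -!CcompA => ->.
Qed.

(** Together with [upsilons_inv] it lets a tensor of discrete monads be exchanged for the discrete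
    monad on the tensor product. *)
Lemma upsilons_monad_map (N : Normal O) (Γ : inputs C) :
  is_monad_map (M := discretes N Γ) (N := discrete (tens_ob O Γ)) (upsilons N Γ).
Proof.
elim: Γ => [A|Γ IH A]; first exact: (monad_map_id (discrete (mob A))).
apply/tens_monad_mapP.
apply: (multiplicative_comp (P := discrete _) (Q := discrete _) (Q' := discrete _)
  (α := upsilons N Γ) (β := cid (hid (mob A))) IH (monad_map_id (discrete _)) _
  (upsilon_multiplicative _ _)).
by rewrite /= tcE.
Qed.

Lemma multiplicative_post (A B D E : C) (P : MonadOn A) (Q : MonadOn B) (M : MonadOn D)
    (N : MonadOn E) (f : Hom (tob O A B) D) (g : Hom D E) (h : Hom (tob O A B) E)
    (t : cell f f (thor O (mcar P) (mcar Q)) (mcar M)) (φ : cell g g (mcar M) (mcar N))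
    (ψ : cell h h (thor O (mcar P) (mcar Q)) (mcar N)) :
  ucell ψ = Ccomp φ t -> multiplicative t -> is_monad_map φ -> multiplicative ψ.
Proof.
move=> eψ [tm te] [/= φm φe].
have eh : h = g ∘ f by rewrite -(lftE ψ) eψ lft_comp !lftE.
split; rewrite eψ -CcompA ?tm ?te.
- rewrite /= /star_cell CcompA φm -CcompA [X in Ccomp _ X]CcompA hcMC.
  by congr Ccomp; congr Ccomp; apply: hc_eqv.
- by rewrite eh !star1E CcompA φe hidmM /= -!CcompA.
Qed.

(** The left unit constraint with I_1 replaced, along ι, by the identity of I_0; [unit_cellV] is its
    inverse. *)
Definition unit_cell (N : Normal O) (B : C) (b : hor B B) :
    cell (fwd (tlun O B)) (fwd (tlun O B)) (thor O (hid (tI O)) b) b :=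
  recell (mcomp1r _) (mcomp1r _) (thlun O b • gtens O (cinv (iota_inv N)) (cid b)).

Lemma unit_cellE (N : Normal O) (B : C) (b : hor B B) :
  ucell (unit_cell N b) = Ccomp (thlun O b) (tc (cinv (iota_inv N)) (Cid b)).
Proof. by rewrite /= tcE. Qed.

Definition unit_cellV (B : C) (b : hor B B) :
    cell (bwd (tlun O B)) (bwd (tlun O B)) b (thor O (hid (tI O)) b) :=
  recell (mcomp1l _) (mcomp1l _) (gtens O (iota O) (cid b) • cbwd (thlun O b)).

Lemma unit_cellK (N : Normal O) (B : C) (b : hor B B) :
  Ccomp (unit_cell N b) (unit_cellV b) = Cid b.
Proof.
by rewrite unit_cellE /= tcE -CcompA (CcompK (tcC _ _ _ _ _)) cinvC Ccomp1l tc1 Ccomp1l cbwdC.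
Qed.

Lemma unit_cellVK (N : Normal O) (B : C) (b : hor B B) :
  Ccomp (unit_cellV b) (unit_cell N b) = Cid _.
Proof.
by rewrite unit_cellE /= tcE -CcompA (CcompK (cfwdC _)) Ccomp1l tcC cinvVC Ccomp1l tc1.
Qed.

Lemma unit_cell_multiplicative (N : Normal O) (B : C) (M : MonadOn B) :
  multiplicative (P := discrete (tI O)) (Q := M) (unit_cell N (mcar M)).
Proof.
(* By [delta_lun], δ corresponds under ι to the inverse unitor of the identity; this makes
   [xi_thlun] applicable. *)
have ιδ : Ccomp (cinv (iota_inv N) ⊚ cinv (iota_inv N)) (cbwd (hlun (hid (tI O))))
    = Ccomp (delta O) (cinv (iota_inv N)).
  have : Ccomp (hlun (hid (tI O))) (Ccomp (iota O ⊚ iota O) (delta O)) = iota O.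
    have -> : ucell (iota O ⊚ iota O) = Ccomp (cid _ ⊚ iota O) (iota O ⊚ cid _).
      by rewrite hcMC; apply: hc_eqv; rewrite /= ?Ccomp1l ?Ccomp1r.
    rewrite -CcompA CcompA (hlun_natC (i := cid _)) ?hidm1C // -CcompA.
    have := delta_lun (ounitP O); rewrite /= -CcompA => ->.
    exact: Ccomp1r.
  move/ciso_moveL => E.
  have {}E := congr1 (fun γ => Ccomp (cinv (iota_inv N) ⊚ cinv (iota_inv N))
    (Ccomp γ (cinv (iota_inv N)))) E.
  move: E; rewrite -!CcompA cinvVC Ccomp1r CcompA hcMC => <-.
  rewrite -[RHS]Ccomp1l -hc1C; congr Ccomp.
  by apply: hc_eqv; rewrite /= cinvC.
split.
- rewrite -[RHS]Ccomp1r -tc1 -(cfwdC (hlun (hid (tI O)))) -[Cid (mcar M ⊙ mcar M)]Ccomp1l.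
  rewrite -tcC [RHS]CcompA.
  have -> : Ccomp (star (unit_cell N (mcar M)) (unit_cell N (mcar M)))
       (tc (cbwd (hlun (hid (tI O)))) (Cid (mcar M ⊙ mcar M)))
     = Ccomp (mmu M) (Ccomp (thlun O (mcar M ⊙ mcar M))
        (tc (cinv (iota_inv N)) (Cid (mcar M ⊙ mcar M)))).
    rewrite /= /star_cell -!CcompA; congr Ccomp.
    have -> : ucell (unit_cell N (mcar M) ⊚ unit_cell N (mcar M))
        = Ccomp (thlun O (mcar M) ⊚ thlun O (mcar M))
           (tcell O (cinv (iota_inv N)) (cid _) ⊚ tcell O (cinv (iota_inv N)) (cid _)).
      by rewrite hcMC; apply: hc_eqv.
    rewrite -CcompA [X in Ccomp _ X]CcompA -xi_natR -CcompA tcC hc1C ιδ.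
    have := xi_thlun (oconstrP O) (mcar M) (mcar M); rewrite /= tcE => <-.
    by rewrite -!CcompA tcC.
  rewrite unit_cellE -!CcompA !tcC.
  have := thlun_nat (omon1P O) (mmu M); rewrite /= tcE => E.
  rewrite !CcompA -E -!CcompA tcC /=.
  by rewrite !Ccomp1l !Ccomp1r.
- rewrite unit_cellE star1E -CcompA tcC Ccomp1l.
  have := upsilon_thlun (oconstrP O) B; rewrite /= tcE => E.
  have := thlun_nat (omon1P O) (meta M); rewrite /= tcE => E'.
  have -> : tc (Ccomp (cinv (iota_inv N)) (Cid (hid (tI O)))) (meta M)
     = Ccomp (tc (Cid (thI O)) (meta M)) (tc (cinv (iota_inv N)) (Cid (hid B))).
    by rewrite tcC Ccomp1l !Ccomp1r.
  rewrite CcompA E' -E -!CcompA tcC cinvVC Ccomp1l tc1.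
  by rewrite Ccomp1r.
Qed.

(** Used for empty input lists. Backwards, [unit_cell] is invertible and so are the relevant ξ and
    υ, so they cancel from the equations for ψ. *)
Lemma unit_monad_map (N : Normal O) (B D : C) (M : MonadOn B) (R : MonadOn D) (f : Hom B D)
    (g : Hom (tob O (tI O) B) D) (φ : cell f f (mcar M) (mcar R))
    (ψ : cell g g (thor O (hid (tI O)) (mcar M)) (mcar R)) :
  ucell ψ = Ccomp φ (unit_cell N (mcar M)) ->
  is_monad_map φ <-> multiplicative (P := discrete (tI O)) (Q := M) ψ.
Proof.
move=> eψ; have [tm te] := unit_cell_multiplicative N M.
split; first exact: (multiplicative_post (P := discrete (tI O)) eψ (unit_cell_multiplicative N M)).
case=> ψm ψe.
have eg : g = f ∘ fwd (tlun O B) by rewrite -(lftE ψ) eψ lft_comp !lftE.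
set t := unit_cell N (mcar M) in eψ tm te *.
split=> /=.
- have eT : epi (Ccomp (t ⊚ t) (xi O (hid (tI O)) (hid (tI O)) (mcar M) (mcar M))).
    apply: epi_comp; last exact: (epi_giso (xi_invl N _ _ _)).
    apply: (epi_section (β := unit_cellV (mcar M) ⊚ unit_cellV (mcar M))).
    by rewrite hcMC -hc1C; apply: hc_eqv; apply: unit_cellK.
  apply: eT; rewrite -CcompA.
  transitivity (ucell (star ψ ψ)).
    by rewrite -ψm eψ -CcompA tm.
  rewrite /= /star_cell -!CcompA [X in _ = Ccomp _ X]CcompA hcMC; congr Ccomp; congr Ccomp.
  exact: hc_eqv.
- have eT : epi (Ccomp (hidm (fwd (tlun O B))) (upsilon O (tI O) B)).
    apply: epi_comp; last exact: (epi_giso (upsilon_inv N _ _)).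
    apply: (epi_section (β := hidm (bwd (tlun O B)))).
    have := hidmM (fwd (tlun O B)) (bwd (tlun O B)); rewrite /= => <-.
    by rewrite bwdK hidm1C.
  apply: eT; rewrite -CcompA.
  transitivity (ucell (star1 R g)).
    by rewrite -ψe eψ -CcompA te.
  by rewrite star1E eg hidmM /= -!CcompA.
Qed.

End MonadIsos.

(** * Composition with evaluation as a bijection *)

Section Currying.
Variables (C : DoubleCategory) (O : OplaxMonoidal C) (N : Normal O).
Local Notation tc := (tc O).
Local Notation "A ⊠ B" := (tob O A B) : dbl_scope.
Local Notation "x ⊠h y" := (thor O x y) : dbl_scope.

Lemma premulti_eq (Γ : inputs C) (B : Monad C) (m m' : PreMulti N Γ B) :
  mmap m = mmap m' -> (forall i, mcell m i ≡ mcell m' i) -> m = m'.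
Proof.
case: m m' => [f φ] [f' φ'] /= ef; subst f' => e; congr mkPreMulti.
by apply: functional_extensionality_dep => i; apply: ucell_inj.
Qed.

Variables (P B D : Monad C) (e : Hom (mob P ⊠ mob B) (mob D))
  (ε1 : cell e e (mcar P ⊠h hid (mob B)) (mcar D))
  (ε2 : cell e e (hid (mob P) ⊠h mcar B) (mcar D)).

Definition eval_multi : PreMulti N (snoc (one P) B) D :=
  @mkPreMulti C O N (snoc (one P) B) D e
    (fun i => match i return cell e e (mcar (@placed C O N (snoc (one P) B) i)) (mcar D) with
      | Some _ => ε1
      | None => ε2
      end).

Hypotheses (m1 : multiplicative (P := P) (Q := discrete (mob B)) ε1)
  (m2 : multiplicative (P := discrete (mob P)) (Q := B) ε2)
  (c : commutes ε1 ε2) (u1 : universal ε2 ε1)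
  (u2 : forall (A : C) (f : Hom (A ⊠ mob B) (mob D))
    (ψ : cell f f (hid A ⊠h mcar B) (mcar D)),
    multiplicative (P := discrete A) (Q := B) ψ ->
    exists! k : Hom A (mob P), Ccomp ε2 (tc (hidm k) (Cid (mcar B))) = ψ).

Lemma eval_commuting : is_commuting eval_multi.
Proof.
split.
- case=> [i|]; first exact/tens_monad_mapP.
  exact/tens_monad_mapP.
- case=> [[]|] i /=.
  apply/commuting2P; apply: (commutes_nat (α := cid _) (β := cid _) _ _ c).
  + by rewrite /= hidm1C tc1.
  + by rewrite /= tcE hidm1C.
Qed.

Lemma restrict_multiplicative (A : C) (k : Hom A (mob P)) (f : Hom (A ⊠ mob B) (mob D))
    (ψ : cell f f (hid A ⊠h mcar B) (mcar D)) :
  ucell ψ = Ccomp ε2 (tc (hidm k) (Cid (mcar B))) ->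
  multiplicative (P := discrete A) (Q := B) ψ.
Proof.
move=> eψ; apply: (multiplicative_comp (P := discrete _) (P' := discrete _) (β := cid (mcar B))
  (hidm_monad_map k) (monad_map_id B) eψ m2).
Qed.

Lemma restrict_inj (A : C) (k k' : Hom A (mob P)) :
  Ccomp ε2 (tc (hidm k) (Cid (mcar B))) = Ccomp ε2 (tc (hidm k') (Cid (mcar B))) -> k = k'.
Proof.
move=> E; pose ψ := ε2 • tcell O (hidm k) (cid (mcar B)).
have eψ : ucell ψ = Ccomp ε2 (tc (hidm k) (Cid (mcar B))) by rewrite /= tcE.
have [k0 [_ k0U]] := u2 (restrict_multiplicative eψ).
by rewrite -(k0U k) ?(k0U k') // eψ.
Qed.

Section NonEmpty.
Variable Γ : inputs C.
Implicit Types m : PreMulti N Γ P.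

Lemma compose_SomeE m (i : pos Γ) :
  ucell (mcell (compose_pos eval_multi m) (Some i : pos (snoc Γ B)))
  = Ccomp ε1 (tc (mcell m i) (Cid (hid (mob B)))).
Proof. by rewrite /= tcE. Qed.

Lemma compose_NoneE m :
  ucell (mcell (compose_pos eval_multi m) (None : pos (snoc Γ B)))
  = Ccomp ε2 (tc (Ccomp (hidm (mmap m)) (upsilons N Γ)) (Cid (mcar B))).
Proof. by rewrite /= !tcE -CcompA tcC Ccomp1l. Qed.

(** The last component determines the vertical map, because [upsilons] is invertible; each other
    component then determines its 2-morphism by [universal_faithful]. *)
Lemma compose_inj m m' : compose_pos eval_multi m = compose_pos eval_multi m' -> m = m'.
Proof.
move=> E.
have E' i : mcell (compose_pos eval_multi m) i ≡ mcell (compose_pos eval_multi m') i.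
  by rewrite E.
have em : mmap m = mmap m'.
  have := E' None; rewrite !compose_NoneE => E0.
  have {}E0 := congr1 (fun γ => Ccomp γ (tc (cinv (upsilons_inv N Γ)) (Cid (mcar B)))) E0.
  move: E0; rewrite -!CcompA !tcC -!CcompA cinvVC !Ccomp1r.
  exact: restrict_inj.
apply: premulti_eq => // i.
have := E' (Some i); rewrite !compose_SomeE.
by apply: (universal_faithful c u1 (k := mmap m)); rewrite ?lftE ?rgtE.
Qed.

(** The conditions involving the last input ([noneP], [lastP]) always hold, being restrictions of
    [m2] and [c]. The others match those for [m] one by one ([someP], [pairP]). *)
Lemma compose_commuting m : is_commuting m <-> is_commuting (compose_pos eval_multi m).
Proof.
have someP (i : pos Γ) : is_monad_map (M := placed N i) (N := P) (mcell m i) <->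
    is_monad_map (M := placed N (Some i : pos (snoc Γ B))) (N := D)
      (mcell (compose_pos eval_multi m) (Some i : pos (snoc Γ B))).
  apply: iff_trans (universal_monad_map c u1 m1 (R := placed N i) (compose_SomeE m i)) _.
  by apply: iff_sym; apply: tens_monad_mapP.
have noneP : is_monad_map (M := placed N (None : pos (snoc Γ B))) (N := D)
    (mcell (compose_pos eval_multi m) (None : pos (snoc Γ B))).
  apply/tens_monad_mapP.
  have hu := monad_map_comp (upsilons_monad_map N Γ) (hidm_monad_map (mmap m)).
  by apply: (multiplicative_comp (Q' := B) (P := discrete _) (β := cid (mcar B)) hu (monad_map_id B) _ m2);
    rewrite compose_NoneE.
have lastP (i : pos Γ) : commutes (A := tens_ob O Γ) (B := mob B)
    (mcell (compose_pos eval_multi m) (pos_before (j := (None : later (snoc Γ B))) i)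
       • regroup_fst N (j := (None : later (snoc Γ B))) i)
    (mcell (compose_pos eval_multi m) (pos_later (None : later (snoc Γ B)))
      • regroup_snd N (None : later (snoc Γ B))).
  apply: (commutes_nat (α := mcell m i) (β := cid (mcar B)) _ _ c).
  - rewrite hidm1C; apply: etrans (compose_SomeE m i).
    exact: Ccomp1r.
  - apply: etrans (congr1 (fun γ => Ccomp γ _) (compose_NoneE m)) _.
    by rewrite /= tcE -CcompA tcC -CcompA cinvVC Ccomp1l Ccomp1r.
have pairP (j : later Γ) (i : pos (before j)) :
  commuting2 (a1 := mcar (placed N i)) (a2 := mcar (placed N (first (from j))))
    (mcell m (pos_before i) • regroup_fst N i) (mcell m (pos_later j) • regroup_snd N j) <->
  commuting2 (a1 := mcar (placed N i))
    (a2 := mcar (placed N (first (from (Some j : later (snoc Γ B))))))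
    (mcell (compose_pos eval_multi m) (pos_before (j := (Some j : later (snoc Γ B))) i)
       • regroup_fst N (j := (Some j : later (snoc Γ B))) i)
    (mcell (compose_pos eval_multi m) (pos_later (Some j : later (snoc Γ B)))
       • regroup_snd N (Some j : later (snoc Γ B))).
  set Ψ1 := mcell (compose_pos eval_multi m) (pos_before (j := (Some j : later (snoc Γ B))) i)
    • regroup_fst N (j := (Some j : later (snoc Γ B))) i.
  set Ψ2 := mcell (compose_pos eval_multi m) (pos_later (Some j : later (snoc Γ B)))
    • regroup_snd N (Some j : later (snoc Γ B)).
  set Φ1 := mcell m (pos_before i) • regroup_fst N i.
  set Φ2 := mcell m (pos_later j) • regroup_snd N j.
  (* [regroup_fst] and [regroup_snd] at [Some j] add an inverse associativity constraint, and the
     former also an inverse of υ; [E1] and [E2] undo these. *)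
  have E1 : Ccomp (Ccomp Ψ1 (tc (Cid (mcar (placed N i))) (upsilon O (tens_ob O (from j)) (mob B))))
      (thassoc O (mcar (placed N i)) (hid (tens_ob O (from j))) (hid (mob B)))
    = Ccomp ε1 (tc Φ1 (cid (hid (mob B)))).
    rewrite /Ψ1 /Φ1 /= !tcE -!CcompA (CcompK (tcC _ _ _ _ _)) (CcompK (tcC _ _ _ _ _)).
    by rewrite cinvC !Ccomp1l tc1 Ccomp1l cfwdC Ccomp1r.
  have E2 : Ccomp Ψ2 (thassoc O (hid (tens_ob O (before j))) (mcar (placed N (first (from j)))) (hid (mob B)))
    = Ccomp ε1 (tc Φ2 (cid (hid (mob B)))).
    by rewrite /Ψ2 /Φ2 /= !tcE -!CcompA cfwdC Ccomp1r tcC Ccomp1l.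
  have L := crossl_transfer m1 E1 E2; have R := crossr_transfer m1 E1 E2.
  (* One direction cancels the associativity constraint, the other cancels evaluation by [ε1]. *)
  split=> /commuting2P h; apply/commuting2P.
    by apply: (epi_ciso (α := thassoc O _ _ (hid (mob B)))); rewrite L R h.
  apply: (universal_faithful c u1 (k := mmap m ∘ regroup O j));
    rewrite ?lft_crossl ?rgt_crossl ?lft_crossr ?rgt_crossr //.
  by rewrite -L -R h.
split=> -[mm mc]; split.
- by case=> [i|] //; apply/someP.
- by case=> [j|] i; [apply/pairP | apply/commuting2P/lastP].
- by move=> i; apply/someP/(mm (Some i)).
- by move=> j i; apply/pairP/(mc (Some j) i).
Qed.

(** The last component yields the vertical map through [u2]; every other component commutes with it
    and so factors through [ε1] by [u1]. *)
Lemma compose_exists (k : PreMulti N (snoc Γ B) D) :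
  is_commuting k -> exists m, compose_pos eval_multi m = k.
Proof.
case=> km kc.
pose ψ0 := mcell k (None : pos (snoc Γ B)).
pose ψ : cell (mmap k) (mmap k) (hid (tens_ob O Γ) ⊠h mcar B) (mcar D) :=
  recell (mcomp1r _) (mcomp1r _) (ψ0 • gtens O (cinv (upsilons_inv N Γ)) (cid (mcar B))).
have eψ : ucell ψ = Ccomp ψ0 (tc (cinv (upsilons_inv N Γ)) (cid (mcar B))) by rewrite /= tcE.
have ψm : multiplicative (P := discrete _) (Q := B) ψ.
  apply: (multiplicative_comp (P := discretes N Γ) (P' := discrete _) (Q := B) (Q' := B)
    _ (monad_map_id B) eψ).
    exact: monad_map_inverse (upsilons_monad_map N Γ).
  by have /tens_monad_mapP := km None.
have [f [fE _]] := u2 ψm.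
have ek : mmap k = e ∘ tmap O f (idm (mob B)).
  by rewrite -(lftE ψ) -fE lft_comp lft_tc !lftE lft_id.
have φP (i : pos Γ) : exists χ : cell f f (mcar (placed N i)) (mcar P),
    Ccomp ε1 (tc χ (Cid (hid (mob B)))) = mcell k (Some i : pos (snoc Γ B)).
  have [||χ [χE _]] := u1 (k := f) (f := mmap k) (x := mcar (placed N i))
    (φ := mcell k (Some i : pos (snoc Γ B))) (ψ := ψ); last by exists χ.
  - by rewrite fE.
  (* The index [None] splits off exactly the last input, so this is the pair formed by input [i] and
     [B]. *)
  have /commuting2P := kc None i.
  apply: (commutes_nat (α := cid _) (β := cid _)).
  - by rewrite hidm1C tc1 /= !Ccomp1r.
  - by rewrite hidm1C tc1 Ccomp1r.
(* The representing 2-morphisms are chosen for all positions at once. *)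
pose χ i := proj1_sig (constructive_indefinite_description _ (φP i)).
have χE i : Ccomp ε1 (tc (χ i) (Cid (hid (mob B)))) = mcell k (Some i : pos (snoc Γ B)).
  exact: proj2_sig (constructive_indefinite_description _ (φP i)).
exists (mkPreMulti χ); apply: premulti_eq => //.
case=> [i|]; first by rewrite compose_SomeE /= χE.
rewrite compose_NoneE /= -[X in tc _ X]Ccomp1l -tcC CcompA fE eψ -CcompA tcC cinvC.
by rewrite Ccomp1l tc1 Ccomp1r.
Qed.

End NonEmpty.

Lemma compose_nilE (m : Hom (tI O) (mob P)) :
  ucell (mcell (compose_nil eval_multi m) (tt : pos (one B)))
  = Ccomp (Ccomp ε2 (tc (hidm m) (Cid (mcar B)))) (unit_cellV O (mcar B)).
Proof. by rewrite /= !tcE -!CcompA. Qed.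

Lemma compose_nil_inj m m' : compose_nil eval_multi m = compose_nil eval_multi m' -> m = m'.
Proof.
move=> E.
have : mcell (compose_nil eval_multi m) (tt : pos (one B))
  ≡ mcell (compose_nil eval_multi m') (tt : pos (one B)) by rewrite E.
rewrite !compose_nilE => {}E.
have := congr1 (fun γ => Ccomp γ (unit_cell N (mcar B))) E.
by rewrite -[LHS]CcompA -[RHS]CcompA unit_cellVK !Ccomp1r => /restrict_inj.
Qed.

(** A single input leaves no pairs, and the monad map condition is transported along [unit_cell]. *)
Lemma compose_nil_commuting m : is_commuting (compose_nil eval_multi m).
Proof.
split=> [[]|[]].
pose ψ := ε2 • tcell O (hidm m) (cid (mcar B)).
have eψ : ucell ψ = Ccomp ε2 (tc (hidm m) (Cid (mcar B))) by rewrite /= tcE.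
apply/(unit_monad_map (N := N) (ψ := ψ)); last exact: restrict_multiplicative eψ.
by rewrite compose_nilE -[RHS]CcompA unit_cellVK Ccomp1r.
Qed.

Lemma compose_nil_exists (k : PreMulti N (one B) D) :
  is_commuting k -> exists m, compose_nil eval_multi m = k.
Proof.
case=> km _.
pose φ := mcell k (tt : pos (one B)).
have ψm : multiplicative (P := discrete _) (Q := B) (φ • unit_cell N (mcar B)).
  have /unit_monad_map := km tt; apply; exact: erefl.
have [f [fE _]] := u2 ψm.
exists f; have E : mcell (compose_nil eval_multi f) (tt : pos (one B)) ≡ φ.
  by rewrite compose_nilE fE -[LHS]CcompA unit_cellK Ccomp1r.
apply: premulti_eq; last by case.
by rewrite -(lftE φ) -E lftE.
Qed.

End Currying.

Theorem proposition4p3p3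
    (C : DoubleCategory) (O : OplaxMonoidal C)
    (S : Symmetric O) (N : Normal O) (K : Closed O)
    (hfib : fibrant C)
    (hcoprod : forall A : C, has_finite_coproducts (Mnd A))
    (heq : has_equalisers C)
    (htab : has_1_tabulators C)
    (hfree : forall A : C, has_left_adjoint (forget_monad A))
    (hcoeq : forall A : C, has_coequalisers (Mnd A))
    (hloceq : has_local_equalisers C) :
  forall B D : Monad C,
  exists (H : Monad C) (e : PreMulti N (snoc (one H) B) D),
    is_commuting e /\
    forall Γ : option (inputs C),
      (forall m : PreMulti_opt N Γ H,
         is_commuting_opt m -> is_commuting (compose1 e m)) /\
      (forall k : PreMulti N (snoc_opt Γ B) D,
         is_commuting k ->
         exists! m : PreMulti_opt N Γ H, is_commuting_opt m /\ compose1 e m = k).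
Proof.
move=> B D.
(* The object and [ε2] come first, since the horizontal map is the centraliser of [ε2]. *)
have [H [e [ε2 [m2 u2]]]] := represent_vert K D B heq htab.
have [h [ε0 [c0 u0]]] := represent_commuting K hfib hloceq ε2.
have [P [ε1 [m1 c u1]]] := hom_monad c0 u0.
exists (mkMonad P), (@eval_multi _ _ _ (mkMonad P) B D e ε1 ε2); split.
  exact: (eval_commuting N (P := mkMonad P) m1 m2 c).
case=> [Γ|]; split=> [m|k] /=.
- by move/(compose_commuting (P := mkMonad P) m1 m2 c u1).
- move=> kc; have [m mE] := compose_exists (P := mkMonad P) u1 u2 kc.
  exists m; split; first by split=> //; apply/(compose_commuting (P := mkMonad P) m1 m2 c u1); rewrite mE.
  move=> m' [_ m'E].
  exact: (compose_inj (P := mkMonad P) m2 c u1 u2 (etrans mE (esym m'E))).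
- by move=> _; exact: (@compose_nil_commuting C O N (mkMonad P) B D e ε1 ε2 m2 m).
- move=> kc; have [m mE] := compose_nil_exists (P := mkMonad P) ε1 u2 kc.
  exists m; split=> // m' [_ m'E].
  exact: (compose_nil_inj (P := mkMonad P) m2 u2 (etrans mE (esym m'E))).
Qed.
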